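(* Let $\Delta>0$ and let $g\in D^\omega(\mathbb{T},\Delta)$ be an analytic circle diffeomorphism with irrational rotation number $\alpha$, with $\inf_{B_\Delta}\mathrm{Re}\,Dg>0$ and $\|D\log Dg\|_{C^0(B_\Delta)}<1/9$. Let $(p_n/q_n)_{n\ge 0}$ be the sequence of convergents of $\alpha$ given by the continued fraction algorithm. Given $C_0>0$ there is $n_0\ge 0$ large enough such that there is a sequence of Jordan curves $(\gamma_n)_{n\ge n_0}$, homotopic to $\mathbb{S}^1$ and exterior to $\overline{\mathbb{D}}$, such that for every $n\geq n_0$ all the iterates $g^j$, $0\le j\le q_n$, are defined in a neighborhood of the closure of the annulus $U_n$ bounded by $\mathbb{S}^1$ and $\gamma_n$, and $$\mathcal{D}_P(g^j(\gamma_n),\gamma_n)\le C_0\qquad(0\le j\le q_n).$$ Moreover, for any $z\in\gamma_n$, $d_P(g^{q_n}(z),z)\le C_0$, that is, $\|g^{q_n}-\mathrm{id}\|_{C^0_P(\gamma_n)}\le C_0$.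
   Context: $\mathbb{T}=\mathbb{R}/\mathbb{Z}$, $\mathbb{D}$ is the open unit disk, $\mathbb{S}^1=\partial\mathbb{D}$. $D^\omega(\mathbb{T})$ is the space of increasing real-analytic diffeomorphisms $g$ of $\mathbb{R}$ with $g(x+1)=g(x)+1$. For $\Delta>0$, $B_\Delta=\{z\in\mathbb{C}:|\mathrm{Im}\,z|<\Delta\}$, and $D^\omega(\mathbb{T},\Delta)$ is the set of $g\in D^\omega(\mathbb{T})$ extending to a holomorphic diffeomorphism, still denoted $g$, such that $g$ and $g^{-1}$ are defined on a neighborhood of $\overline{B_\Delta}$. In the statement about curves, $g$ also denotes the corresponding map near $\mathbb{S}^1$ obtained through the exponential map $z\mapsto e^{2\pi i z}$ or its conjugate by $w\mapsto 1/\overline{w}$ (so that the upper half plane corresponds to the exterior $\mathbb{C}\setminus\overline{\mathbb{D}}$). $d_P$ is the Poincaré distance in $\mathbb{C}\setminus\overline{\mathbb{D}}$ (the metric whose lift to the universal cover, the upper half plane, is $|d\xi|/\mathrm{Im}\,\xi$), $\mathcal{D}_P$ is the Hausdorff distance between compact sets associated to $d_P$, and $\|g^{q_n}-\mathrm{id}\|_{C^0_P(\gamma_n)}=\sup_{z\in\gamma_n}d_P(g^{q_n}(z),z)$. *)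

(* Defs.v *)
From HB Require Import structures.
From mathcomp Require Import all_boot all_order all_algebra.
From mathcomp Require Import all_classical all_reals all_analysis.
From mathcomp Require Import complex.

Set Implicit Arguments.
Unset Strict Implicit.
Unset Printing Implicit Defensive.

Import Order.TTheory GRing.Theory Num.Theory.
Import numFieldNormedType.Exports.

Local Open Scope classical_set_scope.
Local Open Scope ring_scope.
Local Open Scope complex_scope.

(* [R[i]^o] is [R[i]] seen as a normed module over itself, so [derivable f z 1]
   and [derive1 f z] are complex differentiability and the complex derivative.
   [Normc.normc] is the modulus with values in [R]; the norm [`|_|] of [R[i]]
   has values in [R[i]]. *)

Definition real_analytic (R : realType) (f : R -> R) : Prop :=
  forall x : R, exists a : nat -> R, \forall y \near x,
    series (fun n => a n * (y - x) ^+ n) @ \oo --> f y.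

Definition circle_analytic_diffeo (R : realType) (g : R -> R) : Prop :=
  [/\ {homo g : x y / x < y},
      forall x, g (x + 1) = g x + 1,
      real_analytic g &
      exists h : R -> R, [/\ cancel g h, cancel h g & real_analytic h]].

Definition holomorphic_on (R : realType) (V : set R[i]^o)
    (f : R[i]^o -> R[i]^o) : Prop :=
  forall z, V z -> derivable f z 1.

Definition strip (R : realType) (Delta : R) : set R[i]^o :=
  [set z | `|complex.Im z| < Delta].

(* [V] is the domain of the extension [gc] of [g] and [W], the image of [V],
   is the domain of the inverse. As [g] is the lift of a circle map, [gc] is
   the lift of a map of a neighbourhood of the circle in C/Z, so [V] is
   invariant under [z |-> z + 1] and [gc] commutes with it. *)
Definition holo_diffeo_extension (R : realType) (Delta : R) (g : R -> R)
    (V : set R[i]^o) (gc : R[i]^o -> R[i]^o) : Prop :=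
  [/\ open V /\ closure (strip Delta) `<=` V,
      forall x : R, gc x%:C = (g x)%:C,
      forall z, V (z + 1) <-> V z,
      forall z, V z -> gc (z + 1) = gc z + 1 &
      exists (W : set R[i]^o) (h : R[i]^o -> R[i]^o),
        [/\ open W /\ closure (strip Delta) `<=` W,
            holomorphic_on V gc,
            holomorphic_on W h,
            forall z, V z -> W (gc z) /\ h (gc z) = z &
            forall w, W w -> V (h w) /\ gc (h w) = w]].

(* The principal branch of the logarithm, on the right half-plane only. *)
Definition clog (R : realType) (w : R[i]^o) : R[i]^o :=
  ln (Normc.normc w) +i* atan (complex.Im w / complex.Re w).

Definition rotation_number (R : realType) (g : R -> R) : R :=
  lim ((fun n : nat => iter n g 0 / n%:R) @ \oo).

Fixpoint complete_quotient (R : realType) (alpha : R) (n : nat) : R :=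
  if n is m.+1 then
    let x := complete_quotient alpha m in (x - (Num.floor x)%:~R)^-1
  else alpha.

Definition partial_quotient (R : realType) (alpha : R) (n : nat) : int :=
  Num.floor (complete_quotient alpha n).

(* The pair ((p_(n-1), q_(n-1)), (p_n, q_n)), where (p_(-1), q_(-1)) = (1, 0)
   and (p_0, q_0) = (a_0, 1). *)
Fixpoint convergent_pair (R : realType) (alpha : R) (n : nat) :
    (int * int) * (int * int) :=
  if n is m.+1 then
    let: (u, v) := convergent_pair alpha m in
    let a := partial_quotient alpha n in
    (v, (a * v.1 + u.1, a * v.2 + u.2))
  else ((1, 0), (partial_quotient alpha 0, 1)).

Definition convergent (R : realType) (alpha : R) (n : nat) : int * int :=
  (convergent_pair alpha n).2.

Definition convergent_den (R : realType) (alpha : R) (n : nat) : nat :=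
  `|(convergent alpha n).2|%N.

(* The exponential [exp (2 i pi z)] followed by [w |-> 1 / conj w]; it is the
   universal covering of the exterior of the closed unit disk by the upper
   half-plane. *)
Definition outer_cover (R : realType) (z : R[i]^o) : R[i]^o :=
  (expR (2 * pi * complex.Im z) * cos (2 * pi * complex.Re z))
  +i* (expR (2 * pi * complex.Im z) * sin (2 * pi * complex.Re z)).

(* The map induced by [gc] through [outer_cover]. Preimages of [w] differ by
   integers, so the value does not depend on the chosen one when [w] is in
   [annulus_dom V]. *)
Definition annulus_map (R : realType) (gc : R[i]^o -> R[i]^o) (w : R[i]^o) :
    R[i]^o :=
  outer_cover (gc (xget 0 [set z | outer_cover z = w])).

Definition annulus_dom (R : realType) (V : set R[i]^o) : set R[i]^o :=
  @outer_cover R @` V.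

Definition iter_defined (R : realType) (V : set R[i]^o)
    (gc : R[i]^o -> R[i]^o) (j : nat) (w : R[i]^o) : Prop :=
  forall i, (i < j)%N -> annulus_dom V (iter i (annulus_map gc) w).

Definition jordan_curve (R : realType) (c : R -> R[i]^o) : Prop :=
  [/\ {within `[0, 1], continuous c}, c 0 = c 1 &
      {in `[0, 1[ &, injective c}].

(* Free homotopy of closed curves in the complement of the open unit disk. *)
Definition homotopic_to_circle (R : realType) (c : R -> R[i]^o) : Prop :=
  exists H : R * R -> R[i]^o,
    {within `[0, 1] `*` `[0, 1], continuous H} /\
    forall s t : R, s \in `[0, 1] -> t \in `[0, 1] ->
      [/\ H (0, t) = outer_cover t%:C,
          H (1, t) = c t,
          H (s, 0) = H (s, 1) &
          1 <= Normc.normc (H (s, t))].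

Definition curve_image (R : realType) (c : R -> R[i]^o) : set R[i]^o :=
  c @` `[0, 1].

(* The annulus between the unit circle and [gamma]: the part outside the
   closed disk of the bounded components of the complement of [gamma]. *)
Definition annulus_below (R : realType) (gamma : set R[i]^o) : set R[i]^o :=
  [set w | [/\ 1 < Normc.normc w, ~ gamma w &
               bounded_set (connected_component (~` gamma) w)]].

Definition C1 (R : realType) (x : R -> R) : Prop :=
  (forall t, derivable x t 1) /\ continuous (derive1 x).

(* Length of the path [x + i y] over [0, 1] for the metric |d xi| / Im xi. *)
Definition hyperbolic_length (R : realType) (x y : R -> R) : \bar R :=
  (\int[lebesgue_measure]_(t in `[0%R, 1%R])
     (Num.sqrt (derive1 x t ^+ 2 + derive1 y t ^+ 2) / y t)%:E)%E.

(* Paths in the exterior of the closed disk are measured through their lifts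
   to the upper half-plane. The value is [+oo] unless [w1] and [w2] both lie
   in this exterior. *)
Definition poincare_dist (R : realType) (w1 w2 : R[i]^o) : \bar R :=
  ereal_inf [set l | exists x y : R -> R,
    [/\ C1 x /\ C1 y,
        forall t, t \in `[0, 1] -> 0 < y t,
        outer_cover (x 0 +i* y 0) = w1,
        outer_cover (x 1 +i* y 1) = w2 &
        l = hyperbolic_length x y]].

Definition hausdorff_dist (R : realType) (T : Type) (d : T -> T -> \bar R)
    (A B : set T) : \bar R :=
  maxe (ereal_sup [set ereal_inf [set d a b | b in B] | a in A])
       (ereal_sup [set ereal_inf [set d a b | a in A] | b in B]).

(* Main.v *)
Require Import Defs.
From HB Require Import structures.
From mathcomp Require Import all_boot all_order all_algebra.
From mathcomp Require Import all_classical all_reals all_analysis.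
From mathcomp Require Import complex.
From mathcomp Require Import ring lra zify.

Import Order.TTheory GRing.Theory Num.Theory.
Import numFieldNormedType.Exports.
Local Open Scope classical_set_scope.
Local Open Scope ring_scope.
Local Open Scope complex_scope.

Set Implicit Arguments.
Unset Strict Implicit.
Unset Printing Implicit Defensive.

(** Among the lifts of the closest return [g^(q_n)] and of its inverse, let [e] be the one that moves
    the real points to the right by the least amount, and let [gap n x = e x - x]. The curve
    is the image under the covering of the graph of [H = K * gap n], where [K] is large
    compared with [1 / C0]. At height [H], a displacement by one gap has hyperbolic
    length about [1 / K]; so [g^(q_n)] moves the points of the curve little, and the graph
    is almost invariant, as soon as the iterates [g^j], [0 <= j <= q_n], are almost
    affine on the window of size [O(K * gap n x)] around each real point [x]: then
    [g^j (x + i H x)] is close to [g^j x + i H (g^j x)] at the scale [H (g^j x)]. This is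
    the lemma [curve_estimates].

    That the iterates are almost affine is proved with cross-ratios. The expression
    [cross_defect], which vanishes if the map preserves a cross-ratio, is holomorphic
    in each of the four points and vanishes when two of them coincide. By a Schwarz lemma
    with several zeros ([schwarz_nodes]), it is bounded by the product of the six differences
    ([cross_defect_near]). So a holomorphic map distorts the cross-ratio of [a, b, c, d] by
    a factor [1 + O(|b - c| |d - a|)] only, of second order in the size of the
    configuration.

    On the real line, consider the cross-ratio [chi] of [y, e y, e^2 y, e^3 y], which is
    4 if they are evenly spaced. It is at most 4 where the middle gap is the
    smallest one ([chi_min]). Along [q_(n+1)] iterates, the intervals [[y, e y[] are disjoint modulo 1, so
    the sum of the gaps is bounded ([gap_sum]). Every point is reached, up to one gap, by
    an orbit of length [q_(n+1) + q_n] ([cover]), hence [chi] is bounded everywhere.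
    Then adjacent gaps are comparable and this forces the gaps to decay geometrically
    ([gap_small]): this is Denjoy's theorem. The total distortion, of the order of the sum of the
    squares of the gaps, is now at most the largest gap up to a constant, so [chi <= 4 + delta]
    on long stretches of the grid of the [e^i y], for [n] large. The ratio of
    successive gaps on such a stretch, if it exceeded 1 significantly, would go on
    increasing, but it is bounded; so neighbouring gaps are almost equal ([even_grid]).

    For a complex point [z], the cross-ratio of [e^-1 y, y, e y, z] is almost preserved along
    the orbit, by the same sum. As the three real points are almost evenly spaced at
    all times, the position of [g^j z] in the affine chart of [g^j y] is almost
    the one of [z] in the chart of [y] ([shadowing]). This is the almost affine behaviour.

    The maximum principle behind the Schwarz lemma comes from Goursat's subdivision
    argument, applied to trapezoidal sums instead of integrals. It has a
    constant 2, which disappears by taking powers of the function. *)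

Lemma nat_gt (R : realType) (x : R) : exists n : nat, x < n%:R.
Proof. by exists (Num.Def.truncn x).+1; rewrite truncnS_gt// num_real. Qed.

(** * Modulus, real and imaginary parts *)

Section ComplexNorm.
Variable R : realType.
Implicit Types z w : R[i].

Local Notation N := (@Normc.normc R).

Lemma normcE_C z : `|z| = (N z)%:C.
Proof. by []. Qed.

Lemma nc_ge0 z : 0 <= N z.
Proof. by case: z => a b; rewrite sqrtr_ge0. Qed.

Lemma ncD z w : N (z + w) <= N z + N w.
Proof. exact: (@le_normcD R). Qed.

Lemma ncN z : N (- z) = N z.
Proof. exact: (@normcN R). Qed.

Lemma ncB z w : N (z - w) <= N z + N w.
Proof. by rewrite -(ncN w) ncD. Qed.

Lemma ncC z w : N (z - w) = N (w - z).
Proof. by rewrite -ncN opprB. Qed.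

Lemma nc0 : N 0 = 0.
Proof. exact: Normc.normc0. Qed.

Lemma nc1 : N 1 = 1.
Proof. exact: Normc.normc1. Qed.

Lemma ncM z w : N (z * w) = N z * N w.
Proof. exact: Normc.normcM. Qed.

Lemma ncV z : N z^-1 = (N z)^-1.
Proof. exact: Normc.normcV. Qed.

Lemma nc_eq0 z : (N z == 0) = (z == 0).
Proof.
apply/eqP/eqP => [/Normc.eq0_normc//|->]; exact: nc0.
Qed.

Lemma nc_gt0 z : (0 < N z) = (z != 0).
Proof. by rewrite lt_neqAle nc_ge0 andbT eq_sym nc_eq0. Qed.

Lemma ncX z n : N (z ^+ n) = N z ^+ n.
Proof. by elim: n => [|n IH]; rewrite ?expr0 ?nc1// !exprS ncM IH. Qed.

Lemma nc_real (x : R) : N x%:C = `|x|.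
Proof. by rewrite /= expr0n addr0 sqrtr_sqr. Qed.

Lemma nc_sq z : N z ^+ 2 = complex.Re z ^+ 2 + complex.Im z ^+ 2.
Proof. by case: z => a b /=; rewrite sqr_sqrtr// addr_ge0 ?sqr_ge0. Qed.

Lemma nc_Re z : `|complex.Re z| <= N z.
Proof.
rewrite -(@ler_pXn2r _ 2) ?nnegrE ?nc_ge0// nc_sq real_normK ?num_real//.
by rewrite lerDl sqr_ge0.
Qed.

Lemma nc_Im z : `|complex.Im z| <= N z.
Proof.
rewrite -(@ler_pXn2r _ 2) ?nnegrE ?nc_ge0// nc_sq real_normK ?num_real//.
by rewrite lerDr sqr_ge0.
Qed.

Lemma nc_le_ReIm z : N z <= `|complex.Re z| + `|complex.Im z|.
Proof.
rewrite -(@ler_pXn2r _ 2) ?nnegrE ?nc_ge0 ?addr_ge0// nc_sq.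
rewrite -(real_normK (num_real (complex.Re z))).
rewrite -(real_normK (num_real (complex.Im z))).
have := normr_ge0 (complex.Re z); have := normr_ge0 (complex.Im z).
by move=> ? ?; nra.
Qed.

Lemma nc_sum (I : Type) (s : seq I) (F : I -> R[i]) :
  N (\sum_(i <- s) F i) <= \sum_(i <- s) N (F i).
Proof.
elim: s => [|a s IH]; first by rewrite !big_nil nc0.
by rewrite !big_cons (le_trans (ncD _ _))// lerD2l.
Qed.

Lemma nc_dist z w u : N (z - u) <= N (z - w) + N (w - u).
Proof. by have := ncD (z - w) (w - u); rewrite addrA subrK. Qed.

Lemma nc_ge_sub z w : N z - N w <= N (z - w).
Proof. by rewrite lerBlDr; have := ncD (z - w) w; rewrite subrK. Qed.

Lemma ReD z w : complex.Re (z + w) = complex.Re z + complex.Re w.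
Proof. by case: z; case: w. Qed.
Lemma ImD z w : complex.Im (z + w) = complex.Im z + complex.Im w.
Proof. by case: z; case: w. Qed.
Lemma ReN z : complex.Re (- z) = - complex.Re z.
Proof. by case: z. Qed.
Lemma ImN z : complex.Im (- z) = - complex.Im z.
Proof. by case: z. Qed.
Lemma ReM z w : complex.Re (z * w) =
  complex.Re z * complex.Re w - complex.Im z * complex.Im w.
Proof. by case: z; case: w. Qed.
Lemma ImM z w : complex.Im (z * w) =
  complex.Re z * complex.Im w + complex.Im z * complex.Re w.
Proof. by case: z => a b; case: w => c d /=; rewrite [b * c]mulrC. Qed.
Lemma ReMr (x : R) z : complex.Re (x%:C * z) = x * complex.Re z.
Proof. by rewrite ReM /= mul0r subr0. Qed.
Lemma ImMr (x : R) z : complex.Im (x%:C * z) = x * complex.Im z.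
Proof. by rewrite ImM /= mul0r addr0. Qed.
Lemma Im_sum (I : Type) (s : seq I) (F : I -> R[i]) :
  complex.Im (\sum_(i <- s) F i) = \sum_(i <- s) complex.Im (F i).
Proof. by elim: s => [|a s IH]; rewrite ?big_nil// !big_cons ImD IH. Qed.

Lemma complex_ext z w : complex.Re z = complex.Re w ->
  complex.Im z = complex.Im w -> z = w.
Proof. by case: z => a b; case: w => c d /= -> ->. Qed.

Lemma Creal_eq0 (x : R) : (x%:C == 0) = (x == 0).
Proof. by rewrite -(rmorph0 (real_complex R)) (inj_eq (@complexI R)). Qed.

Lemma CintE (k : int) : (k%:~R : R[i]) = (k%:~R)%:C.
Proof. by rewrite rmorph_int. Qed.

End ComplexNorm.

(** * Trapezoidal sums along the boundary of a square *)

Section Goursat.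
Variable R : realType.
Local Notation C := R[i].
Local Notation N := (@Normc.normc R).
Implicit Types (F G : C -> C) (a b p z w : C).

(** Complex differentiability, phrased with the real-valued modulus: the estimates
    below only use this form. *)
Definition cdiff F z := exists l : C, forall eps : R, 0 < eps ->
  exists2 d : R, 0 < d & forall w, N (w - z) < d ->
    N (F w - F z - l * (w - z)) <= eps * N (w - z).

Definition seg a b (t : R) : C := a + t%:C * (b - a).

(** The trapezoidal rule with [n] steps for the integral of [F] along the segment
    from [a] to [b]. It is linear in [F], additive under subdivision of the segment and exact
    on affine functions: Goursat's argument only uses these properties of the integral. *)
Definition trap n F a b : C :=
  \sum_(0 <= k < n) (F (seg a b (k%:R / n%:R)) + F (seg a b (k.+1%:R / n%:R)))
     / 2 * ((b - a) / n%:R).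

Lemma CnatE n : (n%:R : C) = (n%:R : R)%:C.
Proof. by rewrite rmorph_nat. Qed.

Lemma Cnat_neq0 n : (0 < n)%N -> (n%:R : C) != 0.
Proof. by rewrite pnatr_eq0 lt0n. Qed.

Lemma nc_nat n : N n%:R = n%:R.
Proof. by rewrite CnatE nc_real ger0_norm. Qed.

Lemma trap_linear n F G c a b :
  trap n (fun z => F z + c * G z) a b = trap n F a b + c * trap n G a b.
Proof.
by rewrite /trap mulr_sumr -big_split; apply: eq_bigr => k _ /=; ring.
Qed.

Lemma trap_affine n c0 c1 a b : (0 < n)%N ->
  trap n (fun z => c0 + c1 * z) a b = (b - a) * (c0 + c1 * (a + b) / 2).
Proof.
move=> n0; pose U k := let u := seg a b (k%:R / n%:R) in c0 * u + c1 * u ^+ 2 / 2.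
have n0' := Cnat_neq0 n0.
have n0R : (n%:R : R) != 0 by rewrite pnatr_eq0 -lt0n.
transitivity (\sum_(0 <= k < n) (U k.+1 - U k)).
  apply: eq_bigr => k _; rewrite /U/=.
  have -> : seg a b (k.+1%:R / n%:R) = seg a b (k%:R / n%:R) + (b - a) / n%:R.
    by rewrite /seg !rmorphM /= !fmorphV /= !rmorph_nat -natr1; field.
  by field.
rewrite telescope_sumr// /U /seg mul0r divff//= rmorph0 rmorph1; by field.
Qed.

Lemma trap_bound n F a b (M : R) : (0 < n)%N ->
  (forall t, 0 <= t <= 1 -> N (F (seg a b t)) <= M) ->
  N (trap n F a b) <= M * N (b - a).
Proof.
move=> n0 FM; have n0R : 0 < (n%:R : R) by rewrite ltr0n.
apply: le_trans (nc_sum _ _) _.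
have -> : M * N (b - a) = \sum_(0 <= k < n) M * (N (b - a) / n%:R).
  by rewrite sumr_const_nat subn0 -mulr_natr; field; rewrite gt_eqF.
rewrite big_nat [leRHS]big_nat; apply: ler_sum => k /andP[_ kn].
rewrite ncM [N ((b - a) / _)]ncM ncV nc_nat.
apply: ler_wpM2r; first by rewrite mulr_ge0 ?nc_ge0// invr_ge0 ler0n.
rewrite ncM ncV nc_nat ler_pdivrMr//.
rewrite (le_trans (ncD _ _))// mulr2n mulrDr mulr1.
apply: lerD; apply: FM; rewrite divr_ge0 ?ler0n//= ler_pdivrMr// mul1r ler_nat//.
exact: ltnW.
Qed.

(** The rule is an average of values of [F] times [b - a], so it inherits pointwise
    bounds of the integrand. *)
Lemma trap_Im n F a b (m : R) : (0 < n)%N ->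
  (forall t, 0 <= t <= 1 -> m <= complex.Im (F (seg a b t) * (b - a))) ->
  m <= complex.Im (trap n F a b).
Proof.
move=> n0 Fm; have n0R : 0 < (n%:R : R) by rewrite ltr0n.
rewrite /trap Im_sum.
have -> : m = \sum_(0 <= k < n) m / n%:R.
  by rewrite sumr_const_nat subn0 -mulr_natr; field; rewrite gt_eqF.
rewrite big_nat [leRHS]big_nat; apply: ler_sum => k /andP[_ kn].
have h1 := Fm (k%:R / n%:R); have h2 := Fm (k.+1%:R / n%:R).
set u := F _ in h1 *; set v := F _ in h2 *.
have -> : (u + v) / 2 * ((b - a) / n%:R) =
  ((2 * n%:R)^-1 : R)%:C * (u * (b - a) + v * (b - a)).
  by rewrite fmorphV rmorphM /= !rmorph_nat; field; rewrite Cnat_neq0.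
rewrite ImMr ImD ler_pdivrMr// [leRHS]mulrC mulrA.
have -> : n%:R / (2 * n%:R) = 2^-1 :> R by field; rewrite gt_eqF.
have b1 : 0 <= (k%:R / n%:R : R) <= 1.
  by rewrite divr_ge0 ?ler0n//= ler_pdivrMr// mul1r ler_nat// ltnW.
have b2 : 0 <= (k.+1%:R / n%:R : R) <= 1.
  by rewrite divr_ge0 ?ler0n//= ler_pdivrMr// mul1r ler_nat.
have := h1 b1; have := h2 b2; lra.
Qed.

Lemma trap_split m n F a b : (0 < m)%N -> (0 < n)%N ->
  trap (m * n) F a b =
  \sum_(0 <= i < m) trap n F (seg a b (i%:R / m%:R)) (seg a b (i.+1%:R / m%:R)).
Proof.
move=> m0 n0; rewrite /trap big_nat_mul; apply: eq_bigr => i _.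
rewrite -{1}[(i * n)%N]add0n.
rewrite -[X in \sum_(_ <= _ < X) _](@subnK (i * n)); last by rewrite leq_mul2r leqnSn orbT.
rewrite big_addn addnK mulSn addnK; apply: eq_bigr => k _.
have n0R : (n%:R : C) != 0 by rewrite Cnat_neq0.
have m0R : (m%:R : C) != 0 by rewrite Cnat_neq0.
have E j : seg (seg a b (i%:R / m%:R)) (seg a b (i.+1%:R / m%:R)) (j%:R / n%:R)
   = seg a b ((j + i * n)%:R / (m * n)%:R).
  rewrite /seg !rmorphM !fmorphV /= !rmorph_nat natrD !natrM -natr1; field.
  by rewrite m0R n0R.
rewrite !E -addSn; congr (_ * _); rewrite natrM /seg !rmorphM !fmorphV /= !rmorph_nat -natr1.
by field; rewrite m0R n0R.
Qed.

Definition corner p (s : R) (i j : nat) : C := p + s%:C * (i%:R + 'i * j%:R).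

(** The trapezoidal rule for the integral of [F] along the boundary of a square,
    counterclockwise. *)
Definition bdsum n F p (s : R) : C :=
  trap n F (corner p s 0 0) (corner p s 1 0)
  + trap n F (corner p s 1 0) (corner p s 1 1)
  - trap n F (corner p s 0 1) (corner p s 1 1)
  - trap n F (corner p s 0 0) (corner p s 0 1).

Lemma corner_corner p s (i j i' j' : nat) :
  corner (corner p s i j) s i' j' = corner p s (i + i') (j + j').
Proof. by rewrite /corner !natrD; ring. Qed.

Lemma seg_corner_h p s (m i j : nat) : (0 < m)%N ->
  seg (corner p s 0 j) (corner p s 1 j) (i%:R / m%:R) =
  corner p (s / m%:R) i (m * j).
Proof.
move=> m0; rewrite /seg /corner natrM !rmorphM !fmorphV /= !rmorph_nat; field.
by rewrite Cnat_neq0.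
Qed.

Lemma seg_corner_v p s (m i j : nat) : (0 < m)%N ->
  seg (corner p s i 0) (corner p s i 1) (j%:R / m%:R) =
  corner p (s / m%:R) (m * i) j.
Proof.
move=> m0; rewrite /seg /corner natrM !rmorphM !fmorphV /= !rmorph_nat; field.
by rewrite Cnat_neq0.
Qed.

(** The contributions of the inner sides of the subdivision cancel exactly, since
    the nodes of the rule on the small squares are those of the refined rule. *)
Lemma bdsum_split m n F p s : (0 < m)%N -> (0 < n)%N ->
  bdsum (m * n) F p s =
  \sum_(0 <= i < m) \sum_(0 <= j < m)
     bdsum n F (corner p (s / m%:R) i j) (s / m%:R).
Proof.
move=> m0 n0; pose c := corner p (s / m%:R).
pose Hh i j := trap n F (c i j) (c i.+1 j).
pose Vv i j := trap n F (c i j) (c i j.+1).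
transitivity (\sum_(0 <= i < m) Hh i 0 + \sum_(0 <= j < m) Vv m j
   - \sum_(0 <= i < m) Hh i m - \sum_(0 <= j < m) Vv 0 j).
  rewrite /bdsum !trap_split//.
  congr (_ + _ - _ - _); apply: eq_bigr => i _;
    by rewrite ?seg_corner_h ?seg_corner_v// ?muln0 ?muln1.
have -> : \sum_(0 <= i < m) \sum_(0 <= j < m)
     bdsum n F (corner p (s / m%:R) i j) (s / m%:R) =
   \sum_(0 <= i < m) \sum_(0 <= j < m) ((Hh i j - Hh i j.+1) + (Vv i.+1 j - Vv i j)).
  apply: eq_bigr => i _; apply: eq_bigr => j _.
  rewrite /bdsum !corner_corner !addn0 !addn1 /Hh /Vv /c; ring.
transitivity (\sum_(0 <= i < m) (Hh i 0 - Hh i m) + \sum_(0 <= j < m) (Vv m j - Vv 0 j)).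
  rewrite !sumrB; ring.
under [RHS]eq_bigr do rewrite big_split /=.
rewrite [RHS]big_split /=; congr (_ + _).
  apply: eq_bigr => i _.
  have := telescope_sumr (fun j => Hh i j) (leq0n m) => T.
  by rewrite -[LHS]opprB -T -sumrN; apply: eq_bigr => j _; rewrite opprB.
rewrite exchange_big; apply: eq_bigr => j _.
by rewrite (telescope_sumr (fun i => Vv i j) (leq0n m)).
Qed.

Lemma bdsum_linear n F G c p s :
  bdsum n (fun z => F z + c * G z) p s = bdsum n F p s + c * bdsum n G p s.
Proof. by rewrite /bdsum !trap_linear; ring. Qed.

Lemma bdsum_affine n c0 c1 p s : (0 < n)%N ->
  bdsum n (fun z => c0 + c1 * z) p s = 0.
Proof. by move=> n0; rewrite /bdsum !trap_affine// /corner; field. Qed.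

Definition sq p (s : R) : set C := [set z |
  complex.Re p <= complex.Re z <= complex.Re p + s /\
  complex.Im p <= complex.Im z <= complex.Im p + s].

Lemma corner_Re p s i j : complex.Re (corner p s i j) = complex.Re p + s * i%:R.
Proof.
by rewrite /corner ReD ReMr ReD ReM !CnatE/= mul0r mulr0 !subr0 addr0.
Qed.
Lemma corner_Im p s i j : complex.Im (corner p s i j) = complex.Im p + s * j%:R.
Proof.
by rewrite /corner ImD ImMr ImD ImM !CnatE/= mul0r mul1r !add0r.
Qed.

Lemma seg_Re a b t : complex.Re (seg a b t) =
  complex.Re a + t * (complex.Re b - complex.Re a).
Proof. by rewrite /seg ReD ReMr ReD ReN. Qed.
Lemma seg_Im a b t : complex.Im (seg a b t) =
  complex.Im a + t * (complex.Im b - complex.Im a).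
Proof. by rewrite /seg ImD ImMr ImD ImN. Qed.

Definition sqb p (s : R) : set C := [set z | sq p s z /\
  (complex.Re z = complex.Re p \/ complex.Re z = complex.Re p + s \/
   complex.Im z = complex.Im p \/ complex.Im z = complex.Im p + s)].

Lemma nc_corner_h p s j : 0 <= s -> N (corner p s 1 j - corner p s 0 j) = s.
Proof.
move=> s0; have -> : corner p s 1 j - corner p s 0 j = s%:C.
  by rewrite /corner; ring.
by rewrite nc_real ger0_norm.
Qed.

Lemma nc_i : N 'i = 1.
Proof. by rewrite /= expr0n add0r expr1n sqrtr1. Qed.

Lemma nc_corner_v p s i : 0 <= s -> N (corner p s i 1 - corner p s i 0) = s.
Proof.
move=> s0; have -> : corner p s i 1 - corner p s i 0 = s%:C * 'i.
  by rewrite /corner; ring.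
by rewrite ncM nc_i mulr1 nc_real ger0_norm.
Qed.

Lemma seg_sqb p s t i j i' j' : 0 <= s -> 0 <= t <= 1 ->
  (i, j, i', j') \in [:: (0, 0, 1, 0); (1, 0, 1, 1); (0, 1, 1, 1); (0, 0, 0, 1)]%N ->
  sqb p s (seg (corner p s i j) (corner p s i' j') t).
Proof.
move=> s0 /andP[t0 t1].
have ts0 : 0 <= t * s by rewrite mulr_ge0.
have ts1 : t * s <= s by rewrite ler_piMl.
rewrite !inE => /or4P[] /eqP[-> -> -> ->]; rewrite /sqb /sq /=;
  rewrite !seg_Re !seg_Im !corner_Re !corner_Im.
- split; [split; apply/andP; split; nra | right; right; left; ring].
- split; [split; apply/andP; split; nra | right; left; ring].
- split; [split; apply/andP; split; nra | right; right; right; ring].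
- split; [split; apply/andP; split; nra | left; ring].
Qed.

Lemma bdsum_bound n F p s (M : R) : (0 < n)%N -> 0 <= s ->
  (forall z, sqb p s z -> N (F z) <= M) -> N (bdsum n F p s) <= 4 * s * M.
Proof.
move=> n0 s0 FM.
have e1 : N (trap n F (corner p s 0 0) (corner p s 1 0)) <= M * s.
  rewrite -[X in _ <= _ * X](@nc_corner_h p s 0)//.
  by apply: trap_bound => // t t01; apply: FM; apply: seg_sqb.
have e2 : N (trap n F (corner p s 1 0) (corner p s 1 1)) <= M * s.
  rewrite -[X in _ <= _ * X](@nc_corner_v p s 1)//.
  by apply: trap_bound => // t t01; apply: FM; apply: seg_sqb.
have e3 : N (trap n F (corner p s 0 1) (corner p s 1 1)) <= M * s.
  rewrite -[X in _ <= _ * X](@nc_corner_h p s 1)//.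
  by apply: trap_bound => // t t01; apply: FM; apply: seg_sqb.
have e4 : N (trap n F (corner p s 0 0) (corner p s 0 1)) <= M * s.
  rewrite -[X in _ <= _ * X](@nc_corner_v p s 0)//.
  by apply: trap_bound => // t t01; apply: FM; apply: seg_sqb.
rewrite /bdsum.
have := ncB (trap n F (corner p s 0 0) (corner p s 1 0)
  + trap n F (corner p s 1 0) (corner p s 1 1)
  - trap n F (corner p s 0 1) (corner p s 1 1))
  (trap n F (corner p s 0 0) (corner p s 0 1)).
have := ncB (trap n F (corner p s 0 0) (corner p s 1 0)
  + trap n F (corner p s 1 0) (corner p s 1 1))
  (trap n F (corner p s 0 1) (corner p s 1 1)).
have := ncD (trap n F (corner p s 0 0) (corner p s 1 0))
  (trap n F (corner p s 1 0) (corner p s 1 1)).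
lra.
Qed.

End Goursat.

(** * Goursat's theorem for trapezoidal sums *)

Section MaximumPrinciple.
Variable R : realType.
Local Notation C := R[i].
Local Notation N := (@Normc.normc R).
Implicit Types (F G : C -> C) (a b p z w : C).

(** Subdivision in three makes the centre of a square the centre of one subsquare, away from
    all the others; the numbers of steps are powers of 3 so as to be compatible with it. *)
Definition bdsum_small F p (s e : R) := exists k0, forall k, (k0 <= k)%N ->
  N (bdsum (3 ^ k) F p s) <= e.

Lemma pow3_gt0 k : (0 < 3 ^ k)%N.
Proof. by rewrite expn_gt0. Qed.

Lemma bdsum_small_le F p s e e' : e <= e' -> bdsum_small F p s e ->
  bdsum_small F p s e'.
Proof. by move=> ee' [k0 h]; exists k0 => k /h /le_trans; apply. Qed.

Lemma bdsum_small_split F p s (e : nat -> nat -> R) :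
  (forall i j, (i < 3)%N -> (j < 3)%N ->
     bdsum_small F (corner p (s / 3%:R) i j) (s / 3%:R) (e i j)) ->
  bdsum_small F p s (\sum_(0 <= i < 3) \sum_(0 <= j < 3) e i j).
Proof.
move=> h.
have [K hK] : exists K, forall k, (K <= k)%N -> forall i j, (i < 3)%N -> (j < 3)%N ->
    N (bdsum (3 ^ k) F (corner p (s / 3%:R) i j) (s / 3%:R)) <= e i j.
  have hh (ij : 'I_3 * 'I_3) : exists K, forall k, (K <= k)%N ->
      N (bdsum (3 ^ k) F (corner p (s / 3%:R) ij.1 ij.2) (s / 3%:R)) <= e ij.1 ij.2.
    by case: (h ij.1 ij.2) => // K hK; exists K.
  have [f hf] := choice hh.
  exists (\max_ij f ij) => k kK i j i3 j3.
  by apply: (hf (Ordinal i3, Ordinal j3)); apply: leq_trans kK; apply: leq_bigmax.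
exists K.+1 => -[//|k] kK; rewrite expnS bdsum_split ?pow3_gt0//.
apply: le_trans (nc_sum _ _) _; rewrite big_nat [leRHS]big_nat.
apply: ler_sum => i /andP[_ i3].
apply: le_trans (nc_sum _ _) _; rewrite big_nat [leRHS]big_nat.
by apply: ler_sum => j /andP[_ j3]; apply: hK.
Qed.

Lemma sq_corner p s i j z : 0 <= s -> (i < 3)%N -> (j < 3)%N ->
  sq (corner p (s / 3%:R) i j) (s / 3%:R) z -> sq p s z.
Proof.
move=> s0 i3 j3; rewrite /sq /= !corner_Re !corner_Im.
have : (i%:R : R) <= 2 by rewrite ler_nat -ltnS.
have : (j%:R : R) <= 2 by rewrite ler_nat -ltnS.
have : 0 <= (i%:R : R) by []. have : 0 <= (j%:R : R) by [].
move=> a b c d [/andP[? ?] /andP[? ?]].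
by split; apply/andP; split; nra.
Qed.

(** Goursat's argument. If the boundary sums of some square are not small, neither
    are those of one of its nine subsquares, relatively to the area; the nested
    squares obtained in this way shrink to a point, near which [F] is affine up to an
    error that contradicts the lower bound, as affine functions have zero boundary
    sums. *)
Lemma cdiff_bdsum F p0 s0 : 0 < s0 -> (forall z, sq p0 s0 z -> cdiff F z) ->
  forall eps, 0 < eps -> bdsum_small F p0 s0 (eps * s0 ^+ 2).
Proof.
move=> s0_gt0 Fd eps eps0; apply: contrapT => bad0.
pose bad k p := ~ bdsum_small F p (s0 / 3%:R ^+ k) (eps * (s0 / 3%:R ^+ k) ^+ 2).
have step k p : exists p', bad k p -> bad k.+1 p' /\
   forall z, sq p' (s0 / 3%:R ^+ k.+1) z -> sq p (s0 / 3%:R ^+ k) z.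
  have [bp|nbp] := pselect (bad k p); last by exists p.
  apply: contrapT => nex; apply: bp.
  set s := s0 / _.
  have sE : s0 / 3%:R ^+ k.+1 = s / 3%:R.
    by rewrite /s exprSr invfM; ring.
  have s_gt0 : 0 < s by rewrite divr_gt0// exprn_gt0.
  have -> : eps * s ^+ 2 =
     \sum_(0 <= i < 3) \sum_(0 <= j < 3) (eps * (s / 3%:R) ^+ 2).
    by rewrite !(big_nat_recr, big_geq)//=; field.
  apply: bdsum_small_split => i j i3 j3; apply: contrapT => nb.
  apply: nex; exists (corner p (s / 3%:R) i j) => _; split.
    by rewrite /bad sE.
  by move=> z; rewrite sE; apply: sq_corner => //; exact: ltW.
have [nx nxP] := choice (fun kp : nat * C => step kp.1 kp.2).
pose P := fix P k := if k is k'.+1 then nx (k', P k') else p0.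
have badP k : bad k (P k).
  elim: k => [|k IH]; first by rewrite /bad expr0 divr1.
  by have [] := nxP (k, P k) IH.
have nestS k z : sq (P k.+1) (s0 / 3%:R ^+ k.+1) z -> sq (P k) (s0 / 3%:R ^+ k) z.
  by have [_] := nxP (k, P k) (badP k); apply.
have nest k m z : sq (P (m + k)%N) (s0 / 3%:R ^+ (m + k)) z ->
    sq (P k) (s0 / 3%:R ^+ k) z.
  by elim: m => // m IH; rewrite addSn => /nestS.
have sk_gt0 k : 0 < s0 / 3%:R ^+ k by rewrite divr_gt0// exprn_gt0.
have inP k : sq (P k) (s0 / 3%:R ^+ k) (P k).
  by have := ltW (sk_gt0 k); split; rewrite lexx /= lerDl.
have ReP k m : complex.Re (P k) <= complex.Re (P m) + s0 / 3%:R ^+ m.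
  have [km|/ltnW mk] := leqP k m.
    have := inP m; rewrite -(subnK km) => /nest[/andP[a _] _].
    by rewrite (le_trans a)// subnK// lerDl ltW.
  by have := inP k; rewrite -(subnK mk) => /nest[/andP[_ a] _].
have ImP k m : complex.Im (P k) <= complex.Im (P m) + s0 / 3%:R ^+ m.
  have [km|/ltnW mk] := leqP k m.
    have := inP m; rewrite -(subnK km) => /nest[_ /andP[a _]].
    by rewrite (le_trans a)// subnK// lerDl ltW.
  by have := inP k; rewrite -(subnK mk) => /nest[_ /andP[_ a]].
pose X := [set complex.Re (P k) | k in [set: nat]].
pose Y := [set complex.Im (P k) | k in [set: nat]].
pose zs : C := sup X +i* sup Y.
have supX : has_sup X.
  split; first by exists (complex.Re (P 0)), 0.
  by exists (complex.Re (P 0) + s0 / 3%:R ^+ 0) => _ [k _ <-].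
have supY : has_sup Y.
  split; first by exists (complex.Im (P 0)), 0.
  by exists (complex.Im (P 0) + s0 / 3%:R ^+ 0) => _ [k _ <-].
have zsP k : sq (P k) (s0 / 3%:R ^+ k) zs.
  split; apply/andP; split => /=.
  - by apply: sup_upper_bound => //; exists k.
  - by apply: ge_sup; [exact: supX.1 | move=> _ [m _ <-]].
  - by apply: sup_upper_bound => //; exists k.
  - by apply: ge_sup; [exact: supY.1 | move=> _ [m _ <-]].
have zs0 : sq p0 s0 zs by have := zsP 0; rewrite expr0 divr1.
have [l lP] := Fd _ zs0.
have e8 : 0 < eps / 8 by exact: divr_gt0.
have [d d0 hd] := lP _ e8.
have [k hk] : exists k, s0 / 3%:R ^+ k * 2 < d.
  have [k /= hk] := nat_gt (s0 * 2 / d).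
  exists k; rewrite mulrAC ltr_pdivrMr ?exprn_gt0// [ltRHS]mulrC -ltr_pdivrMr//.
  apply: lt_le_trans hk _; rewrite -natrX ler_nat ltnW//.
  exact: ltn_expl.
apply: (badP k); exists 0 => m _.
set s := s0 / _ in hk *; have s_gt0 : 0 < s := sk_gt0 k.
(* subtract the first order expansion of [F] at the limit point *)
have -> : bdsum (3 ^ m) F (P k) s =
   bdsum (3 ^ m) (fun z => F z + (-1) * ((F zs - l * zs) + l * z)) (P k) s.
  by rewrite bdsum_linear bdsum_affine ?pow3_gt0// mulr0 addr0.
apply: (@le_trans _ _ (4 * s * (eps / 8 * (s * 2)))).
  apply: bdsum_bound; rewrite ?pow3_gt0 ?ltW// => z [szP _].
  have -> : F z + (-1) * ((F zs - l * zs) + l * z) = F z - F zs - l * (z - zs) by ring.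
  have nz : N (z - zs) <= s * 2.
    apply: le_trans (nc_le_ReIm _) _.
    have [/andP[? ?] /andP[? ?]] := szP.
    have [/andP[a1 a2] /andP[a3 a4]] := zsP k.
    rewrite -/s in a1 a2 a3 a4.
    rewrite !(ReD, ReN, ImD, ImN) mulr2n mulrDr mulr1.
    by apply: lerD; rewrite ler_norml; apply/andP; split; lra.
  apply: le_trans (hd z _) _; first exact: le_lt_trans hk.
  by rewrite ler_pM2l// divr_gt0.
by rewrite le_eqVlt; apply/orP; left; apply/eqP; clearbody s; field.
Qed.

Definition centered z0 (s : R) : C := z0 - (s / 2)%:C * (1 + 'i).

Lemma centered_Re z0 s : complex.Re (centered z0 s) = complex.Re z0 - s / 2.
Proof. by rewrite /centered ReD ReN ReMr /= addr0 mulr1. Qed.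
Lemma centered_Im z0 s : complex.Im (centered z0 s) = complex.Im z0 - s / 2.
Proof. by rewrite /centered ImD ImN ImMr /= add0r mulr1. Qed.

Lemma corner_centered z0 s :
  corner (centered z0 s) (s / 3%:R) 1 1 = centered z0 (s / 3%:R).
Proof.
by rewrite /corner /centered !rmorphM !fmorphV /= !rmorph_nat; field.
Qed.

(** A bounded function may fail to be differentiable at the centre: the eight outer
    subsquares contribute nothing in the limit, and the boundary sum over the
    central one, which is again centred at the point, is at most its perimeter times
    the bound. *)
Lemma punctured_bdsum F z0 (B : R) s :
  0 < s -> 0 <= B ->
  (forall z, sq (centered z0 s) s z -> N (F z) <= B) ->
  (forall z, sq (centered z0 s) s z -> z != z0 -> cdiff F z) ->
  forall eps, 0 < eps -> bdsum_small F (centered z0 s) s eps.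
Proof.
move=> s_gt0 B0 FB Fd eps eps0.
have H k : forall s', 0 < s' <= s -> forall e, 0 < e ->
    bdsum_small F (centered z0 s') s' (e + 4 * (s' / 3%:R ^+ k) * B).
  elim: k => [|k IH] s' /andP[s'0 s's] e e0.
    exists 0 => k _; apply: (@le_trans _ _ (4 * s' * B)).
      apply: bdsum_bound; rewrite ?pow3_gt0 ?ltW// => z [[h1 h2] _].
      apply: FB; move: h1 h2; rewrite /sq /= !centered_Re !centered_Im.
      by move=> /andP[? ?] /andP[? ?]; split; apply/andP; split; lra.
    by rewrite expr0 divr1; lra.
  pose ee (i j : nat) := if (i == 1%N) && (j == 1%N)
     then e / 2 + 4 * ((s' / 3%:R) / 3%:R ^+ k) * B else e / 16.
  apply: (@bdsum_small_le _ _ _ (\sum_(0 <= i < 3) \sum_(0 <= j < 3) ee i j)).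
    rewrite !(big_nat_recr, big_geq)//= /ee /= exprSr invfM; lra.
  apply: bdsum_small_split => i j i3 j3; rewrite /ee; case: ifPn.
    move=> /andP[/eqP -> /eqP ->]; rewrite corner_centered.
    apply: IH; last exact: divr_gt0.
    by rewrite divr_gt0//=; lra.
  move=> ij.
  have s3 : 0 < s' / 3%:R by rewrite divr_gt0.
  have := @cdiff_bdsum F (corner (centered z0 s') (s' / 3%:R) i j) _ s3 _
     (e / 16 / (s' / 3%:R) ^+ 2).
  rewrite mulfVK ?expf_neq0 ?gt_eqF//; apply; last first.
    by rewrite !divr_gt0// exprn_gt0.
  move=> z; rewrite /sq /= !corner_Re !corner_Im !centered_Re !centered_Im.
  move=> [/andP[h1 h2] /andP[h3 h4]].
  have i2 : (i%:R : R) <= 2 by rewrite ler_nat -ltnS.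
  have j2 : (j%:R : R) <= 2 by rewrite ler_nat -ltnS.
  have i0 : 0 <= (i%:R : R) by [].
  have j0 : 0 <= (j%:R : R) by [].
  apply: Fd.
    rewrite /sq /= !centered_Re !centered_Im.
    by split; apply/andP; split; nra.
  apply: contraNneq ij => zE; move: h1 h2 h3 h4; rewrite zE => h1 h2 h3 h4.
  clear -h1 h2 h3 h4 s'0 i3 j3.
  have {h1 h2} -> : i = 1%N.
    by case: i i3 h1 h2 => [|[|[|]]]// _ h1 h2; exfalso; lra.
  have {h3 h4} -> // : j = 1%N.
  by case: j j3 h3 h4 => [|[|[|]]]// _ h1 h2; exfalso; lra.
have [k hk] : exists k, 4 * (s / 3%:R ^+ k) * B <= eps / 2.
  have [k /= hk] := nat_gt (4 * s * B / (eps / 2)).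
  exists k; rewrite mulrA mulrAC ler_pdivrMr ?exprn_gt0// [leRHS]mulrC -ler_pdivrMr ?divr_gt0//.
  rewrite (le_trans (ltW hk))// -natrX ler_nat ltnW//.
  exact: ltn_expl.
apply: bdsum_small_le (H k s _ (eps / 2) _); [lra | by rewrite s_gt0/= | exact: divr_gt0].
Qed.

Lemma centered_center z0 s : 0 <= s -> sq (centered z0 s) s z0.
Proof.
by move=> s0; rewrite /sq /= centered_Re centered_Im; split; apply/andP; split; lra.
Qed.

Lemma sqb_dist z0 s z : 0 <= s -> sqb (centered z0 s) s z -> s / 2 <= N (z - z0).
Proof.
move=> s0 [_]; rewrite centered_Re centered_Im => h.
have := nc_Re (z - z0); have := nc_Im (z - z0); rewrite !(ReD, ReN, ImD, ImN).
move=> hI hR; case: h => [|[|[|]]] e; rewrite e in hI hR *.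
- apply: le_trans hR; rewrite ler_normr; apply/orP; right; lra.
- apply: le_trans hR; rewrite ler_normr; apply/orP; left; lra.
- apply: le_trans hI; rewrite ler_normr; apply/orP; right; lra.
- apply: le_trans hI; rewrite ler_normr; apply/orP; left; lra.
Qed.

Lemma Im_div z w : complex.Im (w / z) * N z ^+ 2 =
  complex.Re z * complex.Im w - complex.Im z * complex.Re w.
Proof.
have [->|z0] := eqVneq z 0; first by rewrite invr0 mulr0 /= !mul0r subrr.
have n0 : N z ^+ 2 != 0 by rewrite expf_neq0// nc_eq0.
rewrite nc_sq in n0 *; case: z w z0 n0 => x y [u v] _ /= n0.
by field.
Qed.

Lemma trap_opp n F a b : trap n (fun z => - F z) a b = - trap n F a b.
Proof. by rewrite /trap -sumrN; apply: eq_bigr => k _; ring. Qed.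

(** The angle under which a side of a square is seen from the centre: the cross product of the
    position and the direction is [s * (s / 2)], at least the squared distance. *)
Lemma Im_inv_side u w (s : R) : 0 < s -> `|complex.Re u| <= s / 2 ->
  `|complex.Im u| <= s / 2 ->
  complex.Re u * complex.Im w - complex.Im u * complex.Re w = s * (s / 2) ->
  1 <= complex.Im (u^-1 * w).
Proof.
move=> s0 hx hy e.
have x2 : complex.Re u ^+ 2 <= (s / 2) ^+ 2.
  by rewrite -[leLHS]real_normK ?num_real// lerXn2r ?nnegrE// divr_ge0// ltW.
have y2 : complex.Im u ^+ 2 <= (s / 2) ^+ 2.
  by rewrite -[leLHS]real_normK ?num_real// lerXn2r ?nnegrE// divr_ge0// ltW.
have n2 : N u ^+ 2 <= s * (s / 2) by rewrite nc_sq; lra.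
have sp : 0 < s * (s / 2) by rewrite mulr_gt0// divr_gt0.
have u0 : 0 < N u ^+ 2.
  rewrite exprn_gt0// nc_gt0; apply/eqP => ue; move: e sp.
  by rewrite ue /= !mul0r subrr => <-; rewrite ltxx.
by rewrite -(ler_pM2r u0) mul1r [u^-1 * w]mulrC Im_div e.
Qed.

(** The exact integral is [2 * pi] times ['i]. The crude bound, one for each side,
    suffices and holds for every number of steps. *)
Lemma bdsum_inv_Im n z0 s : (0 < n)%N -> 0 < s ->
  4 <= complex.Im (bdsum n (fun z => (z - z0)^-1) (centered z0 s) s).
Proof.
move=> n0 s0; rewrite /bdsum; set c := corner _ _.
have Re_c i j : complex.Re (c i j) = complex.Re z0 + s * (i%:R - 2^-1).
  by rewrite corner_Re centered_Re; field.
have Im_c i j : complex.Im (c i j) = complex.Im z0 + s * (j%:R - 2^-1).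
  by rewrite corner_Im centered_Im; field.
have half (t : R) : 0 <= t <= 1 -> `|s * (t - 2^-1)| <= s / 2.
  by move=> /andP[? ?]; rewrite ler_norml; apply/andP; split; nra.
have segR (i j i' j' : nat) t : complex.Re (seg (c i j) (c i' j') t - z0) =
    s * (i%:R + t * (i'%:R - i%:R) - 2^-1).
  by rewrite ReD ReN seg_Re !Re_c; ring.
have segI (i j i' j' : nat) t : complex.Im (seg (c i j) (c i' j') t - z0) =
    s * (j%:R + t * (j'%:R - j%:R) - 2^-1).
  by rewrite ImD ImN seg_Im !Im_c; ring.
pose J i j i' j' := trap n (fun z => (z - z0)^-1) (c i j) (c i' j').
have fwd (i j i' j' : nat) : (forall t, 0 <= t <= 1 ->
      [/\ 0 <= i%:R + t * (i'%:R - i%:R) <= 1, 0 <= j%:R + t * (j'%:R - j%:R) <= 1 &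
        (i%:R + t * (i'%:R - i%:R) - 2^-1) * (j'%:R - j%:R)
        - (j%:R + t * (j'%:R - j%:R) - 2^-1) * (i'%:R - i%:R) = 2^-1 :> R]) ->
    1 <= complex.Im (J i j i' j').
  move=> H; apply: trap_Im => // t /H[hi hj hc].
  apply: (Im_inv_side s0); rewrite ?segR ?segI; [exact: half | exact: half|].
  rewrite ReD ImD ReN ImN !Re_c !Im_c; have := congr1 (fun v => s * s * v) hc; lra.
have bwd (i j i' j' : nat) : (forall t, 0 <= t <= 1 ->
      [/\ 0 <= i%:R + t * (i'%:R - i%:R) <= 1, 0 <= j%:R + t * (j'%:R - j%:R) <= 1 &
        (i%:R + t * (i'%:R - i%:R) - 2^-1) * (j%:R - j'%:R)
        - (j%:R + t * (j'%:R - j%:R) - 2^-1) * (i%:R - i'%:R) = 2^-1 :> R]) ->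
    1 <= - complex.Im (J i j i' j').
  move=> H; rewrite -ImN -trap_opp; apply: trap_Im => // t /H[hi hj hc].
  rewrite mulNr -mulrN opprB.
  apply: (Im_inv_side s0); rewrite ?segR ?segI; [exact: half | exact: half|].
  rewrite ReD ImD ReN ImN !Re_c !Im_c; have := congr1 (fun v => s * s * v) hc; lra.
have e1 : 1 <= complex.Im (J 0 0 1 0)%N.
  by apply: fwd => t /andP[? ?]; split; [apply/andP; split| apply/andP; split |]; lra.
have e2 : 1 <= complex.Im (J 1 0 1 1)%N.
  by apply: fwd => t /andP[? ?]; split; [apply/andP; split| apply/andP; split |]; lra.
have e3 : 1 <= - complex.Im (J 0 1 1 1)%N.
  by apply: bwd => t /andP[? ?]; split; [apply/andP; split| apply/andP; split |]; lra.
have e4 : 1 <= - complex.Im (J 0 0 0 1)%N.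
  by apply: bwd => t /andP[? ?]; split; [apply/andP; split| apply/andP; split |]; lra.
by rewrite !(ImD, ImN); rewrite /J in e1 e2 e3 e4; lra.
Qed.

End MaximumPrinciple.

(** * Continuity and differentiability in terms of the modulus *)

Section ComplexTopology.
Variable R : realType.
Local Notation C := R[i].
Local Notation N := (@Normc.normc R).

(** The norm of [R[i]] takes its values in [R[i]]; this characterization of
    neighbourhoods lets all estimates be made in [R]. *)
Lemma nbhs_nc (z : R[i]^o) (A : set R[i]^o) :
  nbhs z A <-> exists2 d : R, 0 < d & forall w, N (w - z) < d -> A w.
Proof.
split=> [/nbhs_ballP[e /= e0 eA]|[d d0 dA]].
  have eE : e = (complex.Re e)%:C.
    by apply: complex_ext => //=; apply: ger0_Im; exact: ltW.
  exists (complex.Re e); first by rewrite eE ltcR in e0.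
  move=> w wz; apply: eA; rewrite -ball_normE /ball_/=.
  change (`|z - w| < e); rewrite normcE_C eE ltcR.
  by rewrite ncC.
apply/nbhs_ballP; exists d%:C => /=; first by rewrite ltcR.
move=> w; rewrite -ball_normE /ball_/=.
change (`|z - w| < d%:C -> A w).
by rewrite normcE_C ltcR ncC; exact: dA.
Qed.

Lemma derivable_cdiff_derive (F : R[i]^o -> R[i]^o) (z : R[i]^o) :
  derivable F z 1 -> forall eps : R, 0 < eps ->
  exists2 d : R, 0 < d & forall w, N (w - z) < d ->
    N (F w - F z - derive1 F z * (w - z)) <= eps * N (w - z).
Proof.
move=> dF eps eps0.
have : (fun h : R[i]^o => h^-1 *: (F (h + z) - F z)) @ 0^' --> derive1 F z.
  rewrite derive1E; move: dF => /cvg_ex[l hl].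
  have : (fun h : R[i]^o => h^-1 *: ((F \o shift z) (h *: 1) - F z)) @ 0^' --> 'D_1 F z.
    by apply/cvg_ex; exists l; exact: hl.
  suff -> : (fun h : R[i]^o => h^-1 *: ((F \o shift z) (h *: 1) - F z)) =
    (fun h : R[i]^o => h^-1 *: (F (h + z) - F z)) by [].
  by apply/funext => h /=; rewrite -[h *: 1]/(h * 1) mulr1.
move=> /(_ (fun y => N (y - derive1 F z) < eps)).
have e1 : nbhs (derive1 F z) (fun y : R[i]^o => N (y - derive1 F z) < eps).
  by apply/nbhs_nc; exists eps.
move=> /(_ e1); rewrite /= nbhs_filterE => -[e /= e0 he].
have [d d0 hd] : exists2 d : R, 0 < d & forall w : R[i]^o, N (w - 0) < d -> ball_ [eta Num.Def.normr] (0 : R[i]^o) e w.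
  apply/(nbhs_nc 0 (ball_ [eta Num.Def.normr] (0 : R[i]^o) e)).
  by rewrite ball_normE; exact: nbhsx_ballx.
exists d => // w wd; have [->|wz] := eqVneq w z.
  by rewrite !subrr mulr0 subrr nc0 mulr0.
have wz0 : w - z != 0 by rewrite subr_eq0.
have := he (w - z); rewrite subrK => /(_ _ wz0).
have -> : (w - z)^-1 *: (F w - F z) = (F w - F z) / (w - z) by exact: mulrC.
move=> H; have {}H : N ((F w - F z) / (w - z) - derive1 F z) < eps.
  by apply: H; apply: hd; rewrite subr0.
have -> : F w - F z - derive1 F z * (w - z) =
  ((F w - F z) / (w - z) - derive1 F z) * (w - z).
  by rewrite mulrBl mulfVK.
by rewrite ncM ler_wpM2r ?nc_ge0// ltW.
Qed.

Lemma derivable_cdiff (F : R[i]^o -> R[i]^o) (z : R[i]^o) :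
  derivable F z 1 -> cdiff F z.
Proof. by move=> /derivable_cdiff_derive h; exists (derive1 F z). Qed.

Lemma derivable_continuous (F : R[i]^o -> R[i]^o) (z : R[i]^o) :
  derivable F z 1 -> {for z, continuous F}.
Proof. by move=> /derivable1_diffP/differentiable_continuous. Qed.

Lemma continuous_complex (T : topologicalType) (u v : T -> R) (x : T) :
  {for x, continuous u} -> {for x, continuous v} ->
  {for x, continuous (fun t => (u t +i* v t) : R[i]^o)}.
Proof.
move=> cu cv A /nbhs_nc[e e0 eA].
have e2 : 0 < e / 2 by exact: divr_gt0.
have := cu _ (nbhsx_ballx (u x) _ e2); have := cv _ (nbhsx_ballx (v x) _ e2).
rewrite !nbhs_simpl => hv hu.
change (nbhs x (fun t => A (u t +i* v t))).
near=> t; apply: eA.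
have tu : `|u x - u t| < e / 2.
  by have : ball (u x) (e / 2) (u t) by near: t.
have tv : `|v x - v t| < e / 2.
  by have : ball (v x) (e / 2) (v t) by near: t.
apply: le_lt_trans (nc_le_ReIm _) _.
rewrite -[complex.Re _]/(u t - u x) -[complex.Im _]/(v t - v x).
rewrite distrC [`|v t - _|]distrC.
lra.
Unshelve. all: by end_near. Qed.

Lemma continuous_normc (z : R[i]^o) : {for z, continuous (N : R[i]^o -> R)}.
Proof.
move=> A /nbhs_ballP[e /= e0 eA]; apply/nbhs_nc; exists e => // w wz; apply: eA.
rewrite -ball_normE /ball_/= distrC; apply: le_lt_trans wz.
by rewrite ler_norml -[- _ <= _]lerN2 opprK opprB [N (w - z)]ncC nc_ge_sub -ncC nc_ge_sub.
Qed.

Lemma compact_rect (a b c d : R) : compact (`[a, b] `*` `[c, d] : set (R * R)).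
Proof. apply: compact_setX; exact: segment_compact. Qed.

(** Stated on a rectangle of coordinates, so that the compactness of products of
    segments applies. *)
Lemma rect_bounded (F : R[i]^o -> R[i]^o) (a b c d : R) :
  (forall x y, a <= x <= b -> c <= y <= d -> {for x +i* y, continuous F}) ->
  exists B : R, forall x y, a <= x <= b -> c <= y <= d -> N (F (x +i* y)) <= B.
Proof.
move=> cF.
pose G (p : R * R) : R := N (F (p.1 +i* p.2)).
have cG : {in `[a, b] `*` `[c, d], continuous G}.
  move=> p; rewrite inE /= !in_itv/= => -[pa pc].
  apply: (@continuous_comp _ _ _ (fun p : R * R => F (p.1 +i* p.2)) (N : R[i]^o -> R)); last exact: continuous_normc.
  apply: (@continuous_comp _ _ _ (fun p : R * R => (p.1 +i* p.2) : R[i]^o) F).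
    by apply: continuous_complex; [exact: cvg_fst | exact: cvg_snd].
  exact: cF.
have cI : compact (G @` (`[a, b] `*` `[c, d])).
  apply: continuous_compact; last exact: compact_rect.
  by apply: continuous_in_subspaceT => x /cG.
have [M [Mr hM]] := compact_bounded cI.
exists (M + 1) => x y xa yc.
have := hM (M + 1); rewrite ltrDl => /(_ ltr01) /(_ (G (x, y))).
rewrite /G /= ger0_norm ?nc_ge0//; apply.
by exists (x, y) => //=; rewrite !in_itv.
Qed.

End ComplexTopology.

(** * Maximum principle and Schwarz lemma with several zeros *)

Section SchwarzNodes.
Variable R : realType.
Local Notation C := R[i].
Local Notation N := (@Normc.normc R).
Implicit Types (F G : C -> C) (z : C).

(** Products and quotients of holomorphic functions are taken in the field [R[i]],
    differentiability is the one of its regular module [R[i]^o]; the record keeps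
    the two structures apart. *)
Record hol F z : Prop :=
  Hol { hol_derivable : derivable (F : R[i]^o -> R[i]^o) (z : R[i]^o) 1 }.

Lemma hol_mul F G z : hol F z -> hol G z -> hol (fun w => F w * G w) z.
Proof. by move=> [dF] [dG]; split; exact: (derivableM dF dG). Qed.

Lemma hol_sub F G z : hol F z -> hol G z -> hol (fun w => F w - G w) z.
Proof. by move=> [dF] [dG]; split; exact: (derivableB dF dG). Qed.

Lemma hol_inv F z : F z != 0 -> hol F z -> hol (fun w => (F w)^-1) z.
Proof. by move=> Fz [dF]; split; exact: (derivableV Fz dF). Qed.

Lemma hol_id z : hol (fun w => w) z.
Proof. split; exact: derivable_id. Qed.

Lemma hol_cst (c : C) z : hol (fun _ => c) z.
Proof. split; exact: derivable_cst. Qed.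

Lemma hol_ext F G z : hol F z -> F =1 G -> hol G z.
Proof. by move=> + /funext <-. Qed.

Lemma hol_exp F n z : hol F z -> hol (fun w => F w ^+ n) z.
Proof.
move=> dF; elim: n => [|n IH].
  by apply: (hol_ext (@hol_cst 1 z)) => w; rewrite expr0.
by apply: (hol_ext (hol_mul dF IH)) => w; rewrite exprS.
Qed.

Lemma hol_prod (I : Type) (s : seq I) (F : I -> C -> C) z :
  (forall i, hol (F i) z) -> hol (fun w => \prod_(i <- s) F i w) z.
Proof.
move=> dF; elim: s => [|a s IH].
  by apply: (hol_ext (@hol_cst 1 z)) => w; rewrite big_nil.
by apply: (hol_ext (hol_mul (dF a) IH)) => w; rewrite big_cons.
Qed.

Lemma hol_subc (a z : C) : hol (fun w => w - a) z.
Proof. by apply: hol_sub; [exact: hol_id | exact: hol_cst]. Qed.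

(** The quotient [(F z - F z0) / (z - z0)] is bounded, and differentiable except at
    [z0], so its boundary sums tend to zero: [F z0] times the boundary sum of
    [(z - z0)^-1], which is at least 4, is close to the boundary sum of
    [F z / (z - z0)]. The factor 2 is the price of the crude constants; it
    disappears in the application, where the inequality is used for powers. *)
Lemma weak_maximum_principle F (z0 : C) (s M : R) : 0 < s ->
  (forall z, sq (centered z0 s) s z -> hol F z) ->
  (forall z, sqb (centered z0 s) s z -> N (F z) <= M) ->
  N (F z0) <= 2 * M.
Proof.
move=> s0 dF FM.
have [B FB] : exists B, forall z, sq (centered z0 s) s z -> N (F z) <= B.
  pose p := centered z0 s.
  have [|B hB] := @rect_bounded R F (complex.Re p) (complex.Re p + s)
      (complex.Im p) (complex.Im p + s).
    by move=> x y hx hy; apply/derivable_continuous/hol_derivable/dF.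
  by exists B => -[x y] [/= hx hy]; apply: hB.
have z0s : sq (centered z0 s) s z0 by apply: centered_center; exact: ltW.
have B0 : 0 <= B by apply: le_trans (FB _ z0s); exact: nc_ge0.
have [l hl] := derivable_cdiff (hol_derivable (dF _ z0s)).
have [d d0 hd] := hl 1 ltr01.
pose q z := (F z - F z0) / (z - z0).
have qB z : sq (centered z0 s) s z -> N (q z) <= (N l + 1) + 2 * B / d.
  move=> zs; have b1 : 0 <= 2 * B / d by rewrite divr_ge0 ?mulr_ge0// ltW.
  have b2 := nc_ge0 l.
  have [->|zz] := eqVneq z z0.
    by rewrite /q !subrr mul0r nc0 addr_ge0// addr_ge0.
  have nz : 0 < N (z - z0) by rewrite nc_gt0 subr_eq0.
  rewrite /q ncM ncV ler_pdivrMr//; have [zd|zd] := ltP (N (z - z0)) d.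
    have -> : F z - F z0 = (F z - F z0 - l * (z - z0)) + l * (z - z0) by rewrite subrK.
    apply: le_trans (ncD _ _) _; rewrite ncM; have := hd z zd; nra.
  have h1 := ncB (F z) (F z0); have h2 := FB _ zs; have h3 := FB _ z0s.
  have h4 : 2 * B / d * d <= 2 * B / d * N (z - z0) by apply: ler_wpM2l.
  have h5 : 2 * B / d * d = 2 * B by rewrite mulfVK// gt_eqF.
  nra.
have qd z : sq (centered z0 s) s z -> z != z0 -> cdiff q z.
  move=> zs zz; apply/derivable_cdiff/hol_derivable; rewrite /q.
  apply: hol_mul; first by apply: hol_sub; [exact: dF | exact: hol_cst].
  by apply: hol_inv; [rewrite subr_eq0 | exact: hol_subc].
have K0 : 0 <= N l + 1 + 2 * B / d.
  by rewrite !addr_ge0 ?nc_ge0// divr_ge0 ?mulr_ge0// ltW.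
apply/ler_addgt0Pr => e e0.
have e4 : 0 < 4 * e by rewrite mulr_gt0.
have [k0 /(_ k0 (leqnn _)) hk] := punctured_bdsum s0 K0 qB qd e4.
have n0 := pow3_gt0 k0; set n := (3 ^ k0)%N in n0 hk.
have qE : bdsum n q (centered z0 s) s =
   bdsum n (fun z => F z / (z - z0)) (centered z0 s) s
   - F z0 * bdsum n (fun z => (z - z0)^-1) (centered z0 s) s.
  rewrite -mulNr -bdsum_linear; congr bdsum; apply/funext => z.
  by rewrite /q mulrBl mulNr.
have h1 : N (bdsum n (fun z => F z / (z - z0)) (centered z0 s) s) <= 4 * s * (M / (s / 2)).
  apply: bdsum_bound => //; first exact: ltW.
  move=> z zb; have := sqb_dist (ltW s0) zb => h.
  have s2 : 0 < s / 2 by exact: divr_gt0.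
  rewrite ncM ncV ler_pdivrMr; last exact: lt_le_trans h.
  have M0 : 0 <= M by apply: le_trans (FM _ zb); exact: nc_ge0.
  apply: le_trans (FM _ zb) _.
  rewrite mulrAC ler_pdivlMr//.
  exact: ler_wpM2l.
have h2 : 4 <= N (bdsum n (fun z => (z - z0)^-1) (centered z0 s) s).
  apply: le_trans (bdsum_inv_Im z0 n0 s0) _.
  by apply: le_trans (nc_Im _); exact: ler_norm.
have h3 : N (F z0 * bdsum n (fun z => (z - z0)^-1) (centered z0 s) s) <=
   4 * e + 4 * s * (M / (s / 2)).
  have -> : F z0 * bdsum n (fun z => (z - z0)^-1) (centered z0 s) s =
    bdsum n (fun z => F z / (z - z0)) (centered z0 s) s - bdsum n q (centered z0 s) s.
    by rewrite qE opprB addrC subrK.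
  by apply: le_trans (ncB _ _) _; lra.
have h4 : 4 * s * (M / (s / 2)) = 8 * M by field; rewrite gt_eqF.
rewrite h4 ncM in h3; have := nc_ge0 (F z0); nra.
Qed.

(** The factor [(z - a) ^+ n] of the denominator is cancelled by the zero of
    [F ^+ n.+1] at [a], and one factor [F] is left, which makes the
    quotient, of value 0 at [a], differentiable there. *)
Lemma hol_at_node F (K : C -> C) (a : C) n :
  hol F a -> F a = 0 -> {for (a : R[i]^o), continuous (K : R[i]^o -> R[i]^o)} ->
  hol (fun z => F z ^+ n.+1 * ((z - a) ^+ n)^-1 * K z) a.
Proof.
move=> [/cvg_ex[l hl]] Fa cK; split.
have hF : (fun h : R[i]^o => ((h : C)^-1 * F ((h : C) + a) : R[i]^o)) @ 0^' --> l.
  suff <- : (fun h : R[i]^o => h^-1 *: (((F : R[i]^o -> R[i]^o) \o shift (a : R[i]^o)) (h *: 1) - F a))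
     = (fun h : R[i]^o => ((h : C)^-1 * F ((h : C) + a) : R[i]^o)) by exact: hl.
  by apply/funext => h; rewrite /= Fa subr0 -[h *: 1]/((h : C) * 1) mulr1.
have hK : (fun h : R[i]^o => K ((h : C) + a) : R[i]^o) @ 0^' --> (K a : R[i]^o).
  move=> A /cK /nbhs_nc[d d0 hd].
  change (nbhs (0 : R[i]^o) (fun h : R[i]^o => h != 0 -> A (K ((h : C) + a)))).
  apply/nbhs_nc; exists d => // h hd0 _; apply: hd.
  by rewrite addrK; rewrite subr0 in hd0.
have hX m : (fun h : R[i]^o => ((h : C)^-1 * F ((h : C) + a)) ^+ m : R[i]^o) @ 0^' --> ((l : C) ^+ m : R[i]^o).
  elim: m => [|m IH]; first by rewrite expr0; exact: cvg_cst.
  have -> : (fun h : R[i]^o => ((h : C)^-1 * F ((h : C) + a)) ^+ m.+1 : R[i]^o) =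
     (fun h : R[i]^o => ((h : C)^-1 * F ((h : C) + a)) * (((h : C)^-1 * F ((h : C) + a)) ^+ m) : R[i]^o).
    by apply/funext => h; rewrite exprS.
  rewrite exprS; exact: (cvgM hF IH).
pose A : R[i]^o -> R[i]^o :=
  fun h => ((h : C)^-1 * F ((h : C) + a)) ^+ n.+1 * K ((h : C) + a).
pose B : R[i]^o -> R[i]^o :=
  fun h => (h : C)^-1 * (F ((h : C) + a) ^+ n.+1 / (h : C) ^+ n * K ((h : C) + a)).
have hA : A @ 0^' --> (((l : C) ^+ n.+1 * K a) : R[i]^o) .
  exact: (cvgM (hX n.+1) hK).
have AB : \forall h \near (0 : R[i]^o)^', A h = B h.
  near=> h.
  have h0 : (h : C) != 0 by near: h; exact: nbhs_dnbhs_neq.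
  have hn : (h : C) ^+ n != 0 by rewrite expf_neq0.
  rewrite /A /B exprMn exprVn; move: (F _) (K _) => u v; rewrite [in LHS]exprS.
  by field; rewrite hn h0.
have hB : B @ 0^' --> (((l : C) ^+ n.+1 * K a) : R[i]^o).
  exact: (cvg_trans (near_eq_cvg AB) hA).
apply/cvg_ex; exists (((l : C) ^+ n.+1 * K a) : R[i]^o).
suff <- : B = (fun h : R[i]^o => h^-1 *:
   ((((fun z : C => F z ^+ n.+1 / (z - a) ^+ n * K z) : R[i]^o -> R[i]^o)
      \o shift (a : R[i]^o)) (h *: 1)
    - (F a ^+ n.+1 / (a - a) ^+ n * K a : R[i]^o))) by exact: hB.
apply/funext => h.
rewrite /= Fa expr0n /= !mul0r subr0 -[h *: 1]/((h : C) * 1) mulr1.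
rewrite -[RHS]/((h : C)^-1 * (F ((h : C) + a) ^+ n.+1 / ((h : C) + a - a) ^+ n * K ((h : C) + a))).
by rewrite addrK.
Unshelve. all: by end_near. Qed.

Lemma bernoulli_pow (t : R) n : 0 <= t -> 1 + t *+ n <= (1 + t) ^+ n.
Proof.
move=> t0; elim: n => [|n IH]; first by rewrite expr0 mulr0n addr0.
rewrite exprS mulrS; have : 0 <= t *+ n by rewrite mulrn_wge0.
nra.
Qed.

(** Powers of a number greater than 1 are unbounded: this removes constants from
    inequalities that hold for all powers. *)
Lemma geometric_le1 (t c : R) : 0 <= t -> 0 < c -> (forall n, t ^+ n * c <= 2) -> t <= 1.
Proof.
move=> t0 c0 h; rewrite leNgt; apply/negP => t1.
have [n hn] := nat_gt (2 / c / (t - 1)).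
have t10 : 0 < t - 1 by rewrite subr_gt0.
have := bernoulli_pow n (ltW t10).
have -> : 1 + (t - 1) = t by ring.
rewrite -mulr_natr mulrC => hb.
rewrite ltr_pdivrMr// in hn.
have hn' : 2 < n%:R * (t - 1) * c by rewrite -ltr_pdivrMr.
have := h n; nra.
Qed.

(** Divide [F] by the product of the [z - a]. Instead of removing the singularities of
    this quotient, the weak maximum principle is applied to [F ^+ n.+1] over the
    [n]-th power of the product, which is differentiable everywhere; as [n] is
    arbitrary, taking roots makes the constant 2 disappear. *)
Lemma schwarz_nodes F (nodes : seq C) (z0 : C) (s M w : R) : 0 < s -> uniq nodes ->
  (forall z, sq (centered z0 s) s z -> hol F z) ->
  (forall a, a \in nodes -> F a = 0) ->
  0 < w ->
  (forall z, sqb (centered z0 s) s z -> w <= N (\prod_(a <- nodes) (z - a))) ->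
  (forall z, sqb (centered z0 s) s z -> N (F z) <= M) ->
  N (F z0) <= N (\prod_(a <- nodes) (z0 - a)) * (M / w).
Proof.
move=> s0 un dF F0 w0 hw FM.
pose om (z : C) := \prod_(a <- nodes) (z - a).
have om0 (z : C) : z \notin nodes -> om z != 0.
  move=> zn; rewrite /om prodf_seq_neq0; apply/allP => a an /=.
  by rewrite subr_eq0; apply: contraNneq zn => ->.
have zb : sqb (centered z0 s) s (centered z0 s).
  by split; [rewrite /sq /= !lexx /= !lerDl ltW | left].
have M0 : 0 <= M by apply: le_trans (FM _ zb); exact: nc_ge0.
have [zn|zn] := boolP (z0 \in nodes).
  by rewrite F0// nc0 mulr_ge0 ?nc_ge0// divr_ge0// ltW.
have omz : 0 < N (om z0) by rewrite nc_gt0 om0.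
have key n : N (F z0) ^+ n.+1 / N (om z0) ^+ n <= 2 * (M ^+ n.+1 / w ^+ n).
  rewrite -!ncX -ncV -ncM.
  apply: (@weak_maximum_principle (fun z => F z ^+ n.+1 / om z ^+ n) z0 s) => //.
    move=> z zs; have [za|za] := boolP (z \in nodes).
      pose K (y : C) := (\prod_(a <- rem z nodes) (y - a)) ^+ n.
      have -> : (fun y => F y ^+ n.+1 / om y ^+ n) =
         (fun y => F y ^+ n.+1 * ((y - z) ^+ n)^-1 * (K y)^-1).
        apply/funext => y; rewrite /om (perm_big _ (perm_to_rem za)) big_cons /=.
        by rewrite exprMn invfM /K mulrA.
      apply: hol_at_node; [exact: dF | exact: F0 |].
      apply/derivable_continuous/hol_derivable/hol_inv.
        rewrite /K expf_neq0// prodf_seq_neq0; apply/allP => a an /=.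
        rewrite subr_eq0; apply: contraTneq an => <-.
        by rewrite mem_rem_uniq// inE eqxx.
      by apply: hol_exp; apply: hol_prod => a; exact: hol_subc.
    apply: hol_mul; first by apply: hol_exp; exact: dF.
    apply: hol_inv; first by rewrite expf_neq0// om0.
    by apply: hol_exp; apply: hol_prod => a; exact: hol_subc.
  move=> z zbd; rewrite ncM ncV !ncX.
  apply: ler_pM; rewrite ?exprn_ge0 ?nc_ge0 ?invr_ge0 ?exprn_ge0 ?nc_ge0//.
    by rewrite lerXn2r ?nnegrE ?nc_ge0//; exact: FM.
  have wz : w <= N (om z) := hw _ zbd; have oz := lt_le_trans w0 wz.
  rewrite lef_pV2 ?posrE ?exprn_gt0//.
  by apply: lerXn2r => //; rewrite nnegrE ltW.
have [Fz|Fz] := eqVneq (F z0) 0.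
  by rewrite Fz nc0 mulr_ge0 ?nc_ge0// divr_ge0// ltW.
have Fz0 : 0 < N (F z0) by rewrite nc_gt0.
have M1 : 0 < M.
  rewrite lt_neqAle M0 andbT eq_sym; apply: contraTneq isT => Me.
  have := key 0; rewrite Me !expr1 !expr0 !mul0r mulr0 divr1; lra.
pose t := N (F z0) * w / (N (om z0) * M).
have t1 : t <= 1.
  apply: (@geometric_le1 t (N (F z0) / M)).
  - by rewrite /t divr_ge0// mulr_ge0 ?nc_ge0// ltW.
  - by rewrite divr_gt0.
  move=> n; have := key n.
  have -> : t ^+ n * (N (F z0) / M) = (N (F z0) ^+ n.+1 / N (om z0) ^+ n) * (w ^+ n / M ^+ n.+1).
    rewrite /t exprMn exprVn !exprMn !exprS; field.
    by rewrite !expf_neq0 ?gt_eqF.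
  have e : 2 * (M ^+ n.+1 / w ^+ n) * (w ^+ n / M ^+ n.+1) = 2.
    rewrite !exprS; field.
    by rewrite !expf_neq0 ?gt_eqF.
  move=> h; rewrite -[leRHS]e; apply: ler_wpM2r => //.
  by rewrite divr_ge0// exprn_ge0// ltW.
move: t1; rewrite /t ler_pdivrMr ?mulr_gt0// mul1r => t1.
by rewrite mulrA ler_pdivlMr.
Qed.

End SchwarzNodes.

(** * Distortion of cross-ratios by a holomorphic map *)

Section CrossRatioLocal.
Variable R : realType.
Local Notation C := R[i].
Local Notation N := (@Normc.normc R).

Variables (f : C -> C) (p : C) (r B : R).
Hypothesis r0 : 0 < r.
Hypothesis f_hol : forall z, N (z - p) < 8 * r -> hol f z.
Hypothesis fB : forall z, N (z - p) < 8 * r -> N (f z - f p) <= B.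

Let side := 8 * r.

Lemma side_gt0 : 0 < side. Proof. by rewrite mulr_gt0. Qed.

Lemma near_sq_dist d z : sq (centered d side) side z -> N (z - d) <= 6 * r.
Proof.
rewrite /sq /= centered_Re centered_Im /side => -[/andP[h1 h2] /andP[h3 h4]].
have r0' := r0.
rewrite -(@ler_pXn2r _ 2) ?nnegrE ?nc_ge0 ?mulr_ge0 ?ltW// nc_sq !(ReD, ImD, ReN, ImN).
nra.
Qed.

Lemma near_sq_hol d z : N (d - p) <= r -> sq (centered d side) side z ->
  N (z - p) < 8 * r.
Proof.
move=> dp /near_sq_dist zd; have := nc_dist z d p; have := r0; lra.
Qed.

(** In the Schwarz lemma on a square of side [8 * r] centred at [d], this bounds the product of
    the [z - a] from below on the boundary. *)
Lemma near_sqb_node d a z : N (d - p) <= r -> N (a - p) <= r ->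
  sqb (centered d side) side z -> 2 * r <= N (z - a) <= 8 * r.
Proof.
move=> dp ap zb; have := near_sq_dist zb.1; have := sqb_dist (ltW side_gt0) zb.
rewrite /side => h1 h2; have := nc_dist z d a; have := nc_dist z a d.
have := nc_dist d p a; have := nc_dist a p d; rewrite [N (p - a)]ncC [N (p - d)]ncC.
have r0' := r0; move=> *; apply/andP; split; lra.
Qed.

Lemma near_sqb_f d a z : N (d - p) <= r -> N (a - p) <= r ->
  sqb (centered d side) side z -> N (f z - f a) <= 2 * B.
Proof.
move=> dp ap zb; have h1 := fB (near_sq_hol dp zb.1).
have h2 : N (f a - f p) <= B by apply: fB; have := r0; lra.
have := nc_dist (f z) (f p) (f a); rewrite [N (f p - _)]ncC; lra.
Qed.

Lemma B_ge0 : 0 <= B.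
Proof.
by apply: le_trans (fB (z := p) _); rewrite subrr nc0// mulr_gt0.
Qed.

Lemma hol_subcst a z : N (z - p) < 8 * r -> hol (fun w => f w - f a) z.
Proof. by move=> zp; apply: hol_sub; [exact: f_hol | exact: hol_cst]. Qed.

Lemma lipschitz_near a d : N (a - p) <= r -> N (d - p) <= r ->
  N (f d - f a) <= B / r * N (d - a).
Proof.
move=> ap dp.
have := @schwarz_nodes R (fun z => f z - f a) [:: a] d side (2 * B) (2 * r) side_gt0.
rewrite !big_seq1 => H.
have -> : B / r * N (d - a) = N (d - a) * (2 * B / (2 * r)).
  by have := r0 => ?; field; rewrite gt_eqF.
apply: H => //.
- by move=> z /near_sq_hol zp; apply: hol_subcst; exact: zp.
- by move=> b; rewrite inE => /eqP ->; rewrite subrr.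
- by rewrite mulr_gt0.
- by move=> z zb; rewrite big_seq1; have /andP[] := near_sqb_node dp ap zb.
- by move=> z zb; exact: near_sqb_f zb.
Qed.

(** The left-hand side, as a function of [c], vanishes at [a] and [b]. *)
Lemma divided_difference2_near a b c :
  N (a - p) <= r -> N (b - p) <= r -> N (c - p) <= r ->
  N ((f c - f a) * (b - a) - (f b - f a) * (c - a)) <=
  10 * B / (4 * r ^+ 2) * (N (b - a) * N (c - a) * N (c - b)).
Proof.
move=> ap bp cp; have [->|ab] := eqVneq a b.
  by rewrite !subrr mulr0 mul0r subr0 nc0 !mul0r mulr0.
have r0' := r0; have B0 := B_ge0.
have := @schwarz_nodes R (fun z => (f z - f a) * (b - a) - (f b - f a) * (z - a))
  [:: a; b] c side (10 * B * N (b - a)) ((2 * r) * (2 * r)) side_gt0.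
rewrite !big_cons big_nil mulr1 => H.
have -> : 10 * B / (4 * r ^+ 2) * (N (b - a) * N (c - a) * N (c - b)) =
  N ((c - a) * (c - b)) * (10 * B * N (b - a) / (2 * r * (2 * r))).
  by rewrite ncM; field; rewrite gt_eqF.
apply: H.
- by rewrite /= inE ab.
- move=> z /near_sq_hol zp; apply: hol_sub.
    by apply: hol_mul; [apply: hol_subcst; exact: zp | exact: hol_cst].
  by apply: hol_mul; [exact: hol_cst | exact: hol_subc].
- by move=> x; rewrite !inE => /orP[] /eqP ->; rewrite ?subrr ?mulr0 ?mul0r ?subrr.
- by rewrite !mulr_gt0.
- move=> z zb; rewrite !big_cons big_nil mulr1 ncM.
  have /andP[h1 _] := near_sqb_node cp ap zb.
  have /andP[h2 _] := near_sqb_node cp bp zb.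
  by apply: ler_pM; rewrite ?mulr_ge0// ltW.
move=> z zb; apply: le_trans (ncB _ _) _; rewrite !ncM.
have h1 := near_sqb_f cp ap zb.
have /andP[_ h2] := near_sqb_node cp ap zb.
have h3 := lipschitz_near ap bp.
have h4 := nc_ge0 (b - a); have h5 := nc_ge0 (z - a).
have e1 : N (f z - f a) * N (b - a) <= 2 * B * N (b - a) by apply: ler_wpM2r.
have e2 : N (f b - f a) * N (z - a) <= B / r * N (b - a) * (8 * r).
  by apply: ler_pM => //; exact: nc_ge0.
have e3 : B / r * N (b - a) * (8 * r) = 8 * B * N (b - a).
  by field; rewrite gt_eqF.
lra.
Qed.

(** It vanishes when [F] preserves the cross-ratio of the four points; this form
    has no denominator. *)
Definition cross_defect (F : C -> C) (a b c d : C) : C :=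
  (F a - F b) * (F d - F c) * ((a - c) * (d - b))
  - (F a - F c) * (F d - F b) * ((a - b) * (d - c)).

(** As a function of [d], the defect vanishes at [a], [b] and [c], which gives the
    last three factors by the Schwarz lemma. On the boundary of a large square, it
    is bounded by the three other factors: writing it with divided differences, one
    term is of second order in [a], [b], [c] by the previous lemma, and the other one is a
    product of first order differences. *)
Lemma cross_defect_near a b c d :
  N (a - p) <= r -> N (b - p) <= r -> N (c - p) <= r -> N (d - p) <= r ->
  N (cross_defect f a b c d) <= 50 * B ^+ 2 / (8 * r ^+ 4) *
  (N (a - b) * N (a - c) * N (b - c) * (N (d - a) * N (d - b) * N (d - c))).
Proof.
move=> ap bp cp dp; have r0' := r0; have B0 := B_ge0.
have [ab|ab] := eqVneq a b.
  by rewrite /cross_defect ab !subrr !(mulr0, mul0r) !subrr nc0 !(mulr0, mul0r).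
have [ac|ac] := eqVneq a c.
  by rewrite /cross_defect ac !subrr !(mulr0, mul0r) !subrr nc0 !(mulr0, mul0r).
have [bc|bc] := eqVneq b c.
  by rewrite /cross_defect bc !subrr nc0 !(mulr0, mul0r).
have := @schwarz_nodes R (fun z => cross_defect f a b c z)
  [:: a; b; c] d side (50 * B ^+ 2 / r * (N (a - b) * N (a - c) * N (b - c)))
  ((2 * r) * (2 * r * (2 * r))) side_gt0.
rewrite !big_cons big_nil mulr1 => H.
have -> : 50 * B ^+ 2 / (8 * r ^+ 4) *
  (N (a - b) * N (a - c) * N (b - c) * (N (d - a) * N (d - b) * N (d - c))) =
  N ((d - a) * ((d - b) * (d - c))) *
  (50 * B ^+ 2 / r * (N (a - b) * N (a - c) * N (b - c)) /
   (2 * r * (2 * r * (2 * r)))).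
  by rewrite !ncM; field; rewrite gt_eqF.
apply: H.
- by rewrite /= !inE negb_or ab ac bc.
- move=> z /near_sq_hol zp; rewrite /cross_defect; apply: hol_sub.
    apply: hol_mul.
      by apply: hol_mul; [exact: hol_cst | apply: hol_subcst; exact: zp].
    by apply: hol_mul; [exact: hol_cst | exact: hol_subc].
  apply: hol_mul.
    by apply: hol_mul; [exact: hol_cst | apply: hol_subcst; exact: zp].
  by apply: hol_mul; [exact: hol_cst | exact: hol_subc].
- by move=> x; rewrite !inE => /or3P[] /eqP ->; rewrite /cross_defect; ring.
- by rewrite !mulr_gt0.
- move=> z zb; rewrite !big_cons big_nil mulr1 !ncM.
  have /andP[h1 _] := near_sqb_node dp ap zb.
  have /andP[h2 _] := near_sqb_node dp bp zb.
  have /andP[h3 _] := near_sqb_node dp cp zb.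
  have t0 : 0 <= 2 * r by rewrite mulr_ge0// ltW.
  by apply: ler_pM => //; [rewrite mulr_ge0 | apply: ler_pM].
move=> z zb.
have -> : cross_defect f a b c z =
  ((f c - f a) * (b - a) - (f b - f a) * (c - a)) * ((f z - f c) * (z - b)) * (-1)
  + (f a - f c) * (a - b) * ((f z - f c) * (c - b) - (f c - f b) * (z - c)).
  by rewrite /cross_defect; ring.
apply: le_trans (ncD _ _) _; rewrite !ncM ncN nc1 mulr1.
have := divided_difference2_near ap bp cp.
set D := N ((f c - f a) * _ - _).
rewrite [N (b - a)]ncC [N (c - a)]ncC [N (c - b)]ncC => hD.
have h1 := near_sqb_f dp cp zb.
have /andP[_ h2] := near_sqb_node dp bp zb.
have /andP[_ h3] := near_sqb_node dp cp zb.
have h4 := lipschitz_near cp ap.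
have h5 := lipschitz_near bp cp; rewrite [N (c - b)]ncC in h5.
set ab' := N (a - b) in hD *; set ac' := N (a - c) in hD h4 *.
set bc' := N (b - c) in hD h5 *.
have ab0 : 0 <= ab' by exact: nc_ge0. have ac0 : 0 <= ac' by exact: nc_ge0.
have bc0 : 0 <= bc' by exact: nc_ge0.
have e1 : D * (N (f z - f c) * N (z - b)) <=
   (10 * B / (4 * r ^+ 2) * (ab' * ac' * bc')) * ((2 * B) * (8 * r)).
  apply: ler_pM => //; rewrite ?mulr_ge0 ?nc_ge0//.
  by apply: ler_pM; rewrite ?nc_ge0.
have e2 : N ((f z - f c) * (c - b) - (f c - f b) * (z - c)) <= 10 * B * bc'.
  apply: le_trans (ncB _ _) _; rewrite !ncM [N (c - b)]ncC -/bc'.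
  have k1 : N (f z - f c) * bc' <= 2 * B * bc' by apply: ler_wpM2r.
  have k2 : N (f c - f b) * N (z - c) <= B / r * bc' * (8 * r).
    by apply: ler_pM; rewrite ?nc_ge0.
  have k3 : B / r * bc' * (8 * r) = 8 * B * bc' by field; rewrite gt_eqF.
  lra.
have e3 : N (f a - f c) * ab' * N ((f z - f c) * (c - b) - (f c - f b) * (z - c))
    <= (B / r * ac' * ab') * (10 * B * bc').
  by apply: ler_pM => //; rewrite ?mulr_ge0 ?nc_ge0//; apply: ler_wpM2r.
have e4 : (10 * B / (4 * r ^+ 2) * (ab' * ac' * bc')) * ((2 * B) * (8 * r)) +
  (B / r * ac' * ab') * (10 * B * bc') = 50 * B ^+ 2 / r * (ab' * ac' * bc').
  by field; rewrite gt_eqF.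
lra.
Qed.

End CrossRatioLocal.

Section CrossRatioDistortion.
Variable R : realType.
Local Notation C := R[i].
Local Notation N := (@Normc.normc R).

(** The defect divided by the second product of differences. The lower bound [m] on the
    expansion bounds this product from below, so four of the six factors cancel; the two
    which are left are small for a small configuration. *)
Lemma cross_ratio_distortion (f : C -> C) (m K0 r : R) (A B D E : C) (p : R) :
  0 < m -> 0 < K0 ->
  (forall a b c d : C, N (a - p%:C) <= r -> N (b - p%:C) <= r ->
      N (c - p%:C) <= r -> N (d - p%:C) <= r ->
      N (cross_defect f a b c d) <=
      K0 * (N (a - b) * N (a - c) * N (b - c) * (N (d - a) * N (d - b) * N (d - c)))) ->
  (forall a b : C, N (a - p%:C) <= r -> N (b - p%:C) <= r -> m * N (a - b) <= N (f a - f b)) ->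
  N (A - p%:C) <= r -> N (B - p%:C) <= r -> N (D - p%:C) <= r -> N (E - p%:C) <= r ->
  exists2 rho : C, N (rho - 1) <= K0 / m ^+ 2 * (N (B - D) * N (E - A)) &
  (f A - f B) * (f E - f D) * ((A - D) * (E - B)) =
  rho * ((f A - f D) * (f E - f B) * ((A - B) * (E - D))).
Proof.
move=> m0 K00 HX Hm hA hB hD hE; have := HX A B D E hA hB hD hE.
set X := cross_defect _ _ _ _ _.
set u := (f A - f D) * (f E - f B) * ((A - B) * (E - D)).
set t := _ * ((A - D) * (E - B)).
have XE : X = t - u by [].
move=> hX.
have hu : m ^+ 2 * (N (A - D) * N (E - B) * (N (A - B) * N (E - D))) <= N u.
  rewrite /u !ncM [leLHS]mulrA; apply: ler_wpM2r; first by rewrite mulr_ge0 ?nc_ge0.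
  have -> : m ^+ 2 * (N (A - D) * N (E - B)) = (m * N (A - D)) * (m * N (E - B)) by ring.
  have m0' := ltW m0.
  by apply: ler_pM; rewrite ?mulr_ge0 ?nc_ge0//; apply: Hm.
have m2 : 0 < m ^+ 2 by rewrite exprn_gt0.
have k0 : 0 <= K0 / m ^+ 2 * (N (B - D) * N (E - A)).
  by apply: mulr_ge0; [rewrite divr_ge0 ?ltW | rewrite mulr_ge0 ?nc_ge0].
have hXu : N X <= K0 / m ^+ 2 * (N (B - D) * N (E - A)) * N u.
  apply: le_trans hX _; apply: le_trans (ler_wpM2l k0 hu).
  rewrite le_eqVlt; apply/orP; left; apply/eqP; field; exact: lt0r_neq0.
have [u0|u0] := eqVneq u 0.
  exists 1.
    by rewrite subrr nc0.
  move: hXu; rewrite u0 nc0 mulr0 => hX0.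
  have /eqP : N X == 0 by rewrite eq_le hX0 nc_ge0.
  by move/eqP; rewrite nc_eq0 XE u0 subr0 mulr0 => /eqP.
exists (t / u); last by rewrite mulfVK.
have -> : t / u - 1 = X / u by rewrite XE mulrBl divff.
by rewrite ncM ncV ler_pdivrMr// nc_gt0.
Qed.

End CrossRatioDistortion.

(** * The holomorphic extension near the real line *)

Section RealDerivative.
Variable R : realType.

Lemma is_derive_eps (phi : R -> R) (t l : R) :
  (forall eps, 0 < eps -> exists2 d, 0 < d & forall s, `|s - t| < d ->
     `|phi s - phi t - l * (s - t)| <= eps * `|s - t|) ->
  is_derive t 1 phi l.
Proof.
move=> H.
have cvgl : (fun h : R => h^-1 *: (phi (h *: 1 + t) - phi t)) @ 0^' --> l.
  apply/cvgrPdist_le => eps eps0; have [d d0 hd] := H eps eps0.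
  apply/nbhs_ballP; exists d => //= h; rewrite -ball_normE /ball_/= sub0r normrN => hd' h0.
  rewrite -[h *: 1]/(h * 1) mulr1 -[_ *: _]/(_ * _).
  have := hd (h + t); rewrite addrK => /(_ hd') hh.
  rewrite distrC.
  have -> : h^-1 * (phi (h + t) - phi t) - l = h^-1 * (phi (h + t) - phi t - l * h).
    by field.
  by rewrite normrM normfV mulrC ler_pdivrMr// normr_gt0.
split; first by apply/cvg_ex; exists l.
exact: cvg_lim.
Qed.

End RealDerivative.

Section HolomorphicExtension.
Variable R : realType.
Local Notation C := R[i].
Local Notation N := (@Normc.normc R).

Variables (Delta : R) (g : R -> R) (V : set R[i]^o) (f : R[i]^o -> R[i]^o).
Hypothesis Delta_gt0 : 0 < Delta.
Hypothesis f_ext : holo_diffeo_extension Delta g V f.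
Hypothesis Re_Df : (0 < ereal_inf
       [set (complex.Re (derive1 f z))%:E | z in strip Delta])%E.

Lemma strip_sub z : `|complex.Im z| < Delta -> V z.
Proof.
by move=> zs; case: f_ext => -[_ sV] _ _ _ _; apply: sV; exact: subset_closure.
Qed.

Lemma ext_hol z : `|complex.Im z| < Delta -> hol f z.
Proof.
move=> /strip_sub Vz; case: f_ext => _ _ _ _ [W [h [_ fh _ _ _]]]; split.
exact: fh.
Qed.

Lemma ext_real (x : R) : f x%:C = (g x)%:C.
Proof. by case: f_ext. Qed.

Lemma ext_V_int (z : C) (k : int) : V (z + k%:~R) <-> V z.
Proof.
case: f_ext => _ _ VP _ _.
have Vn w (n : nat) : V (w + n%:R) <-> V w.
  elim: n => [|n IH]; first by rewrite addr0.
  by rewrite -natr1 addrA VP.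
case: k => n; first exact: Vn.
rewrite NegzE mulrNz; split => [|Vz].
  by rewrite -{2}[z](subrK (n.+1%:R : C)) Vn.
by rewrite -(Vn _ n.+1) subrK.
Qed.

Lemma ext_int (z : C) (k : int) : V z -> f (z + k%:~R) = f z + k%:~R.
Proof.
case: f_ext => _ _ VP fP _ Vz.
have fn w (n : nat) : V w -> f (w + n%:R) = f w + n%:R.
  move=> Vw; elim: n => [|n IH]; first by rewrite !addr0.
  rewrite -natr1 !addrA fP ?IH// -[(n%:R : C)]/(n%:~R).
  by rewrite ext_V_int.
case: k => n; first exact: fn.
rewrite NegzE mulrNz; apply: (addIr (n.+1%:R : C)).
rewrite -fn ?subrK//; apply/(ext_V_int (z - n.+1%:R) n.+1).
by rewrite subrK.
Qed.

Lemma Re_derive_lower : exists2 c : R, 0 < c &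
  forall z, `|complex.Im z| < Delta -> c <= complex.Re (derive1 f z).
Proof.
have := Re_Df; set E := [set _ | _ in _] => E0.
have lb z : `|complex.Im z| < Delta -> (ereal_inf E <= (complex.Re (derive1 f z))%:E)%E.
  by move=> zs; apply: ereal_inf_lbound; exists z.
have := lb 0; rewrite /= normr0 => /(_ Delta_gt0).
move: E0 lb; case: (ereal_inf E) => [c||] //.
by rewrite lte_fin => c0 lb _; exists c => // z /lb; rewrite lee_fin.
Qed.

(** The strip is convex and the real part of the derivative is bounded below there: along
    the segment from [b] to [a], the mean value theorem applies to the component of [f] in
    the direction of the segment. *)
Lemma strip_lower : exists2 c : R, 0 < c &
  forall a b : C, `|complex.Im a| < Delta -> `|complex.Im b| < Delta ->
    c * N (a - b) <= N (f a - f b).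
Proof.
have [c c0 hc] := Re_derive_lower; exists c => // a b ha hb.
have [->|ab] := eqVneq a b; first by rewrite subrr nc0 mulr0 nc_ge0.
pose w : C := a - b; have w0 : w != 0 by rewrite subr_eq0.
pose pt (t : R) : C := b + t%:C * w.
have pts (t : R) : 0 <= t <= 1 -> `|complex.Im (pt t)| < Delta.
  move=> /andP[t0 t1]; rewrite /pt ImD ImMr /w ImD ImN.
  apply: (@le_lt_trans _ _ (Num.max `|complex.Im a| `|complex.Im b|)); last by rewrite gt_max ha.
  have : `|complex.Im a| <= Num.max `|complex.Im a| `|complex.Im b| by rewrite le_max lexx.
  have : `|complex.Im b| <= Num.max `|complex.Im a| `|complex.Im b| by rewrite le_max lexx orbT.
  move: (Num.max _ _) => m; rewrite !ler_norml => /andP[? ?] /andP[? ?].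
  by apply/andP; split; nra.
pose phi (t : R) := complex.Re (f (pt t) / w).
have dphi (t : R) : 0 <= t <= 1 -> is_derive t 1 phi (complex.Re (derive1 f (pt t))).
  move=> /pts ht; apply: is_derive_eps => eps eps0.
  have [d d0 hd] := derivable_cdiff_derive (hol_derivable (ext_hol ht)) eps0.
  have Nw : 0 < N w by rewrite nc_gt0.
  exists (d / N w); first by rewrite divr_gt0.
  move=> s; rewrite ltr_pdivlMr// => hs.
  have Ept : pt s - pt t = (s - t)%:C * w by rewrite /pt rmorphB /=; ring.
  have := hd (pt s); rewrite Ept ncM nc_real => /(_ hs) hh.
  have -> : phi s - phi t - complex.Re (derive1 f (pt t)) * (s - t) =
     complex.Re ((f (pt s) - f (pt t) - derive1 f (pt t) * ((s - t)%:C * w)) / w).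
    move: (derive1 f (pt t)) => D; rewrite /phi.
    have -> : (f (pt s) - f (pt t) - D * ((s - t)%:C * w)) / w =
      f (pt s) / w - f (pt t) / w - (s - t)%:C * D :> C by field.
    by rewrite [RHS]ReD ReN ReMr ReD ReN [complex.Re D * _]mulrC.
  apply: le_trans (nc_Re _) _; rewrite ncM ncV ler_pdivrMr// -mulrA.
  exact: hh.
have phic : {within `[0, 1], continuous phi}.
  apply: derivable_within_continuous => t; rewrite in_itv/= => /dphi ht.
  exact: ex_derive.
have [|t t01 ht] := @MVT_segment R phi (fun t => complex.Re (derive1 f (pt t))) 0 1 ler01 _ phic.
  by move=> t; rewrite in_itv/= => /andP[/ltW t0 /ltW t1]; apply: dphi; rewrite t0.
have {}ht : complex.Re ((f a - f b) / w) = complex.Re (derive1 f (pt t)).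
  move: ht; rewrite subr0 mulr1 /phi /pt !rmorph0 !rmorph1 mul0r mul1r addr0 /w.
  by rewrite [b + _]addrC subrK mulrBl ReD ReN.
rewrite in_itv/= in t01.
have h1 := hc _ (pts t t01).
have h2 := le_trans (ler_norm _) (nc_Re ((f a - f b) / w)).
have Nw : 0 < N w by rewrite nc_gt0.
by rewrite -ler_pdivlMr// -ncV -ncM; apply: le_trans h2; rewrite ht.
Qed.

(** The constants do not depend on the base point because [f z - z] is periodic, hence
    bounded on a strip. *)
Lemma uniform_cross_ratio : exists r L K : R, [/\ 0 < r, r < Delta, 0 < L, 0 < K &
  forall p : R,
   (forall a b : C, N (a - p%:C) <= r -> N (b - p%:C) <= r ->
      N (f a - f b) <= L * N (a - b)) /\
   (forall a b c d : C, N (a - p%:C) <= r -> N (b - p%:C) <= r ->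
      N (c - p%:C) <= r -> N (d - p%:C) <= r ->
      N (cross_defect f a b c d) <=
      K * (N (a - b) * N (a - c) * N (b - c) * (N (d - a) * N (d - b) * N (d - c))))].
Proof.
(* the squares of the local estimates lie in the disk of radius [8 * r] *)
pose r := Delta / 16.
have r0 : 0 < r by rewrite divr_gt0.
have Im8 (p : R) z : N (z - p%:C) < 8 * r -> `|complex.Im z| <= 8 * r.
  move=> h; apply: le_trans (ltW h); apply: le_trans (nc_Im _).
  by rewrite ImD ImN /= subr0.
have r8 : 8 * r < Delta by rewrite /r; have := Delta_gt0; lra.
have [|B1 hB1] := @rect_bounded R (fun z => f z - z) 0 1 (- (8 * r)) (8 * r).
  move=> x y hx hy; apply/derivable_continuous/hol_derivable.
  apply: hol_sub; last exact: hol_id.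
  by apply: ext_hol; apply: le_lt_trans r8; rewrite ler_norml.
have hB z : `|complex.Im z| <= 8 * r -> N (f z - z) <= B1.
  case: z => x y /= hy; pose k := Num.floor x.
  have Vz : V ((x - k%:~R) +i* y) by apply: strip_sub; exact: le_lt_trans r8.
  have -> : (x +i* y : C) = ((x - k%:~R) +i* y) + k%:~R.
    rewrite (CintE _ k).
    by apply: complex_ext; rewrite ?ReD ?ImD /= ?subrK ?addr0.
  have -> : f (((x - k%:~R) +i* y) + k%:~R) - (((x - k%:~R) +i* y) + k%:~R) =
     f ((x - k%:~R) +i* y) - ((x - k%:~R) +i* y) :> C by rewrite ext_int//; ring.
  apply: hB1; last by rewrite -ler_norml.
  have := floor_itv x; rewrite -/k ; rewrite rmorphD /= => /andP[? ?].
  apply/andP; split; lra.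
have B10 : 0 <= B1 by apply: le_trans (hB 0 _); rewrite ?nc_ge0//= normr0 mulr_ge0// ltW.
pose B := 2 * B1 + 8 * r.
have B0 : 0 < B by rewrite ltr_wpDl ?mulr_ge0 ?mulr_gt0.
have fh (p : R) z : N (z - p%:C) < 8 * r -> hol f z.
  by move=> /Im8 h; apply: ext_hol; exact: le_lt_trans r8.
have fB (p : R) z : N (z - p%:C) < 8 * r -> N (f z - f p%:C) <= B.
  move=> h; have h1 := hB _ (Im8 _ _ h).
  have h2 : N (f p%:C - p%:C) <= B1 by apply: hB; rewrite /= normr0 mulr_ge0// ltW.
  have -> : f z - f p%:C = (f z - z) - (f p%:C - p%:C) + (z - p%:C) by ring.
  apply: le_trans (ncD _ _) _; have := ncB (f z - z) (f p%:C - p%:C).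
  rewrite /B; lra.
exists r, (B / r), (50 * B ^+ 2 / (8 * r ^+ 4)); split => //.
- by have := Delta_gt0; rewrite /r; lra.
- by rewrite divr_gt0.
- by rewrite divr_gt0 ?mulr_gt0 ?exprn_gt0.
move=> p; split.
  by move=> a b ha hb; apply: (lipschitz_near r0 (@fh p) (@fB p)).
by move=> a b c d; apply: (cross_defect_near r0 (@fh p) (@fB p)).
Qed.

End HolomorphicExtension.

(** * Continued fractions and best approximation *)

Section ContinuedFraction.
Variable R : realType.
Variable alpha : R.
Hypothesis alpha_irr : irrational alpha.

Local Notation X := (complete_quotient alpha).
Local Notation a := (partial_quotient alpha).

Definition cvg_num n : int := (convergent alpha n).1.
Definition cvg_den n : int := (convergent alpha n).2.
Definition cvg_err n : R := (cvg_den n)%:~R * alpha - (cvg_num n)%:~R.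

Lemma complete_quotient_irr n : irrational (X n).
Proof.
elim: n => [//|n IH] /= [q /= _ qE]; apply: IH.
exists (q^-1 + (Num.floor (X n))%:~R) => //=.
by rewrite rmorphD /= ratr_int fmorphV /= qE invrK subrK.
Qed.

Lemma frac_gt0 n : 0 < X n - (Num.floor (X n))%:~R < 1.
Proof.
have := floor_itv (X n); rewrite rmorphD /= => /andP[h1 h2].
apply/andP; split; last lra.
rewrite subr_gt0 lt_neqAle h1 andbT; apply/eqP => e.
by apply: (@complete_quotient_irr n); exists (Num.floor (X n))%:~R => //=; rewrite ratr_int.
Qed.

Lemma complete_quotient_gt1 n : 1 < X n.+1.
Proof. by have /andP[h1 h2] := frac_gt0 n; rewrite /= invf_gt1. Qed.

Lemma partial_quotient_ge1 n : 1 <= a n.+1.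
Proof. by rewrite /partial_quotient floor_ge_int; exact: ltW (complete_quotient_gt1 n). Qed.

Lemma convergent_pairS n : convergent_pair alpha n.+1 =
  (convergent alpha n, (a n.+1 * cvg_num n + (convergent_pair alpha n).1.1,
                        a n.+1 * cvg_den n + (convergent_pair alpha n).1.2)).
Proof. by rewrite /cvg_num /cvg_den /convergent /=; case: (convergent_pair alpha n). Qed.

Lemma cvg_num0 : cvg_num 0 = a 0. Proof. by []. Qed.
Lemma cvg_den0 : cvg_den 0 = 1. Proof. by []. Qed.
Lemma cvg_num1 : cvg_num 1 = a 1 * a 0 + 1. Proof. by []. Qed.
Lemma cvg_den1 : cvg_den 1 = a 1.
Proof. by rewrite /cvg_den /convergent /= mulr1 addr0. Qed.
Lemma cvg_numSS n : cvg_num n.+2 = a n.+2 * cvg_num n.+1 + cvg_num n.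
Proof. by rewrite {1}/cvg_num {1}/convergent convergent_pairS [in X in _ = _ + X]/= convergent_pairS. Qed.
Lemma cvg_denSS n : cvg_den n.+2 = a n.+2 * cvg_den n.+1 + cvg_den n.
Proof. by rewrite {1}/cvg_den {1}/convergent convergent_pairS [in X in _ = _ + X]/= convergent_pairS. Qed.

Lemma cvg_den_mono n : 1 <= cvg_den n <= cvg_den n.+1.
Proof.
elim: n => [|n /andP[h1 h2]]; first by rewrite cvg_den0 cvg_den1 lexx partial_quotient_ge1.
rewrite (le_trans h1 h2) cvg_denSS andTb; have := partial_quotient_ge1 n.+1.
move: (a n.+2) (cvg_den n.+1) (cvg_den n) h1 h2 => x y z h1 h2 h3; nia.
Qed.

Lemma cvg_errSS n : cvg_err n.+2 = (a n.+2)%:~R * cvg_err n.+1 + cvg_err n.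
Proof. by rewrite /cvg_err cvg_denSS cvg_numSS !rmorphD !rmorphM /=; ring. Qed.

(** The classical formula for the error in terms of the next complete quotient; it
    gives the alternation of signs. *)
Lemma cvg_errS n : cvg_err n = - (cvg_err n.+1 * X n.+2).
Proof.
elim: n => [|n IH].
  have /andP[h1 _] := frac_gt0 1; have /andP[h0 _] := frac_gt0 0.
  have X1 : X 1 = (alpha - (a 0)%:~R)^-1 by [].
  have -> : X 2 = (X 1 - (a 1)%:~R)^-1 by [].
  have h1' : X 1 - (a 1)%:~R != 0 by exact: lt0r_neq0.
  have h0' : alpha - (a 0)%:~R != 0 by exact: lt0r_neq0.
  apply: (mulIf h1'); rewrite mulNr mulfVK//.
  rewrite /cvg_err cvg_num0 cvg_den0 cvg_num1 cvg_den1 X1 rmorphD rmorphM /=.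
  by field.
have /andP[h _] := frac_gt0 n.+2.
have -> : X n.+3 = (X n.+2 - (a n.+2)%:~R)^-1 by [].
have h' : X n.+2 - (a n.+2)%:~R != 0 by exact: lt0r_neq0.
by rewrite cvg_errSS IH; field.
Qed.

Lemma cvg_err_neq0 n : cvg_err n != 0.
Proof.
elim: n => [|n IH].
  have /andP[h0 _] := frac_gt0 0.
  by rewrite /cvg_err cvg_den0 cvg_num0 mul1r; exact: lt0r_neq0.
by apply: contraNneq IH => e; rewrite cvg_errS e mul0r oppr0.
Qed.

Lemma cvg_err_alt n : cvg_err n * cvg_err n.+1 < 0.
Proof.
rewrite {1}cvg_errS; have := complete_quotient_gt1 n.+1.
have : 0 < cvg_err n.+1 ^+ 2 by rewrite lt_neqAle sqr_ge0 andbT eq_sym sqrf_eq0 cvg_err_neq0.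
nra.
Qed.

(** The errors alternate in sign and the partial quotients are at least 1. *)
Lemma cvg_err_dec n : `|cvg_err n.+1| + `|cvg_err n.+2| <= `|cvg_err n|.
Proof.
have := cvg_err_alt n; have := cvg_err_alt n.+1.
have := cvg_errSS n.
have : (1 : R) <= (a n.+2)%:~R by rewrite -[1]/(1%:~R) ler_int partial_quotient_ge1.
move: (cvg_err n) (cvg_err n.+1) (cvg_err n.+2) ((a n.+2)%:~R : R) => x y z t t1 e h1 h2.
have [y0|y0] := leP 0 y.
  have x0 : x < 0 by nra.
  have z0 : z < 0 by nra.
  rewrite (ger0_norm y0) (ltr0_norm z0) (ltr0_norm x0); nra.
have x0 : 0 < x by nra.
have z0 : 0 < z by nra.
rewrite (ltr0_norm y0) (gtr0_norm z0) (gtr0_norm x0); nra.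
Qed.

Lemma cvg_err0_lt1 : `|cvg_err 0| < 1.
Proof.
rewrite /cvg_err cvg_den0 cvg_num0 mul1r; have /andP[h0 h1] := frac_gt0 0.
by rewrite gtr0_norm.
Qed.

Lemma cvg_err_lt1 n : `|cvg_err n| < 1.
Proof.
elim: n => [|n IH]; first exact: cvg_err0_lt1.
by apply: le_lt_trans IH; apply: le_trans (cvg_err_dec n); rewrite lerDl.
Qed.

Lemma cvg_det n :
  (cvg_num n * cvg_den n.+1 - cvg_num n.+1 * cvg_den n) ^+ 2 = 1.
Proof.
elim: n => [|n <-].
  by rewrite cvg_den0 cvg_num0 cvg_num1 cvg_den1; ring.
by rewrite cvg_numSS cvg_denSS; ring.
Qed.

(** Two consecutive convergents form a basis of the integer pairs. If [0 < k < q_(n+1)],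
    the coordinates of [(k, - l)] have opposite signs, or the second one is zero, and as
    the errors alternate in sign, the two contributions add up. *)
Lemma best_approximation n (k l : int) : 0 < k < cvg_den n.+1 ->
  `|cvg_err n| <= `|k%:~R * alpha + l%:~R|.
Proof.
move=> /andP[k0 kq].
pose D := cvg_num n * cvg_den n.+1 - cvg_num n.+1 * cvg_den n.
have DD : D * D = 1 by have := cvg_det n; rewrite expr2.
(* coordinates of (k, -l) in the basis of two consecutive convergents *)
pose u := D * (- l * cvg_den n.+1 - cvg_num n.+1 * k).
pose v := D * (cvg_num n * k + l * cvg_den n).
have kE : k = u * cvg_den n + v * cvg_den n.+1.
  transitivity (D * D * k); first by rewrite DD mul1r.
  by rewrite /u /v {2}/D; ring.
have lE : - l = u * cvg_num n + v * cvg_num n.+1.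
  transitivity (D * D * - l); first by rewrite DD mul1r.
  by rewrite /u /v {2}/D; ring.
have -> : k%:~R * alpha + l%:~R = u%:~R * cvg_err n + v%:~R * cvg_err n.+1.
  rewrite -[l]opprK lE kE /cvg_err !(rmorphN, rmorphD, rmorphM) /=; ring.
have /andP[q1 q2] := cvg_den_mono n.
have h := cvg_err_alt n.
move: (cvg_err n) (cvg_err n.+1) h => x y h.
have [v0|v0|v0] := ltgtP v 0.
- have u1 : 1 <= u by rewrite -gtz0_ge1; clear -kE k0 v0 q1 q2; nra.
  have u1R : (1 : R) <= u%:~R by rewrite -[1]/(1%:~R) ler_int.
  have v1R : v%:~R <= (-1 : R) by rewrite -[-1]/((-1)%:~R) ler_int; lia.
  have [x0|x0] := leP 0 x.
    have y0 : y < 0 by nra.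
    by rewrite (ger0_norm x0) ler_normr; apply/orP; left; nra.
  have y0 : 0 < y by nra.
  by rewrite (ltr0_norm x0) ler_normr; apply/orP; right; nra.
- have u1 : u <= -1 by clear -kE kq v0 q1 q2; nia.
  have v1R : (1 : R) <= v%:~R by rewrite -[1]/(1%:~R) ler_int.
  have u1R : u%:~R <= (-1 : R) by rewrite -[-1]/((-1)%:~R) ler_int.
  have [x0|x0] := leP 0 x.
    have y0 : y < 0 by nra.
    by rewrite (ger0_norm x0) ler_normr; apply/orP; right; nra.
  have y0 : 0 < y by nra.
  by rewrite (ltr0_norm x0) ler_normr; apply/orP; left; nra.
- have u1 : 1 <= u by clear -kE k0 v0 q1; nia.
  have u1R : (1 : R) <= u%:~R by rewrite -[1]/(1%:~R) ler_int.
  rewrite v0 mul0r addr0 normrM ler_peMl//.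
  by rewrite ger0_norm//; lra.
Qed.

End ContinuedFraction.

(** * Lifts of circle homeomorphisms and their rotation number *)

Section CircleAction.
Variable R : realType.
Variables g h : R -> R.
Hypothesis g_incr : {homo g : x y / x < y}.
Hypothesis g_per : forall x, g (x + 1) = g x + 1.
Hypothesis gK : cancel g h.
Hypothesis hK : cancel h g.

(** The action of the integers generated by [g], with [h] the inverse of [g]. *)
Definition act (k : int) (x : R) : R :=
  match k with Posz n => iter n g x | Negz n => iter n.+1 h x end.

Lemma g_lt : {mono g : x y / x < y}.
Proof.
move=> x y; apply/idP/idP => [|/g_incr//].
by apply: contraTT; rewrite -!leNgt le_eqVlt => /orP[/eqP ->|/g_incr/ltW].
Qed.

Lemma h_lt : {mono h : x y / x < y}.
Proof. by move=> x y; rewrite -g_lt !hK. Qed.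

Lemma h_per x : h (x + 1) = h x + 1.
Proof. by apply: (can_inj gK); rewrite g_per !hK. Qed.

Lemma act0 x : act 0 x = x. Proof. by []. Qed.

Lemma actS k x : act (k + 1) x = g (act k x).
Proof.
case: k => [n|[|n]]; first by rewrite -PoszD addn1.
  by rewrite /= hK.
have -> : Negz n.+1 + 1 = Negz n by lia.
by rewrite [RHS]/= hK.
Qed.

Lemma actP k x : act (k - 1) x = h (act k x).
Proof. by rewrite -[k in RHS](subrK 1) actS gK. Qed.

Lemma act1 x : act 1 x = g x. Proof. by []. Qed.

Lemma act_nat n x : act n%:Z x = iter n g x. Proof. by []. Qed.

Lemma actD k l x : act (k + l) x = act k (act l x).
Proof.
elim/int_ind: k => [|n IH|n IH]; first by rewrite add0r.
  by rewrite intS -addrA addrC actS IH [1 + _]addrC actS.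
by rewrite intS opprD -addrA addrC actP IH [-1 + _]addrC actP.
Qed.

Lemma act_lt k : {mono act k : x y / x < y}.
Proof.
have it (F : R -> R) n : {mono F : x y / x < y} -> {mono iter n F : x y / x < y}.
  by move=> FM; elim: n => // n IH x y; rewrite !iterS FM IH.
by case: k => n; [exact: (it g n g_lt) | exact: (it h n.+1 h_lt)].
Qed.

Lemma act_le k : {mono act k : x y / x <= y}.
Proof. by move=> x y; rewrite !leNgt act_lt. Qed.

Lemma act_addn k x (n : nat) : act k (x + n%:R) = act k x + n%:R.
Proof.
elim: n => [|n IH]; first by rewrite !addr0.
rewrite -natr1 !addrA -IH; move: (x + _) => y.
have it (F : R -> R) m : (forall z, F (z + 1) = F z + 1) ->
    iter m F (y + 1) = iter m F y + 1.
  by move=> FP; elim: m => // m IHm; rewrite !iterS IHm FP.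
by case: k {IH} => m; [exact: (it g m g_per) | exact: (it h m.+1 h_per)].
Qed.

Lemma act_addz k x (l : int) : act k (x + l%:~R) = act k x + l%:~R.
Proof.
case: l => n; first exact: act_addn.
rewrite NegzE mulrNz; apply: (addIr (n.+1%:R)).
by rewrite -act_addn !subrK.
Qed.

Lemma actK k : cancel (act k) (act (- k)).
Proof. by move=> x; rewrite -actD addNr. Qed.

Variable alpha : R.
Hypothesis alphaE : alpha = rotation_number g.

(** Monotonicity and periodicity: [x] lies between two consecutive integers, where
    the displacement is the one of 0. *)
Lemma displacement k x : act k 0 - 1 < act k x - x < act k 0 + 1.
Proof.
pose m := Num.floor x; have := floor_itv x; rewrite -/m rmorphD /= => /andP[h1 h2].
have e1 : act k 0 + m%:~R <= act k x.
  by rewrite -act_addz add0r act_le.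
have e2 : act k x < act k 0 + (m + 1)%:~R.
  by rewrite -act_addz add0r act_lt rmorphD.
rewrite rmorphD /= in e2.
by apply/andP; split; lra.
Qed.

Lemma displacement_iter (k : int) (m : nat) x :
  m%:R * (act k 0 - 1) <= act (k * m%:Z) x - x <= m%:R * (act k 0 + 1).
Proof.
elim: m => [|m /andP[h1 h2]]; first by rewrite mulr0 act0 subrr !mul0r lexx.
have -> : k * m.+1%:Z = k + k * m%:Z by rewrite intS; ring.
rewrite actD -natr1.
have /andP[h3 h4] := displacement k (act (k * m) x).
by apply/andP; split; lra.
Qed.

(** Iterating the comparison of displacements, [(act n 0 - 1) / n] is at most
    [(act m 0 + 1) / m] for all [n] and [m]; the supremum of the former is the limit
    which defines the rotation number, and it separates both families. *)
Lemma rotation_number_bound (n : nat) : (0 < n)%N -> `|act n 0 - n%:R * alpha| <= 1.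
Proof.
pose u (n : nat) := act n 0.
have comp (n' m : nat) : (0 < n')%N -> (0 < m)%N ->
    (u n' - 1) / n'%:R <= (u m + 1) / m%:R.
  move=> n0 m0; rewrite ler_pdivrMr ?ltr0n// mulrAC ler_pdivlMr ?ltr0n//.
  have /andP[h1 _] := displacement_iter n' m 0.
  have /andP[_ h2] := displacement_iter m n' 0.
  by rewrite [m%:Z * _]mulrC in h2; rewrite /u; lra.
pose A := [set (u k - 1) / k%:R | k in [set k : nat | (0 < k)%N]].
have hA : has_sup A.
  split; first by exists ((u 1%N - 1) / 1%:R), 1%N.
  by exists ((u 1%N + 1) / 1%:R) => _ [k /= k0 <-]; apply: comp.
pose s := sup A.
have lo (m : nat) : (0 < m)%N -> u m - 1 <= m%:R * s.
  move=> m0; rewrite mulrC -ler_pdivrMr ?ltr0n//.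
  by apply: sup_upper_bound => //; exists m.
have hi (m : nat) : (0 < m)%N -> m%:R * s <= u m + 1.
  move=> m0; rewrite mulrC -ler_pdivlMr ?ltr0n//.
  by apply: ge_sup; [exact: hA.1 | move=> _ [k /= k0 <-]; exact: comp].
suff -> : alpha = s.
  move=> n0; have := lo n n0; have := hi n n0; rewrite -/(u n) => h1 h2.
  by rewrite ler_norml; apply/andP; split; lra.
rewrite alphaE /rotation_number; apply: cvg_lim => //.
apply/cvgrPdist_le => e e0; near=> k.
have k0 : (0 < k)%N by near: k; exists 1%N.
have kR : 0 < (k%:R : R) by rewrite ltr0n.
have ke : 1 <= e * k%:R.
  rewrite -ler_pdivrMl// mulr1; apply: ltW; near: k.
  by exists (Num.Def.truncn e^-1).+1 => // k /= hk;
     apply: lt_le_trans (_ : (Num.Def.truncn e^-1).+1%:R <= _);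
     rewrite ?truncnS_gt ?num_real ?ler_nat.
have := lo k k0; have := hi k k0; rewrite /u act_nat => h1 h2.
have -> : s - iter k g 0 / k%:R = (k%:R * s - iter k g 0) / k%:R by field; rewrite gt_eqF.
rewrite normrM normfV [`|k%:R|]gtr0_norm// ler_pdivrMr//.
apply: le_trans ke; rewrite ler_norml; apply/andP; split; lra.
Unshelve. all: by end_near. Qed.

(** The inequality adds up along the orbit, and the mean displacement of a long orbit is the
    rotation number. *)
Lemma act_drift_ge (q : nat) (p : int) x : (0 < q)%N ->
  x + p%:~R <= act q x -> p%:~R <= q%:R * alpha.
Proof.
move=> q0 hx.
have it (m : nat) : x + m%:R * p%:~R <= act (q%:Z * m) x.
  elim: m => [|m IH]; first by rewrite mul0r addr0 mulr0.
  have -> : q%:Z * m.+1%:Z = q%:Z * m%:Z + q by rewrite intS; ring.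
  rewrite actD -natr1.
  have e : act (q%:Z * m) (x + p%:~R) <= act (q%:Z * m) (act q x) by rewrite act_le.
  by apply: le_trans e; rewrite act_addz; lra.
rewrite leNgt; apply/negP => hp.
have d0 : 0 < p%:~R - q%:R * alpha by rewrite subr_gt0.
have [m /= hm] := nat_gt (2 / (p%:~R - q%:R * alpha)).
have m0 : (0 < m)%N.
  by rewrite -(ltr_nat R); apply: lt_trans hm; rewrite divr_gt0.
rewrite ltr_pdivrMr// in hm.
have := it m; rewrite -PoszM => h1.
have /andP[_ h2] := displacement (q * m)%N x.
have := rotation_number_bound (n := (q * m)%N); rewrite muln_gt0 q0 m0 => /(_ isT).
rewrite ler_norml natrM => /andP[_ h3].
nra.
Qed.

Lemma act_drift_le (q : nat) (p : int) x : (0 < q)%N ->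
  act q x <= x + p%:~R -> q%:R * alpha <= p%:~R.
Proof.
move=> q0 hx.
have it (m : nat) : act (q%:Z * m) x <= x + m%:R * p%:~R.
  elim: m => [|m IH]; first by rewrite mul0r addr0 mulr0.
  have -> : q%:Z * m.+1%:Z = q%:Z * m%:Z + q by rewrite intS; ring.
  rewrite actD -natr1.
  have e : act (q%:Z * m) (act q x) <= act (q%:Z * m) (x + p%:~R) by rewrite act_le.
  by apply: le_trans e _; rewrite act_addz; lra.
rewrite leNgt; apply/negP => hp.
have d0 : 0 < q%:R * alpha - p%:~R by rewrite subr_gt0.
have [m /= hm] := nat_gt (2 / (q%:R * alpha - p%:~R)).
have m0 : (0 < m)%N.
  by rewrite -(ltr_nat R); apply: lt_trans hm; rewrite divr_gt0.
rewrite ltr_pdivrMr// in hm.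
have := it m; rewrite -PoszM => h1.
have /andP[h2 _] := displacement (q * m)%N x.
have := rotation_number_bound (n := (q * m)%N); rewrite muln_gt0 q0 m0 => /(_ isT).
rewrite ler_norml natrM => /andP[h3 _].
nra.
Qed.

Lemma act_gt (k l : int) x : 0 < k%:~R * alpha + l%:~R -> x < act k x + l%:~R.
Proof.
case: k => [[|n]|n] hk.
- by rewrite /=; move: hk; rewrite mul0r add0r; lra.
- rewrite ltNge; apply/negP => hx.
  have := @act_drift_le n.+1 (- l) x isT; rewrite mulrNz.
  move: hk; rewrite -[(Posz n.+1)%:~R]/(n.+1%:R) => hk.
  have : act n.+1 x <= x - l%:~R by lra.
  by move=> + H => /H; lra.
rewrite ltNge; apply/negP => hx.
set y := act (Negz n) x in hx.
have xy : act n.+1 y = x by rewrite /y -[Posz n.+1]opprK -NegzE actK.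
have := @act_drift_ge n.+1 l y isT; rewrite xy => H.
have : y + l%:~R <= x by [].
move=> /H; move: hk; rewrite NegzE mulrNz -[(Posz n.+1)%:~R]/(n.+1%:R); lra.
Qed.

(** With an irrational rotation number, this determines the order of the integer translates
    of an orbit: it is the one of the rotation. *)
Lemma act_order (k l k' l' : int) x :
  k%:~R * alpha + l%:~R < k'%:~R * alpha + l'%:~R ->
  act k x + l%:~R < act k' x + l'%:~R.
Proof.
move=> hkl; have := @act_gt (k' - k) (l' - l) (act k x).
rewrite -actD subrK !rmorphB /= => H.
by have := H _; lra.
Qed.

End CircleAction.

(** * Closest returns *)

Section Packing.
Variable R : realType.

(** Remove the rightmost interval: the others end before it begins. *)
Lemma packing (I : eqType) (s : seq I) (a b : I -> R) (A B : R) :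
  uniq s -> A <= B ->
  (forall i, i \in s -> [/\ A <= a i, a i < b i & b i <= B]) ->
  (forall i j, i \in s -> j \in s -> i != j -> b i <= a j \/ b j <= a i) ->
  \sum_(i <- s) (b i - a i) <= B - A.
Proof.
have [m] := ubnP (size s); elim: m => // m IH in s B *.
case: s => [|i0 s0]; first by move=> _ _ AB _ _; rewrite big_nil subr_ge0.
set s := i0 :: s0 => sm us AB hab disj.
have [i is_ imax] : exists2 i, i \in s & forall j, j \in s -> a j <= a i.
  rewrite /s; elim: (s0) => [|j t [i it imax]].
    by exists i0; rewrite ?mem_head// => j; rewrite inE => /eqP ->.
  have it' : i \in i0 :: j :: t.
    by move: it; rewrite !inE => /orP[->//|->]; rewrite !orbT.
  have [aij|aij] := leP (a i) (a j).
    exists j; first by rewrite !inE eqxx orbT.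
    move=> k; rewrite !inE => /or3P[/eqP->|/eqP->//|kt].
    - by apply: le_trans aij; apply: imax; rewrite mem_head.
    - by apply: le_trans aij; apply: imax; rewrite inE kt orbT.
  exists i => // k; rewrite !inE => /or3P[/eqP->|/eqP->|kt].
  - by apply: imax; rewrite mem_head.
  - exact: ltW.
  - by apply: imax; rewrite inE kt orbT.
have [Ai ai Bi] := hab i is_.
rewrite (perm_big _ (perm_to_rem is_)) big_cons /=.
have : \sum_(j <- rem i s) (b j - a j) <= a i - A.
  apply: IH => //.
  - by rewrite size_rem// -ltnS prednK.
  - exact: rem_uniq.
  - move=> j js; have [Aj aj Bj] := hab j (mem_rem js); split=> //.
    have ij : i != j by apply: contraTneq js => <-; rewrite mem_rem_uniq// inE eqxx.
    have [|//] := disj i j is_ (mem_rem js) ij.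
    by have := imax j (mem_rem js); lra.
  - by move=> j k /mem_rem js /mem_rem ks; exact: disj.
by move=> h; lra.
Qed.

End Packing.

Section Grid.
Variable R : realType.
Variables g h : R -> R.
Hypothesis g_incr : {homo g : x y / x < y}.
Hypothesis g_per : forall x, g (x + 1) = g x + 1.
Hypothesis gK : cancel g h.
Hypothesis hK : cancel h g.
Variable alpha : R.
Hypothesis alphaE : alpha = rotation_number g.
Hypothesis alpha_irr : irrational alpha.

Local Notation act := (act g h).
Local Notation q := (cvg_den alpha).
Local Notation p := (cvg_num alpha).
Local Notation err := (cvg_err alpha).

Let actD := actD gK hK.
Let act_lt := act_lt g_incr hK.
Let act_le := act_le g_incr hK.
Let act_addz := act_addz g_per gK hK.
Let act_order := act_order g_incr g_per gK hK alphaE.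

Lemma irr_pair (k l k' l' : int) :
  k%:~R * alpha + l%:~R = k'%:~R * alpha + l'%:~R -> k = k' /\ l = l'.
Proof.
move=> e; have [kk|kk] := eqVneq k k'.
  by split=> //; move: e; rewrite kk => /addrI/eqP; rewrite eqr_int => /eqP.
exfalso; apply: alpha_irr; exists ((l' - l)%:~R / (k - k')%:~R) => //=.
have kk0 : (k - k')%:~R != 0 :> R by rewrite intr_eq0 subr_eq0.
rewrite fmorph_div /= !ratr_int; apply: (mulIf kk0); rewrite mulfVK//.
by rewrite !rmorphB /= mulrBr; lra.
Qed.

Lemma act_order_le (k l k' l' : int) x :
  k%:~R * alpha + l%:~R <= k'%:~R * alpha + l'%:~R ->
  act k x + l%:~R <= act k' x + l'%:~R.
Proof.
rewrite le_eqVlt => /orP[/eqP/irr_pair[-> ->]//|/act_order/ltW]; exact.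
Qed.

Section FixedN.
Variable n : nat.

(** The direction in which [g^(q_n) - p_n] moves the points. *)
Definition sgn_err : int := if 0 < err n then 1 else -1.

Lemma sgn_errE : sgn_err%:~R * err n = `|err n|.
Proof.
rewrite /sgn_err; case: ltP => h0; first by rewrite mul1r gtr0_norm.
by rewrite mulrNz mulN1r ler0_norm.
Qed.

(** The power of [g^(q_n) - p_n] whose index has been given the sign of the error, so
    that [sh 1] moves points to the right, like the rotation by [`|err n|]. All
    statements on closest returns become independent of the parity of [n]. *)
Definition sh (m : int) (x : R) : R :=
  act (m * (sgn_err * q n)) x + (- (m * (sgn_err * p n)))%:~R.

Lemma sh_rot m : (m * (sgn_err * q n))%:~R * alpha +
   (- (m * (sgn_err * p n)))%:~R = m%:~R * `|err n|.
Proof. by rewrite -sgn_errE /cvg_err !(rmorphN, rmorphM) /=; ring. Qed.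

Lemma sh0 x : sh 0 x = x.
Proof. by rewrite /sh !mul0r oppr0 addr0. Qed.

Lemma sh_lt m : {mono sh m : x y / x < y}.
Proof. by move=> x y; rewrite /sh ltrD2r act_lt. Qed.

Lemma sh_le m : {mono sh m : x y / x <= y}.
Proof. by move=> x y; rewrite /sh lerD2r act_le. Qed.

Lemma sh_act m k x : sh m (act k x) = act k (sh m x).
Proof. by rewrite /sh act_addz -!actD [k + _]addrC. Qed.

Lemma sh_addz m x (l : int) : sh m (x + l%:~R) = sh m x + l%:~R.
Proof. by rewrite /sh act_addz addrAC. Qed.

Lemma shD m m' x : sh (m + m') x = sh m (sh m' x).
Proof.
rewrite [sh m' x]/sh sh_addz sh_act /sh act_addz -!actD -!addrA -rmorphD /=.
by congr (act _ _ + _%:~R); ring.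
Qed.

Lemma sh_index_lt m m' x : m < m' -> sh m x < sh m' x.
Proof.
move=> mm; rewrite /sh; apply: act_order; rewrite !sh_rot.
by rewrite ltr_pM2r ?normr_gt0 ?cvg_err_neq0// ltr_int.
Qed.

Definition gap x := sh 1 x - x.

Lemma gap_gt0 x : 0 < gap x.
Proof. by rewrite /gap subr_gt0 -{1}[x]sh0; exact: sh_index_lt. Qed.

Lemma sh_lt1 x : sh 1 x < x + 1.
Proof.
have := @act_order (1 * (sgn_err * q n)) (- (1 * (sgn_err * p n))) 0 1 x.
by rewrite sh_rot act0; apply; rewrite mul0r add0r mul1r; exact: cvg_err_lt1.
Qed.

Lemma gap_lt1 x : gap x < 1.
Proof. by rewrite /gap ltrBlDl; exact: sh_lt1. Qed.

Lemma gap_addz x (l : int) : gap (x + l%:~R) = gap x.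
Proof. by rewrite /gap sh_addz; ring. Qed.

(** The intervals [[t, sh 1 t[] for [t] in an orbit segment of length [q_(n+1)], brought to
    one period, are disjoint: they are ordered like for the rotation, where two
    points of such a segment are at distance at least [`|err n|] by best
    approximation. They lie in an interval of length 2, as the gap is less than 1. *)
Lemma gap_sum_block x : \sum_(0 <= i < `|q n.+1|%N) gap (act i x) <= 2.
Proof.
have /andP[q1 q12] := cvg_den_mono alpha_irr n.
have qE : (`|q n.+1|%N : int) = q n.+1 by rewrite abszE ger0_norm//; lia.
pose l (i : nat) : int := - Num.floor (act i x).
pose a (i : nat) := act i x + (l i)%:~R.
have -> : \sum_(0 <= i < `|q n.+1|) gap (act i x) =
          \sum_(i <- iota 0 `|q n.+1|) (sh 1 (a i) - a i).
  rewrite /index_iota subn0; apply: eq_bigr => i _.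
  by rewrite -/(gap (a i)) /a gap_addz.
rewrite -[leRHS]subr0; apply: packing => //.
- exact: iota_uniq.
- move=> i _; have := floor_itv (act i x); rewrite rmorphD /= => /andP[h1 h2].
  have := sh_lt1 (a i); have := gap_gt0 (a i); rewrite /gap /a /l rmorphN /=.
  by move=> h3 h4; split; lra.
move=> i j; rewrite !mem_iota !add0n /= => iq jq ij.
wlog ij' : i j iq jq ij / (i < j)%N.
  move=> W; have := ij; rewrite neq_ltn => /orP[|]; first exact: W.
  by move=> ji; have [||] := W j i jq iq _ ji; rewrite 1?eq_sym//; [right|left].
have k0 : 0 < (j%:Z - i%:Z) < q n.+1 by lia.
have := best_approximation alpha_irr (l j - l i) k0.
rewrite !rmorphB /= => hb.
have shE (i' : nat) : sh 1 (a i') = act (1 * (sgn_err * q n) + i') x +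
    ((- (1 * (sgn_err * p n))) + l i')%:~R.
  by rewrite /a sh_addz /sh -actD rmorphD /= addrA.
have rotE (i' : nat) : (1 * (sgn_err * q n) + i')%:~R * alpha +
    ((- (1 * (sgn_err * p n))) + l i')%:~R =
    `|err n| + (i'%:~R * alpha + (l i')%:~R).
  have E := sh_rot 1; rewrite [RHS]mul1r in E; rewrite -E.
  move: (1 * _) (- (1 * _)) => u v.
  by rewrite !rmorphD /=; ring.
have [d0|d0] := leP 0 ((j%:~R - i%:~R) * alpha + ((l j)%:~R - (l i)%:~R)).
  left; rewrite shE /a; apply: act_order_le; rewrite rotE.
  by rewrite (ger0_norm d0) in hb; lra.
right; rewrite shE /a; apply: act_order_le; rewrite rotE.
by rewrite (ltr0_norm d0) in hb; lra.
Qed.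

Lemma gap_sum (m k : nat) x : (k <= m * `|q n.+1|%N)%N ->
  \sum_(0 <= i < k) gap (act i x) <= 2 * m%:R.
Proof.
move=> km; apply: (@le_trans _ _ (\sum_(0 <= i < m * `|q n.+1|) gap (act i x))).
  rewrite [leRHS](big_cat_nat (leq0n k) km)/= lerDl; apply: sumr_ge0 => i _.
  exact: ltW (gap_gt0 _).
elim: m {k km} x => [|m IH] x; first by rewrite mul0n big_geq// mulr0.
rewrite mulSn (big_cat_nat (leq0n _) (leq_addr (m * `|q n.+1|) `|q n.+1|))/=.
rewrite -[m.+1%:R]natr1 mulrDr mulr1 [leRHS]addrC; apply: lerD; first exact: gap_sum_block.
rewrite -{1}[`|q n.+1|%N]add0n big_addn addKn.
apply: le_trans (IH (act `|q n.+1|%N x)); apply: ler_sum => i _.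
by rewrite iterD.
Qed.

Lemma sh_unbounded x y : exists m : nat, x < sh m y.
Proof.
have b0 : 0 < `|err n| by rewrite normr_gt0 cvg_err_neq0.
pose z := Num.floor (x - y) + 1.
have [m hm] := nat_gt (z%:~R / `|err n|).
exists m.
have := @act_order 0 z (m%:Z * (sgn_err * q n)) (- (m%:Z * (sgn_err * p n))) y.
rewrite sh_rot mul0r add0r act0 => H.
have {}H : y + z%:~R < sh m y by apply: H; rewrite -ltr_pdivrMr.
have := floorD1_gt (x - y); rewrite -/z; lra.
Qed.

Lemma sh_bounded_below x y : exists m : nat, sh (- m%:Z) y <= x.
Proof.
have [m hm] := sh_unbounded y x; exists m.
by rewrite -(sh_le m) -shD subrr sh0 ltW.
Qed.

Definition covers y x (k : nat) : Prop :=
  exists l : int, act k y + l%:~R <= x < sh 1 (act k y + l%:~R).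

(** Move forward by multiples of [q_n] steps, in the direction of [sgn_err], from
    the suitable side of [x]. *)
Lemma covers_ex x y : exists k, covers y x k.
Proof.
have /andP[q1 q12] := cvg_den_mono alpha_irr n.
pose L := Num.floor (x - y).
have := floor_itv (x - y); rewrite -/L rmorphD /= => /andP[L1 L2].
have shk (s : int) (m : nat) z : s * sgn_err = 1 ->
    sh (s * m%:Z) (y + z%:~R) = act (absz (m%:Z * q n)%R) y + (z - m%:Z * p n)%:~R.
  move=> ss; rewrite sh_addz /sh abszE ger0_norm; last by rewrite mulr_ge0//; lia.
  have -> : s * m * (sgn_err * q n) = (s * sgn_err) * (m%:Z * q n) by ring.
  have -> : s * m * (sgn_err * p n) = (s * sgn_err) * (m%:Z * p n) by ring.
  by rewrite ss !mul1r rmorphB rmorphN /=; ring.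
have [s0|s0] : sgn_err = 1 \/ sgn_err = -1 by rewrite /sgn_err; case: ifP; auto.
  have ex : exists m : nat, x < sh m (y + L%:~R) by exact: sh_unbounded.
  case: (ex_minnP ex) => -[|m] hm hmin.
    by exfalso; move: hm; rewrite sh0; lra.
  have := shk 1 m L; rewrite s0 !mul1r => /(_ erefl) E.
  exists (absz (m%:Z * q n)%R), (L - m%:Z * p n); rewrite -E -shD -intS hm andbT.
  by rewrite leNgt; apply/negP => /hmin; rewrite ltnn.
have ex : exists m : nat, sh (- m%:Z) (y + (L + 1)%:~R) <= x by exact: sh_bounded_below.
case: (ex_minnP ex) => -[|m] hm hmin.
  by exfalso; move: hm; rewrite oppr0 sh0 rmorphD /=; lra.
have := shk (-1) m.+1 (L + 1); rewrite s0 mulrNN mulr1 mulN1r => /(_ erefl) E.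
exists (absz (m.+1%:Z * q n)%R), (L + 1 - m.+1%:Z * p n); rewrite -E -shD hm /=.
have -> : 1 - m.+1%:Z = - m%:Z by lia.
by rewrite ltNge; apply/negP => /hmin; rewrite ltnn.
Qed.

(** Take the least [k] that works. If it is at least [q_(n+1) + q_n], going back by
    [q_(n+1)] steps, or by [q_(n+1) + q_n] steps, gives two points whose
    intervals cover [[t, sh 1 t[], because the errors alternate in sign and
    decrease; so one of them contains [x], which contradicts the minimality. *)
Lemma cover x y : exists2 k : nat, k%:Z < q n.+1 + q n & covers y x k.
Proof.
have [k0 hk0] := covers_ex x y.
have ex : exists k, `[< covers y x k >] by exists k0; apply/asboolP.
case: (ex_minnP ex) => k /asboolP [l /andP[tx xt]] kmin; exists k; last by exists l; rewrite tx.
have /andP[q1 q12] := cvg_den_mono alpha_irr n.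
rewrite ltNge; apply/negP => kq.
set t := act k y + l%:~R in tx xt.
have alt := cvg_err_alt alpha_irr n.
have dec : `|err n.+1| < `|err n|.
  apply: lt_le_trans (cvg_err_dec alpha_irr n); rewrite ltrDl normr_gt0.
  exact: cvg_err_neq0.
(* the two candidates, obtained by going back q_(n+1), then also q_n, steps *)
pose k' := (absz (k%:Z - q n.+1)%R); pose l' := l + p n.+1.
pose k'' := (absz (k%:Z - q n.+1 - q n)%R); pose l'' := l + p n.+1 + p n.
have k'E : k'%:Z = k%:Z - q n.+1 by rewrite abszE ger0_norm//; lia.
have k''E : k''%:Z = k%:Z - q n.+1 - q n by rewrite abszE ger0_norm//; lia.
have k'k : (k' < k)%N by rewrite -ltz_nat k'E; lia.
have k''k : (k'' < k)%N by rewrite -ltz_nat k''E; lia.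
set t' := act k' y + l'%:~R; set t'' := act k'' y + l''%:~R.
have no' : ~ (t' <= x < sh 1 t').
  move=> H; have /kmin : `[< covers y x k' >] by apply/asboolP; exists l'.
  by rewrite leqNgt k'k.
have no'' : ~ (t'' <= x < sh 1 t'').
  move=> H; have /kmin : `[< covers y x k'' >] by apply/asboolP; exists l''.
  by rewrite leqNgt k''k.
have rot' : k'%:~R * alpha + l'%:~R = (k%:~R * alpha + l%:~R) - err n.+1.
  by rewrite k'E /l' /cvg_err !(rmorphB, rmorphD) /=; ring.
have rot'' : k''%:~R * alpha + l''%:~R = (k%:~R * alpha + l%:~R) - err n.+1 - err n.
  by rewrite k''E /l'' /cvg_err !(rmorphB, rmorphD) /=; ring.
have [e0|e0] := ltP 0 (err n).
  have e1 : err n.+1 < 0 by nra.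
  have tt' : t < t' by apply: act_order; rewrite rot'; lra.
  have t''t : t'' < t.
    by apply: act_order; rewrite rot''; move: dec; rewrite (gtr0_norm e0) (ltr0_norm e1); lra.
  have s1 : sgn_err = 1 by rewrite /sgn_err e0.
  have st'' : sh 1 t'' = t'.
    rewrite /t'' sh_addz /sh s1 !mul1r -actD k''E rmorphN /=.
    have -> : q n + (k%:Z - q n.+1 - q n) = k' by rewrite k'E; ring.
    by rewrite /t' /l'' !rmorphD /=; ring.
  apply: no''; rewrite st''; have [xt'|] := ltP x t'.
    by rewrite andbT; lra.
  move=> t'x; exfalso; apply: no'; rewrite t'x /=.
  by apply: lt_trans xt _; rewrite sh_lt.
have e0' : err n < 0 by rewrite lt_neqAle e0 cvg_err_neq0.
have e1 : 0 < err n.+1 by nra.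
have t't : t' < t by apply: act_order; rewrite rot'; lra.
have tt'' : t < t''.
  by apply: act_order; rewrite rot''; move: dec; rewrite (ltr0_norm e0') (gtr0_norm e1); lra.
have s1 : sgn_err = -1 by rewrite /sgn_err ltNge e0.
have st'' : sh 1 t' = t''.
  rewrite /t' sh_addz /sh s1 mul1r !mulN1r mul1r -actD k'E opprK.
  have -> : - q n + (k%:Z - q n.+1) = k'' by rewrite k''E; ring.
  by rewrite /t'' /l'' !rmorphD /=; ring.
have [xt'|t''x] := ltP x t''.
  by apply: no'; rewrite st'' xt' andbT; lra.
apply: no''; rewrite t''x /=.
by apply: lt_trans xt _; rewrite sh_lt.
Qed.

End FixedN.

End Grid.

(** * Cross-ratios on the real line *)

Section CrossRatioReal.
Variable R : realType.
Local Notation N := (@Normc.normc R).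

(** Equal to 4 when the four points are evenly spaced, and large when one of the
    outer intervals is short. *)
Definition cratio (a b c d : R) : R := (c - a) * (d - b) / ((b - a) * (d - c)).

Lemma cratio_gt0 a b c d : a < b -> b < c -> c < d -> 0 < cratio a b c d.
Proof.
by move=> ab bc cd; rewrite /cratio divr_gt0// mulr_gt0// subr_gt0//;
  [apply: lt_trans bc | apply: lt_trans cd].
Qed.

Variables (Delta : R) (g : R -> R) (V : set R[i]^o) (f : R[i]^o -> R[i]^o).
Hypothesis Delta_gt0 : 0 < Delta.
Hypothesis f_ext : holo_diffeo_extension Delta g V f.
Hypothesis Re_Df : (0 < ereal_inf
       [set (complex.Re (derive1 f z))%:E | z in strip Delta])%E.
Hypothesis g_incr : {homo g : x y / x < y}.
Hypothesis g_per : forall x, g (x + 1) = g x + 1.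

Lemma nc_real_sub (x y : R) : Normc.normc (x%:C - y%:C) = `|x - y|.
Proof. by rewrite -rmorphB nc_real. Qed.

Lemma real_lower : exists2 c : R, 0 < c &
  forall x y, x < y -> c * (y - x) <= g y - g x.
Proof.
have [c c0 hc] := strip_lower Delta_gt0 f_ext Re_Df.
exists c => // x y xy; have gxy := g_incr xy.
have Im0 (t : R) : `|complex.Im (t%:C)| < Delta by rewrite normr0.
have := hc _ _ (Im0 y) (Im0 x).
by rewrite !(ext_real f_ext) !nc_real_sub !gtr0_norm ?subr_gt0.
Qed.

Lemma real_upper : exists2 L : R, 0 < L &
  forall x y, x < y -> g y - g x <= L * (y - x).
Proof.
have [r [L [K [r0 _ L0 K0 H]]]] := uniform_cross_ratio Delta_gt0 f_ext.
have ri : 0 < r^-1 by rewrite invr_gt0.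
exists (L + 1 + r^-1); first by rewrite !addr_gt0.
move=> x y xy; have xy0 : 0 < y - x by rewrite subr_gt0.
have gxy := g_incr xy.
have [yxr|yxr] := leP (y - x) r.
  have [HL _] := H x; have := HL y%:C x%:C.
  rewrite !(ext_real f_ext) !nc_real_sub subrr normr0 gtr0_norm//.
  move=> /(_ yxr (ltW r0)); rewrite gtr0_norm ?subr_gt0//.
  by move=> h; nra.
have : g y - g x <= y - x + 1.
  pose m := Num.floor (y - x) + 1.
  have h1 := floorD1_gt (y - x).
  have h2 := floor_le (y - x).
  have h3 : g (x + m%:~R) = g x + m%:~R.
    have mE : m = (absz m)%:Z.
      rewrite gez0_abs// /m addr_ge0// floor_ge0; exact: ltW.
    rewrite mE; move: (absz m) => k; elim: k => [|k IH]; first by rewrite !addr0.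
    by rewrite -addn1 PoszD rmorphD /= !addrA g_per IH.
  have h4 : g y <= g (x + m%:~R) by apply/ltW/g_incr; rewrite /m; lra.
  move: h4; rewrite h3 /m rmorphD /=; lra.
have : 1 <= r^-1 * (y - x) by rewrite mulrC ler_pdivlMr// mul1r ltW.
nra.
Qed.

(** The distortion is of second order in the size of the configuration; its sum along an orbit
    is then controlled by the largest interval. *)
Lemma cratio_local : exists r K : R, [/\ 0 < r, 0 < K &
  forall a b c d, a < b -> b < c -> c < d -> d - a <= r ->
  cratio (g a) (g b) (g c) (g d) <= cratio a b c d * (1 + K * (d - a) ^+ 2)].
Proof.
have [m m0 hm] := strip_lower Delta_gt0 f_ext Re_Df.
have [r [L [K [r0 rD L0 K0 H]]]] := uniform_cross_ratio Delta_gt0 f_ext.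
exists r, (K / m ^+ 2); split => //; first by rewrite divr_gt0// exprn_gt0.
move=> a b c d ab bc cd dar; have [_ HX] := H a.
have Im_near (z : R[i]) : N (z - a%:C) <= r -> `|complex.Im z| < Delta.
  move=> hz; apply: le_lt_trans rD; apply: le_trans hz; apply: le_trans (nc_Im _).
  by rewrite ImD ImN /= subr0.
have expand (z w : R[i]) : N (z - a%:C) <= r -> N (w - a%:C) <= r -> m * N (z - w) <= N (f z - f w).
  by move=> /Im_near hz /Im_near hw; exact: hm.
have near_a (x : R) : a <= x <= d -> N (x%:C - a%:C) <= r.
  by move=> /andP[? ?]; rewrite nc_real_sub ger0_norm ?subr_ge0//; lra.
(* with [b] and [c] exchanged, the distortion is the one of [cratio] *)
have [rho hrho] := cross_ratio_distortion m0 K0 HX expand (near_a a ltac:(lra))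
  (near_a c ltac:(lra)) (near_a b ltac:(lra)) (near_a d ltac:(lra)).
rewrite !(ext_real f_ext) -!rmorphB -!rmorphM => E.
have gab := g_incr ab; have gbc := g_incr bc; have gcd := g_incr cd.
have cr0 := cratio_gt0 ab bc cd.
have rhoE : rho = (cratio (g a) (g b) (g c) (g d) / cratio a b c d)%:C.
  have X0 : (g a - g b) * (g d - g c) * ((a - c) * (d - b)) != 0.
    by rewrite !mulf_neq0// subr_eq0; apply/eqP; lra.
  have XC : ((g a - g b) * (g d - g c) * ((a - c) * (d - b)))%:C != 0.
    by rewrite Creal_eq0.
  apply: (mulIf XC); rewrite -E -rmorphM; congr (_%:C); rewrite /cratio.
  by field; rewrite !subr_eq0; repeat (apply/andP; split); apply/eqP; lra.
rewrite mulrC -ler_pdivrMr//; move: hrho.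
rewrite rhoE -(rmorph1 (real_complex R)) !nc_real_sub => hrho.
have h1 : `|c - b| * `|d - a| <= (d - a) ^+ 2.
  by rewrite expr2 !gtr0_norm ?subr_gt0; [apply: ler_pM; lra | lra | lra].
have k0 : 0 <= K / m ^+ 2 by rewrite divr_ge0 ?exprn_ge0 ?ltW.
have h2 := ler_wpM2l k0 h1.
by have := le_trans (ler_norm _) hrho; lra.
Qed.

(** For large intervals, the Lipschitz constants of [g] and of its inverse bound the
    distortion. *)
Lemma cratio_global : exists2 K : R, 0 < K &
  forall a b c d, a < b -> b < c -> c < d ->
  cratio (g a) (g b) (g c) (g d) <= cratio a b c d * (1 + K * (d - a)).
Proof.
have [m m0 hm] := real_lower; have [L L0 hL] := real_upper.
have [r [K [r0 K0 hK]]] := cratio_local.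
have Lm0 : 0 < (L / m) ^+ 2 / r by rewrite divr_gt0// exprn_gt0// divr_gt0.
exists (K * r + (L / m) ^+ 2 / r); first by rewrite addr_gt0// mulr_gt0.
move=> a b c d ab bc cd; have da : 0 < d - a by lra.
have cr0 := cratio_gt0 ab bc cd.
have [dar|dar] := leP (d - a) r.
  apply: le_trans (hK _ _ _ _ ab bc cd dar) _; rewrite ler_pM2l// lerD2l.
  rewrite expr2 mulrDl.
  have h1 : (d - a) * (d - a) <= r * (d - a) by rewrite ler_pM2r.
  have h2 : 0 <= (L / m) ^+ 2 / r * (d - a) by rewrite mulr_ge0 ?ltW.
  have h3 : K * ((d - a) * (d - a)) <= K * (r * (d - a)) by rewrite ler_pM2l.
  lra.
have eA : 0 < b - a by lra.
have eB : 0 < d - c by lra.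
have eC : 0 < c - a by lra.
have eD : 0 < d - b by lra.
have hA := hm a b ab; have hB := hm c d cd.
have hC := hL a c ltac:(lra); have hD := hL b d ltac:(lra).
have gA : 0 < g b - g a by apply: lt_le_trans hA; rewrite mulr_gt0.
have gB : 0 < g d - g c by apply: lt_le_trans hB; rewrite mulr_gt0.
have gC : 0 < g c - g a by rewrite subr_gt0; apply: g_incr; lra.
have gD : 0 < g d - g b by rewrite subr_gt0; apply: g_incr; lra.
have h1 : cratio (g a) (g b) (g c) (g d) <= cratio a b c d * (L / m) ^+ 2.
  rewrite {1}/cratio ler_pdivrMr ?mulr_gt0//.
  have -> : cratio a b c d * (L / m) ^+ 2 * ((g b - g a) * (g d - g c)) =
    (L * (c - a)) * (L * (d - b)) * (((g b - g a) * (g d - g c)) / ((m * (b - a)) * (m * (d - c)))).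
    by rewrite /cratio; field; rewrite !gt_eqF.
  have h2 : 1 <= ((g b - g a) * (g d - g c)) / ((m * (b - a)) * (m * (d - c))).
    rewrite ler_pdivlMr ?mulr_gt0// mul1r.
    by apply: ler_pM => //; rewrite mulr_ge0 ?ltW.
  have h3 : (g c - g a) * (g d - g b) <= (L * (c - a)) * (L * (d - b)).
    by apply: ler_pM => //; rewrite ltW.
  apply: le_trans h3 _; rewrite ler_peMr// !mulr_ge0 ?ltW//.
apply: le_trans h1 _; rewrite ler_pM2l//.
have h2 : 1 <= (d - a) / r by rewrite ler_pdivlMr// mul1r ltW.
have h3 : (L / m) ^+ 2 <= (L / m) ^+ 2 / r * (d - a).
  by rewrite -mulrA [r^-1 * _]mulrC ler_peMr// sqr_ge0.
have h4 : 0 <= K * r * (d - a) by rewrite !mulr_ge0// ltW.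
by rewrite mulrDl; lra.
Qed.

End CrossRatioReal.

(** * Sequences whose consecutive cross-ratios are almost 4 *)

Section NearlyGeometric.
Variable R : realType.

(** If [x] and [y] are the successive ratios of three adjacent lengths, the hypothesis says
    that their cross-ratio is at most [4 + delta]. For [delta = 0], it reads
    [(1 + x) / (3 - x) <= y], where [(1 + x) / (3 - x) - x = (x - 1) ^+ 2 / (3 - x)]:
    a ratio away from 1 increases. *)
Lemma ratio_growth (eta delta x y : R) : 0 < eta <= 1 -> 0 < delta <= eta ^+ 2 / 10 ->
  0 < y -> 1 + eta <= x -> (1 + x) * (1 + y) <= (4 + delta) * y ->
  x + eta ^+ 2 / 8 <= y.
Proof.
move=> /andP[e0 e1] /andP[d0 d1] y0 xe H.
have e2 : 0 < eta ^+ 2 by rewrite exprn_gt0.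
have e21 : eta ^+ 2 <= 1 by rewrite expr_le1// ltW.
have H' : 1 + x <= y * (3 + delta - x) by lra.
have x3 : x < 3 + delta by nra.
rewrite leNgt; apply/negP => yx.
have h1 : y * (3 + delta - x) <= (x + eta ^+ 2 / 8) * (3 + delta - x).
  by apply: ler_wpM2r; lra.
have h2 : eta ^+ 2 <= (x - 1) ^+ 2 by rewrite lerXn2r ?nnegrE; lra.
have h3 : delta * x <= eta ^+ 2 / 10 * (31 / 10) by apply: ler_pM; lra.
have h4 : eta ^+ 2 / 8 * (3 + delta - x) <= eta ^+ 2 / 8 * (21 / 10).
  by apply: ler_wpM2l; lra.
nra.
Qed.

(** By the previous lemma, a ratio greater than [1 + eta] would grow by a fixed amount at
    each step, while the hypothesis bounds all ratios by [4 + delta]. *)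
Lemma nearly_geometric_fwd (eta : R) : 0 < eta <= 1 ->
  exists2 delta : R, 0 < delta & exists M : nat, forall u : nat -> R,
  (forall i, 0 < u i) ->
  (forall i, (i < M)%N -> (u i + u i.+1) * (u i.+1 + u i.+2) <= (4 + delta) * (u i * u i.+2)) ->
  u 1%N <= (1 + eta) * u 0%N.
Proof.
move=> /andP[e0 e1]; exists (eta ^+ 2 / 10); first by rewrite divr_gt0 ?exprn_gt0.
set delta := eta ^+ 2 / 10.
have e2 : 0 < eta ^+ 2 by rewrite exprn_gt0.
have e21 : eta ^+ 2 <= 1 by rewrite expr_le1// ltW.
have d0 : 0 < delta by rewrite divr_gt0.
have [m hm] := nat_gt (5 / (eta ^+ 2 / 8)).
exists m.+1 => u u0 hu; rewrite leNgt; apply/negP => h.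
pose x i := u i.+1 / u i.
have xle i : (i < m.+1)%N -> x i <= 4 + delta.
  move=> im; have := hu i im; rewrite /x ler_pdivrMr//.
  have := u0 i; have := u0 i.+1; have := u0 i.+2.
  move: (u i) (u i.+1) (u i.+2) => p q r r0 q0 p0 H.
  have : q * r <= (4 + delta) * p * r by nra.
  by rewrite ler_pM2r.
have xstep i : (i < m.+1)%N -> 1 + eta <= x i -> x i + eta ^+ 2 / 8 <= x i.+1.
  move=> im xi; apply: (@ratio_growth eta delta) => //; rewrite ?e0 ?d0 ?lexx//.
    by rewrite divr_gt0.
  have := hu i im; rewrite /x.
  have := u0 i; have := u0 i.+1; have := u0 i.+2.
  move: (u i) (u i.+1) (u i.+2) => p q r r0 q0 p0 H.
  have pq : 0 < (p * q)^-1 by rewrite invr_gt0 mulr_gt0.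
  have -> : (1 + q / p) * (1 + r / q) = ((p + q) * (q + r)) * (p * q)^-1.
    by field; rewrite !gt_eqF.
  have -> : (4 + delta) * (r / q) = ((4 + delta) * (p * r)) * (p * q)^-1.
    by field; rewrite !gt_eqF.
  by rewrite ler_pM2r.
have xge i : (i <= m)%N -> 1 + eta + i%:R * (eta ^+ 2 / 8) <= x i.
  elim: i => [|i IH] im.
    by rewrite mul0r addr0 /x ler_pdivlMr// ltW.
  have hi := IH (ltnW im).
  have i0 : 0 <= i%:R * (eta ^+ 2 / 8) by rewrite mulr_ge0// divr_ge0// ltW.
  have hh : 1 + eta <= x i by lra.
  by have := xstep i (ltnW im) hh; rewrite -[i.+1%:R]natr1; lra.
have := xge m (leqnn m); have := xle m (ltnSn m).
rewrite ltr_pdivrMr ?divr_gt0// in hm.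
rewrite /delta; lra.
Qed.

Lemma nearly_geometric (eta : R) : 0 < eta <= 1 ->
  exists2 delta : R, 0 < delta & exists M : nat, forall u : int -> R,
  (forall i, 0 < u i) ->
  (forall i, `|i| <= M%:Z ->
    (u i + u (i + 1)) * (u (i + 1) + u (i + 2)) <= (4 + delta) * (u i * u (i + 2))) ->
  u 1 <= (1 + eta) * u 0 /\ u 0 <= (1 + eta) * u 1.
Proof.
move=> eta01; have [delta d0 [M HM]] := nearly_geometric_fwd eta01.
exists delta => //; exists M.+2 => u u0 hu; split.
  apply: (HM (fun i : nat => u i)) => [i|i iM]; first exact: u0.
  have := hu i; have -> : i.+1 = i + 1 :> int by lia.
  have -> : i.+2 = i + 2 :> int by lia.
  by apply; lia.
apply: (HM (fun i : nat => u (1 - i%:Z))) => [i|i iM]; first exact: u0.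
have := hu (- (i.+1)%:Z).
have -> : - (i.+1)%:Z + 1 = 1 - i.+1%:Z by lia.
have -> : - (i.+1)%:Z + 2 = 1 - i%:Z by lia.
have -> : - (i.+1)%:Z = 1 - i.+2%:Z by lia.
move=> H; have {}H := H ltac:(lia).
apply: le_trans (le_trans H _); rewrite le_eqVlt; apply/orP; left; apply/eqP; ring.
Qed.

End NearlyGeometric.

(** * The grid of closest returns becomes small and even *)

Section Distortion.
Variable R : realType.
Variables g h : R -> R.
Hypothesis g_incr : {homo g : x y / x < y}.
Hypothesis g_per : forall x, g (x + 1) = g x + 1.
Hypothesis gK : cancel g h.
Hypothesis hK : cancel h g.
Variable alpha : R.
Hypothesis alphaE : alpha = rotation_number g.
Hypothesis alpha_irr : irrational alpha.
Hypothesis g_lower : exists2 c : R, 0 < c & forall x y, x < y -> c * (y - x) <= g y - g x.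
Hypothesis g_upper : exists2 L : R, 0 < L & forall x y, x < y -> g y - g x <= L * (y - x).
Hypothesis g_cratio : exists2 K : R, 0 < K &
  forall a b c d, a < b -> b < c -> c < d ->
  cratio (g a) (g b) (g c) (g d) <= cratio a b c d * (1 + K * (d - a)).
Hypothesis g_cratio_local : exists r K : R, [/\ 0 < r, 0 < K &
  forall a b c d, a < b -> b < c -> c < d -> d - a <= r ->
  cratio (g a) (g b) (g c) (g d) <= cratio a b c d * (1 + K * (d - a) ^+ 2)].

Local Notation act := (act g h).
Local Notation q := (cvg_den alpha).
Local Notation p := (cvg_num alpha).
Local Notation err := (cvg_err alpha).
Local Notation sh := (sh g h alpha).
Local Notation gap := (gap g h alpha).

Let actD := actD gK hK.
Let act_addz := act_addz g_per gK hK.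
Let shD := shD g_per gK hK alpha.
Let sh0 := sh0 g h alpha.
Let sh_lt := sh_lt g_incr hK alpha.
Let sh_le := sh_le g_incr hK alpha.
Let sh_act := sh_act g_per gK hK alpha.
Let sh_addz := sh_addz g_per gK hK alpha.
Let sh_index_lt := sh_index_lt g_incr g_per gK hK alphaE alpha_irr.
Let gap_gt0 := gap_gt0 g_incr g_per gK hK alphaE alpha_irr.
Let gap_addz := gap_addz g_per gK hK alpha.

Lemma lipschitz_continuous (F : R -> R) (L : R) : 0 < L ->
  (forall x y, x < y -> 0 <= F y - F x <= L * (y - x)) -> continuous F.
Proof.
move=> L0 HF x; apply/cvgrPdist_lt => e e0.
have hb : nbhs x (ball x (e / L)) by apply: nbhsx_ballx; rewrite divr_gt0.
near=> t.
have tx : `|x - t| < e / L by have : ball x (e / L) t by near: t.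
have H : `|F x - F t| <= L * `|x - t|.
  have [xt|tx'|->] := ltgtP x t.
  - have /andP[h1 h2] := HF _ _ xt.
    rewrite distrC [`|x - t|]distrC ger0_norm// gtr0_norm// subr_gt0//.
  - have /andP[h1 h2] := HF _ _ tx'.
    by rewrite ger0_norm// gtr0_norm// subr_gt0.
  - by rewrite !subrr normr0 mulr0.
by apply: le_lt_trans H _; rewrite mulrC -ltr_pdivlMr.
Unshelve. all: by end_near. Qed.

Lemma g_continuous : continuous g.
Proof.
have [L L0 HL] := g_upper; apply: (lipschitz_continuous L0) => x y xy.
by rewrite HL// andbT subr_ge0 ltW// g_incr.
Qed.

Lemma h_continuous : continuous h.
Proof.
have [c c0 hc] := g_lower.
have c1 : 0 < c^-1 by rewrite invr_gt0.
apply: (lipschitz_continuous c1) => x y xy.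
have hxy : h x < h y by rewrite (h_lt g_incr hK).
rewrite subr_ge0 ltW//=; have := hc _ _ hxy; rewrite !hK.
by rewrite -ler_pdivlMl.
Qed.

Lemma act_continuous k : continuous (act k).
Proof.
have it (F : R -> R) m : continuous F -> continuous (iter m F).
  move=> cF; elim: m => [|m IH] x; first exact: cvg_id.
  by apply: (@continuous_comp _ _ _ (iter m F) F); [exact: IH | exact: cF].
by case: k => m; [exact: (it g m g_continuous) | exact: (it h m.+1 h_continuous)].
Qed.

(** For the existence of a smallest gap, and for the continuity of the curve. *)
Lemma gap_continuous n : continuous (gap n).
Proof.
move=> x; apply: cvgB; last exact: cvg_id.
by apply: cvgD; [exact: act_continuous | exact: cvg_cst].
Qed.

Lemma gap_sh n m x : gap n (sh n m x) = sh n (m + 1) x - sh n m x.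
Proof. by rewrite /gap [m + 1]addrC shD. Qed.

(** The cross-ratio of four consecutive points of the grid. It is compared with 4, its
    value on an even grid. *)
Definition chi n y := cratio y (sh n 1 y) (sh n 2 y) (sh n 3 y).

Definition width n y := sh n 3 y - y.

Lemma sh01 n y : y < sh n 1 y.
Proof. by rewrite -{1}[y](sh0 n); exact: sh_index_lt. Qed.
Lemma sh12 n y : sh n 1 y < sh n 2 y.
Proof. exact: sh_index_lt. Qed.
Lemma sh23 n y : sh n 2 y < sh n 3 y.
Proof. exact: sh_index_lt. Qed.

Lemma chi_gt0 n y : 0 < chi n y.
Proof. by apply: cratio_gt0; [exact: sh01 | exact: sh12 | exact: sh23]. Qed.

Lemma width_gap n y : width n y = gap n y + gap n (sh n 1 y) + gap n (sh n 2 y).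
Proof.
by rewrite !gap_sh -[1 + 1]/(2 : int) -[2 + 1]/(3 : int) /width /gap; ring.
Qed.

Lemma chiE n y : let l0 := gap n y in let l1 := gap n (sh n 1 y) in
  let l2 := gap n (sh n 2 y) in chi n y = (l0 + l1) * (l1 + l2) / (l0 * l2).
Proof.
rewrite /= !gap_sh -[1 + 1]/(2 : int) -[2 + 1]/(3 : int) /gap /chi /cratio.
by congr (_ / _); ring.
Qed.

Lemma chi_le n y A : let l0 := gap n y in let l1 := gap n (sh n 1 y) in
  let l2 := gap n (sh n 2 y) in
  chi n y <= A <-> (l0 + l1) * (l1 + l2) <= A * (l0 * l2).
Proof. by rewrite /= chiE ler_pdivrMr// mulr_gt0. Qed.

Lemma chi_addz n y (l : int) : chi n (y + l%:~R) = chi n y.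
Proof. by rewrite !chiE !sh_addz !gap_addz. Qed.

(** The quadruples overlap, but each width is the sum of three gaps on orbits. *)
Lemma sum_width n m k y : (k <= m * `|q n.+1|%N)%N ->
  \sum_(0 <= i < k) width n (act i y) <= 6 * m%:R.
Proof.
move=> km.
have S z := gap_sum g_incr g_per gK hK alphaE alpha_irr z km.
have -> : \sum_(0 <= i < k) width n (act i y) = \sum_(0 <= i < k) gap n (act i y) +
   \sum_(0 <= i < k) gap n (act i (sh n 1 y)) + \sum_(0 <= i < k) gap n (act i (sh n 2 y)).
  by rewrite -!big_split; apply: eq_bigr => i _; rewrite width_gap !sh_act.
have := S y; have := S (sh n 1 y); have := S (sh n 2 y); lra.
Qed.

Lemma width_gt0 n y : 0 < width n y.
Proof. by rewrite /width subr_gt0 -{1}[y](sh0 n); exact: sh_index_lt. Qed.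

(** The factors multiply along the orbit and the sum of the widths is bounded, as in Denjoy's
    argument. *)
Lemma chi_iter n kappa : 0 <= kappa ->
  (forall y, chi n (g y) <= chi n y * (1 + kappa * width n y)) ->
  forall m (k : nat) y, (k <= m * `|q n.+1|%N)%N ->
  chi n (act k y) <= chi n y * expR (kappa * (6 * m%:R)).
Proof.
move=> k0 H m k y km.
have : chi n (act k y) <= chi n y * expR (kappa * \sum_(0 <= i < k) width n (act i y)).
  elim: k {km} => [|k IH]; first by rewrite big_geq// mulr0 expR0 mulr1.
  rewrite big_nat_recr//= mulrDr expRD mulrA.
  apply: le_trans (H _) _; apply: ler_pM => //.
  - exact: ltW (chi_gt0 _ _).
  - by rewrite addr_ge0// mulr_ge0// ltW// width_gt0.
  - exact: expR_ge1Dx.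
move=> /le_trans; apply; rewrite ler_pM2l ?chi_gt0// ler_expR.
by apply: ler_wpM2l => //; exact: sum_width.
Qed.

(** If the middle gap of three is the smallest gap, the cross-ratio is at most 4. *)
Lemma chi_min n : exists y, chi n y <= 4.
Proof.
have [y0 _ hy0] : exists2 y0 : R, y0 \in `[(0:R), 1] &
    forall t, t \in `[(0:R), 1] -> gap n y0 <= gap n t.
  apply: EVT_min; first exact: ler01.
  by apply: continuous_subspaceT; exact: gap_continuous.
have hy x : gap n y0 <= gap n x.
  have -> : gap n x = gap n (x - (Num.floor x)%:~R) by rewrite -mulrNz gap_addz.
  apply: hy0; rewrite in_itv/=; have := floor_itv x; rewrite rmorphD /= => /andP[? ?].
  by apply/andP; split; lra.
exists (sh n (-1) y0); apply/chi_le.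
rewrite -!shD subrr sh0.
have := hy (sh n (-1) y0); have := hy (sh n (2 - 1) y0); have := gap_gt0 n y0.
move: (gap n (sh n (-1) y0)) (gap n y0) (gap n (sh n (2 - 1) y0)) => l0 l1 l2 h1 h2 h3.
have : (l0 + l1) * (l1 + l2) <= (l0 + l0) * (l2 + l2) by apply: ler_pM; lra.
lra.
Qed.

Lemma sgn_err_sqr n : sgn_err alpha n * sgn_err alpha n = 1.
Proof. by rewrite /sgn_err; case: ifP. Qed.

Lemma q_abs n : (`|q n|%N : int) = q n.
Proof.
by rewrite abszE ger0_norm//; have /andP[] := cvg_den_mono alpha_irr n; lia.
Qed.

(** Positive iterates of [g] move along the grid in the direction of [sgn_err] only. *)
Lemma sh_sgn n (m : nat) y : exists l : int,
  sh n (sgn_err alpha n * m%:Z) y = act (m * `|q n|)%N y + l%:~R.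
Proof.
exists (- (sgn_err alpha n * m%:Z * (sgn_err alpha n * p n))); rewrite /sh.
congr (act _ _ + _); rewrite PoszM q_abs.
have -> : sgn_err alpha n * m * (sgn_err alpha n * q n) =
   (sgn_err alpha n * sgn_err alpha n) * (m%:Z * q n) by ring.
by rewrite sgn_err_sqr mul1r.
Qed.

(** Start from a point [z] where [chi] is at most 4. The interval of some iterate of [z] of
    order less than [q_(n+1) + q_n] contains [x] shifted by [M] steps
    against the direction of [g^(q_n)]; from there, positive iterates of [g] reach
    all the grid points within [M] steps of [x], and their images under
    the [q_(n+1)] first iterates. *)
Lemma grid n kappa (M : nat) : 0 <= kappa ->
  (forall y, chi n (g y) <= chi n y * (1 + kappa * width n y)) ->
  forall x, exists2 y, y <= x < sh n 1 y &
  forall (i : int) (j : nat), `|i| <= M%:Z -> (j <= `|q n.+1|)%N ->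
    chi n (sh n i (act j y)) <= 4 * expR (kappa * (6 * (2 * M + 3)%:R)).
Proof.
move=> k0 H x; have [z hz] := chi_min n.
set s := sgn_err alpha n.
have /andP[q1 q12] := cvg_den_mono alpha_irr n.
have [k kq [l hl]] := cover g_incr g_per gK hK alphaE alpha_irr n (sh n (- (s * M%:Z)) x) z.
set y1 := act k z + l%:~R in hl.
exists (sh n (s * M%:Z) y1).
  have /andP[h1 h2] := hl.
  have e : sh n (s * M%:Z) (sh n (- (s * M%:Z)) x) = x by rewrite -shD subrr sh0.
  by rewrite -shD addrC shD -e sh_le sh_lt h1.
move=> i j iM jq.
have ss : s * s = 1 by exact: sgn_err_sqr.
pose m := absz (s * i + M%:Z)%R.
have mE : m%:Z = s * i + M%:Z.
  rewrite abszE ger0_norm//; move: iM; rewrite ler_norml => /andP[? ?].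
  by rewrite /s /sgn_err; case: ifP => _; rewrite ?mul1r ?mulN1r; lia.
have m2 : (m <= 2 * M)%N.
  rewrite -lez_nat mE; move: iM; rewrite ler_norml => /andP[? ?].
  by rewrite /s /sgn_err; case: ifP => _; rewrite ?mul1r ?mulN1r; lia.
have -> : sh n i (act j (sh n (s * M) y1)) = sh n (s * m%:Z) (act j y1).
  rewrite -sh_act -shD; congr (sh n _ _).
  by rewrite mE mulrDr mulrA ss mul1r.
have [l' ->] := sh_sgn n m (act j y1).
rewrite chi_addz /y1 !act_addz chi_addz -!actD.
have -> : (m * `|q n|)%N%:Z + j%:Z + k%:Z = (m * `|q n| + j + k)%N by lia.
apply: le_trans (chi_iter (m := 2 * M + 3) k0 H _ _) _.
  have e1 : (`|q n| <= `|q n.+1|)%N by rewrite -lez_nat !q_abs.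
  have e2 : (k <= 2 * `|q n.+1|)%N.
    by rewrite -lez_nat PoszM q_abs; lia.
  have e3 : (m * `|q n| <= 2 * M * `|q n.+1|)%N by apply: leq_mul.
  by rewrite !mulnDl; lia.
by rewrite ler_pM2r// expR_gt0.
Qed.

(** Bounded cross-ratios make adjacent gaps of order [n+2] comparable. The gap of
    order [n+3] at [x] is covered by two of them, and the next one is still inside
    the interval of order [n], so the gap of order [n] exceeds the one of order [n+3] by a definite
    proportion. *)
Lemma gap_step : exists2 B : R, 0 < B & forall n x,
  gap n.+3 x <= B * (gap n x - gap n.+3 x).
Proof.
have [K K0 hK'] := g_cratio.
pose A := 4 * expR (K * (6 * (2 * 2 + 3)%:R)).
have A0 : 0 < A by rewrite mulr_gt0// expR_gt0.
exists (A ^+ 2 + A); first by rewrite addr_gt0// exprn_gt0.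
move=> n x.
have Hstep y : chi n.+2 (g y) <= chi n.+2 y * (1 + K * width n.+2 y).
  rewrite /chi /width -!(act1 g h) !sh_act.
  by apply: hK'; [exact: sh01 | exact: sh12 | exact: sh23].
set x' := sh n.+3 1 x.
have [y /andP[yx xy] hy] := grid 2 (ltW K0) Hstep x'.
have {}hy i : `|i| <= 2 -> chi n.+2 (sh n.+2 i y) <= A.
  by move=> i2; have := hy i 0%N i2 (leq0n _).
have bnd i : `|i| <= 2 -> gap n.+2 (sh n.+2 (i + 1) y) <= A * gap n.+2 (sh n.+2 i y)
    /\ gap n.+2 (sh n.+2 (i + 1) y) <= A * gap n.+2 (sh n.+2 (i + 2) y).
  move=> /hy /chi_le; rewrite -!shD ![_ + i]addrC.
  have := gap_gt0 n.+2 (sh n.+2 i y); have := gap_gt0 n.+2 (sh n.+2 (i + 1) y).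
  have := gap_gt0 n.+2 (sh n.+2 (i + 2) y).
  move: (gap _ _) (gap _ (sh n.+2 (i+1) y)) (gap _ (sh n.+2 (i+2) y)) => l0 l1 l2 h2 h1 h0 H.
  by split; nra.
have E0 := cvg_err_dec alpha_irr n; have E1 := cvg_err_dec alpha_irr n.+1.
have E2 : `|err n.+3| < `|err n.+2|.
  apply: lt_le_trans (cvg_err_dec alpha_irr n.+2); rewrite ltrDl normr_gt0.
  exact: cvg_err_neq0.
have shr N m : (m * (sgn_err alpha N * q N))%:~R * alpha +
   (- (m * (sgn_err alpha N * p N)))%:~R = m%:~R * `|err N| by exact: sh_rot.
(* for the rotation: [e_(n+3) + 2 * e_(n+2) <= e_n], as [e_(n+3) + e_(n+2) <= e_(n+1)]
   and [e_(n+2) + e_(n+1) <= e_n] *)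
have e2x : sh n.+2 2 x' <= sh n 1 x.
  rewrite /x' /sh act_addz -actD -addrA -rmorphD /=.
  apply: (act_order_le g_incr g_per gK hK alphaE alpha_irr).
  rewrite shr; rewrite !rmorphD /=.
  have := shr n.+3 1; have := shr n.+2 2; rewrite [1%:~R * _]mul1r.
  rewrite -[2%:~R]/(2 : R) => e1 e2; rewrite mul1r.
  lra.
have e1x : sh n.+2 (-1) x' <= x.
  rewrite -[leRHS](sh0 n) /x' /sh act_addz -actD -addrA -rmorphD /=.
  apply: (act_order_le g_incr g_per gK hK alphaE alpha_irr).
  rewrite shr mul0r !rmorphD /=.
  have := shr n.+3 1; have := shr n.+2 (-1); rewrite [1%:~R * _]mul1r mulrNz mulN1r => e1 e2.
  lra.
have y1x : sh n.+2 (-1) y <= x by apply: le_trans e1x; rewrite sh_le.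
have y2x : sh n.+2 2 y <= sh n 1 x by apply: le_trans e2x; rewrite sh_le.
have [_ b1] := bnd (-2) isT; have [_ b2] := bnd (-1) isT.
have g0 : gap n.+2 (sh n.+2 (-1) y) = y - sh n.+2 (-1) y.
  by rewrite gap_sh addNr sh0.
have g1 : gap n.+2 y = sh n.+2 1 y - y by [].
have g2 : gap n.+2 (sh n.+2 1 y) = sh n.+2 2 y - sh n.+2 1 y by rewrite gap_sh.
have i1 : (-2 + 1 : int) = -1 by []. have i2 : (-2 + 2 : int) = 0 by [].
have i3 : (-1 + 1 : int) = 0 by []. have i4 : (-1 + 2 : int) = 1 by [].
move: b1 b2; rewrite i1 i2 i3 i4 sh0.
rewrite g0 g1 g2 => b1 b2.
have gx3 : gap n.+3 x = x' - x by [].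
have gx0 : gap n x = sh n 1 x - x by [].
rewrite gx3 gx0.
have c1 : x' - x <= A * (sh n.+2 1 y - y) + (sh n.+2 1 y - y) by lra.
have c2 : sh n.+2 2 y - sh n.+2 1 y <= sh n 1 x - x - (x' - x) by lra.
have c3 : 0 <= sh n.+2 2 y - sh n.+2 1 y by rewrite subr_ge0 ltW// sh12.
nra.
Qed.

Lemma gap_dec n x : gap n.+1 x <= gap n x.
Proof.
rewrite /gap lerD2r /sh; apply: (act_order_le g_incr g_per gK hK alphaE alpha_irr).
rewrite !sh_rot !mul1r; apply: le_trans (cvg_err_dec alpha_irr n).
by rewrite lerDl.
Qed.

(** Denjoy's theorem, in a quantitative form: the gaps decay geometrically. *)
Lemma gap_small eps : 0 < eps -> exists n0, forall n x, (n0 <= n)%N -> gap n x <= eps.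
Proof.
move=> e0; have [B B0 hB] := gap_step.
pose lam := B / (1 + B).
have B1 : 0 < 1 + B by lra.
have l0 : 0 < lam by rewrite divr_gt0.
have l1 : lam < 1 by rewrite ltr_pdivrMr// mul1r; lra.
have step n x : gap n.+3 x <= lam * gap n x.
  rewrite /lam mulrAC ler_pdivlMr//; have := hB n x; lra.
have pw k x : gap (3 * k) x <= lam ^+ k.
  elim: k => [|k IH].
    by rewrite muln0 expr0 ltW// (gap_lt1 g_incr g_per gK hK alphaE alpha_irr).
  rewrite mulnS exprS; apply: le_trans (step _ _) _.
  by apply: ler_wpM2l => //; exact: ltW.
have [k hk] : exists k, lam ^+ k <= eps.
  have : (fun k => lam ^+ k) @ \oo --> (0 : R).
    by apply: cvg_expr; rewrite ger0_norm// ltW.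
  move=> /cvgrPdist_le /(_ eps e0) [k _ /(_ k (leqnn k))] /=.
  have lk : 0 <= lam ^+ k by rewrite exprn_ge0// ltW.
  by rewrite sub0r normrN (ger0_norm lk) => ?; exists k.
exists (3 * k)%N => n x nk; apply: le_trans hk; apply: le_trans (pw k x).
rewrite -(subnK nk); elim: (n - _)%N => // m IH.
by rewrite addSn; apply: le_trans IH; exact: gap_dec.
Qed.

(** Once the gaps are small, the squares of the widths have a small sum, so the cross-ratios
    near all points are at most [4 + delta] along the orbit, on as many
    grid points as needed; then consecutive gaps are almost equal. *)
Lemma even_grid eta : 0 < eta <= 1 -> exists n0, forall n, (n0 <= n)%N ->
  forall x, exists2 y, y <= x < sh n 1 y &
  forall (i : int) (j : nat), `|i| <= 2 -> (j <= `|q n.+1|)%N ->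
    gap n (sh n (i + 1) (act j y)) <= (1 + eta) * gap n (sh n i (act j y)) /\
    gap n (sh n i (act j y)) <= (1 + eta) * gap n (sh n (i + 1) (act j y)).
Proof.
move=> eta01; have [delta d0 [M HM]] := nearly_geometric eta01.
have [r [K [r0 K0 hK']]] := g_cratio_local.
pose T : R := 6 * (2 * (M + 2) + 3)%:R.
have T0 : 0 < T by rewrite mulr_gt0.
have [t t0 ht] : exists2 t : R, 0 < t & 4 * expR (K * t * T) <= 4 + delta.
  pose u := ln (1 + delta / 4).
  have u0 : 0 < u by rewrite ln_gt0// ltrDl divr_gt0.
  exists (u / (K * T)); first by rewrite divr_gt0// mulr_gt0.
  have -> : K * (u / (K * T)) * T = u by field; rewrite !gt_eqF.
  rewrite lnK ?posrE; first by lra.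
  by rewrite addr_gt0// divr_gt0.
have rt0 : 0 < Num.min r t / 3 by rewrite divr_gt0// lt_min r0.
have [n0 hn0] := gap_small rt0.
exists n0 => n nn x.
have hw y : width n y <= Num.min r t.
  rewrite width_gap; have := hn0 n y nn; have := hn0 n (sh n 1 y) nn; have := hn0 n (sh n 2 y) nn.
  lra.
have Kt : 0 <= K * t by rewrite mulr_ge0// ltW.
have Hstep y : chi n (g y) <= chi n y * (1 + K * t * width n y).
  have := hw y; rewrite le_min => /andP[w1 w2].
  have w0 := width_gt0 n y.
  have : chi n (g y) <= chi n y * (1 + K * width n y ^+ 2).
    rewrite /chi -!(act1 g h) !sh_act; apply: hK' => //; [exact: sh01 | exact: sh12 | exact: sh23].
  move=> /le_trans; apply; rewrite ler_pM2l ?chi_gt0// lerD2l -mulrA.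
  by rewrite ler_pM2l// expr2 ler_pM2r.
have [y hy hchi] := grid (M + 2) Kt Hstep x.
exists y => // i j i2 jq.
have := HM (fun k => gap n (sh n (i + k) (act j y))); rewrite addr0; apply.
  by move=> k; exact: gap_gt0.
move=> k kM.
have ik : `|i + k| <= (M + 2)%N%:Z.
  by apply: le_trans (ler_normD _ _) _; rewrite PoszD addrC; apply: lerD.
have /chi_le := le_trans (hchi (i + k) j ik jq) ht.
by rewrite -!shD !(addrC _ (i + k)) -!addrA.
Qed.

End Distortion.

(** * Orbits of complex points follow orbits of real points *)

Section MoebiusStability.
Variable R : realType.
Local Notation C := R[i].
Local Notation N := (@Normc.normc R).

(** Three points [-1, 0, 1] and the cross-ratio determine the fourth point; [c0] and
    [c'] are perturbations of [-1], and [rho] is the distortion of the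
    cross-ratio. Solving for [Z' - Z0] gives a denominator close to 2. *)
Lemma cross_ratio_stable (K eps : R) (c0 c' rho Z0 Z' : C) :
  0 <= K -> 0 <= eps -> 5 * eps * (K + 2) <= 1 ->
  N (c0 + 1) <= eps -> N (c' + 1) <= eps -> N (rho - 1) <= eps -> N Z0 <= K ->
  (Z' - c') * c0 * (Z0 - 1) = rho * c' * (Z0 - c0) * (Z' - 1) ->
  N (Z' - Z0) <= 5 * eps * (K + 2) ^+ 2.
Proof.
move=> K0 e0 eK hc0 hc' hr hZ E.
have e1 : eps <= 1 by nra.
set u := c0 + 1 in hc0; set v := c' + 1 in hc'; set w := rho - 1 in hr.
have c0E : c0 = u - 1 by rewrite /u addrK.
have c'E : c' = v - 1 by rewrite /v addrK.
have rE : rho = w + 1 by rewrite /w subrK.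
pose th := w - v - w * v.
pose dP := u * (Z0 - 1) + th * (Z0 + 1 - u) - u.
have key : (Z' - Z0) * (2 + dP) =
   - u + (v * u - v - u) * (Z0 - 1) + th * (Z0 + 1 - u) - Z0 * dP.
  have : (Z' - c') * c0 * (Z0 - 1) - rho * c' * (Z0 - c0) * (Z' - 1) = 0 by rewrite E subrr.
  rewrite c0E c'E rE => E'; apply/eqP; rewrite -subr_eq0 -E' /dP /th; apply/eqP; ring.
have hth : N th <= 3 * eps.
  have h1 := ncB (w - v) (w * v); have h2 := ncB w v; rewrite ncM in h1.
  have h3 : N w * N v <= 1 * eps by apply: ler_pM; rewrite ?nc_ge0//; apply: le_trans e1.
  rewrite /th; lra.
have hvu : N (v * u - v - u) <= 3 * eps.
  have h1 := ncB (v * u - v) u; have h2 := ncB (v * u) v; rewrite ncM in h2.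
  have h3 : N v * N u <= 1 * eps by apply: ler_pM; rewrite ?nc_ge0//; apply: le_trans e1.
  lra.
have hZ1 : N (Z0 - 1) <= K + 1 by have := ncB Z0 1; rewrite nc1; lra.
have hZu : N (Z0 + 1 - u) <= K + 2.
  by have := ncB (Z0 + 1) u; have := ncD Z0 1; rewrite nc1; lra.
have hdP : N dP <= 5 * eps * (K + 2).
  have h1 := ncB (u * (Z0 - 1) + th * (Z0 + 1 - u)) u.
  have h2 := ncD (u * (Z0 - 1)) (th * (Z0 + 1 - u)); rewrite !ncM in h2.
  have h3 : N u * N (Z0 - 1) <= eps * (K + 1) by apply: ler_pM; rewrite ?nc_ge0.
  have h4 : N th * N (Z0 + 1 - u) <= 3 * eps * (K + 2) by apply: ler_pM; rewrite ?nc_ge0.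
  rewrite /dP; nra.
have hP : 1 <= N (2 + dP).
  have := nc_ge_sub 2 (- dP); rewrite opprK ncN nc_nat; lra.
have hR : N (- u + (v * u - v - u) * (Z0 - 1) + th * (Z0 + 1 - u) - Z0 * dP) <=
   5 * eps * (K + 2) ^+ 2.
  have h1 := ncB (- u + (v * u - v - u) * (Z0 - 1) + th * (Z0 + 1 - u)) (Z0 * dP).
  have h2 := ncD (- u + (v * u - v - u) * (Z0 - 1)) (th * (Z0 + 1 - u)).
  have h3 := ncD (- u) ((v * u - v - u) * (Z0 - 1)).
  rewrite ncN in h3; rewrite !ncM in h1 h2 h3.
  have h4 : N (v * u - v - u) * N (Z0 - 1) <= 3 * eps * (K + 1) by apply: ler_pM; rewrite ?nc_ge0.
  have h5 : N th * N (Z0 + 1 - u) <= 3 * eps * (K + 2) by apply: ler_pM; rewrite ?nc_ge0.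
  have h6 : N Z0 * N dP <= K * (5 * eps * (K + 2)) by apply: ler_pM; rewrite ?nc_ge0.
  nra.
have := congr1 N key; rewrite ncM => h.
have := nc_ge0 (Z' - Z0); nra.
Qed.

End MoebiusStability.

Section Shadowing.
Variable R : realType.
Local Notation C := R[i].
Local Notation N := (@Normc.normc R).
Variables (Delta : R) (g h : R -> R) (V : set R[i]^o) (f : R[i]^o -> R[i]^o).
Hypothesis Delta_gt0 : 0 < Delta.
Hypothesis f_ext : holo_diffeo_extension Delta g V f.
Hypothesis Re_Df : (0 < ereal_inf
       [set (complex.Re (derive1 f z))%:E | z in strip Delta])%E.
Hypothesis g_incr : {homo g : x y / x < y}.
Hypothesis g_per : forall x, g (x + 1) = g x + 1.
Hypothesis gK : cancel g h.
Hypothesis hK : cancel h g.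
Variable alpha : R.
Hypothesis alphaE : alpha = rotation_number g.
Hypothesis alpha_irr : irrational alpha.

Local Notation act := (act g h).
Local Notation q := (cvg_den alpha).
Local Notation sh := (sh g h alpha).
Local Notation gap := (gap g h alpha).

Let shD := shD g_per gK hK alpha.
Let sh0 := sh0 g h alpha.
Let sh_act := sh_act g_per gK hK alpha.
Let gap_gt0 := gap_gt0 g_incr g_per gK hK alphaE alpha_irr.
Let g_lower := real_lower Delta_gt0 f_ext Re_Df g_incr.
Let g_upper := real_upper Delta_gt0 f_ext g_incr g_per.
Let g_cratio := cratio_global Delta_gt0 f_ext Re_Df g_incr g_per.
Let g_cratio_local := cratio_local Delta_gt0 f_ext Re_Df g_incr.

(** The affine chart of the window of [y]: it sends [y] to 0 and [sh n 1 y] to 1. *)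
Definition chart n (y : R) (z : C) : C := (z - y%:C) / (gap n y)%:C.

(** In the charts of the points of the orbit of [y], the orbit of a complex point does not move
    by more than [eta], up to time [q_(n+1)]. *)
Definition shadows n (K eta : R) (y : R) : Prop :=
  forall (j : nat) (z : C), (j <= `|q n.+1|)%N -> N (chart n y z) <= K ->
    `|complex.Im (iter j f z)| < Delta /\
    N (chart n (act j y) (iter j f z) - chart n y z) <= eta.

Lemma iter_real (j : nat) (x : R) : iter j f x%:C = (act j x)%:C.
Proof. by elim: j => //= j ->; rewrite (ext_real f_ext). Qed.

Lemma ratio_near1 (x y e : R) : 0 < x -> 0 < y -> 0 <= e ->
  x <= (1 + e) * y -> y <= (1 + e) * x -> `|x / y - 1| <= e.
Proof.
move=> x0 y0 e0 h1 h2; have -> : x / y - 1 = (x - y) / y by field; rewrite gt_eqF.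
rewrite normrM normfV [`|y|]gtr0_norm// ler_pdivrMr// ler_norml; apply/andP; split; last lra.
have [xy|xy] := leP x y; nra.
Qed.

Lemma chart_real n y x : chart n y x%:C = ((x - y) / gap n y)%:C.
Proof. by rewrite /chart -rmorphB -fmorphV -rmorphM. Qed.

(** The cross-ratio of [y], [sh n 1 y], [sh n (-1) y] and the point is followed along the
    orbit. Its distortion at each step is at most a constant times the product of the maximal
    gap and of the gap at this step, and the sum of the gaps is at most 2, so the total
    distortion is small. The three real points are, in the charts, close to [0, 1, -1], and
    the cross-ratio determines the position of the fourth point. That
    the point stays where the estimates hold is part of the induction. *)
Lemma shadows_of_even_grid (K eta : R) : 0 <= K -> 0 < eta <= 1 ->
  exists eps tau : R, [/\ 0 < eps, 0 < tau & forall n y,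
   (forall x, gap n x <= tau) ->
   (forall (j : nat), (j <= `|q n.+1|)%N ->
      gap n (act j y) <= (1 + eps) * gap n (sh n (-1) (act j y)) /\
      gap n (sh n (-1) (act j y)) <= (1 + eps) * gap n (act j y)) ->
   shadows n K eta y].
Proof.
move=> K0 /andP[e0 e1].
have [r [L [K1 [r0 rD L0 K10 H]]]] := uniform_cross_ratio Delta_gt0 f_ext.
have [m m0 Hm] := strip_lower Delta_gt0 f_ext Re_Df.
have K2 : 0 < K + 2 by lra.
(* so that the bound [5 * eps * (K + 2) ^+ 2] of the stability lemma is [eta / 2] *)
pose eps := eta / (10 * (K + 2) ^+ 2).
have eps0 : 0 < eps by rewrite divr_gt0// mulr_gt0// exprn_gt0.
have eps5 : 5 * eps * (K + 2) ^+ 2 = eta / 2 by rewrite /eps; field; exact: lt0r_neq0.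
have eps51 : 5 * eps * (K + 2) <= 1.
  have : 5 * eps * (K + 2) * (K + 2) = eta / 2 by rewrite -eps5; ring.
  have e' := ltW eps0; have K2' := ltW K2.
  have : 0 <= 5 * eps * (K + 2) by apply: mulr_ge0 => //; apply: mulr_ge0.
  nra.
have epsle1 : eps <= 1 by nra.
pose kap (tau : R) := K1 / m ^+ 2 * (3 * (K + 1)) * tau.
have M0 : 0 < K1 / m ^+ 2 * (3 * (K + 1)).
  have k1 : 0 < K1 / m ^+ 2 by rewrite divr_gt0// exprn_gt0.
  by apply: mulr_gt0 => //; lra.
(* [kap tau * 2] bounds the logarithm of the total distortion *)
pose tau0 := ln (1 + eps) / (2 * (K1 / m ^+ 2 * (3 * (K + 1)))).
have tau00 : 0 < tau0.
  by apply: divr_gt0; [apply: ln_gt0; rewrite ltrDl | exact: mulr_gt0].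
pose tau := Num.min tau0 (r / (K + 2)).
have taugt0 : 0 < tau by rewrite lt_min tau00 divr_gt0.
exists eps, tau; split => // n y hgap hgrid.
have kap0 : 0 <= kap tau by apply: mulr_ge0; exact: ltW.
have kap2 : expR (kap tau * 2) <= 1 + eps.
  rewrite -[leRHS]lnK ?posrE ?addr_gt0// ler_expR.
  have : tau <= tau0 by rewrite ge_min lexx.
  have d2 : 0 < 2 * (K1 / m ^+ 2 * (3 * (K + 1))) by apply: mulr_gt0.
  by rewrite /tau0 ler_pdivlMr// /kap => hh; lra.
have taur : tau * (K + 2) <= r.
  by rewrite -ler_pdivlMr// ge_min lexx orbT.
move=> j z jq zK.
pose y' (i : nat) := act i y.
pose w (i : nat) : C := iter i f z.
pose Z (i : nat) := chart n (y' i) (w i).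
pose c (i : nat) : C := (- (gap n (sh n (-1) (y' i)) / gap n (y' i)))%:C.
have gp i : 0 < gap n (y' i) by exact: gap_gt0.
have gpC i : (gap n (y' i))%:C != 0 :> C by rewrite Creal_eq0 gt_eqF.
have cE i : (i <= `|q n.+1|)%N -> N (c i + 1) <= eps.
  move=> iq; have [h1 h2] := hgrid i iq.
  have -> : c i + 1 = (1 - gap n (sh n (-1) (y' i)) / gap n (y' i))%:C.
    by rewrite /c rmorphN rmorphB rmorph1 addrC.
  rewrite nc_real distrC.
  have e' := ltW eps0; have g' := gap_gt0 n (sh n (-1) (y' i)).
  by apply: ratio_near1.
have Z0K : N (Z 0%N) <= K by exact: zK.
pose S (i : nat) := \sum_(0 <= k < i) gap n (y' k).
have S2 i : (i <= `|q n.+1|)%N -> S i <= 2.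
  move=> iq; have km : (i <= 1 * `|q n.+1|)%N by rewrite mul1n.
  by have := gap_sum g_incr g_per gK hK alphaE alpha_irr y km; rewrite mulr1.
have wE i : w i = (y' i)%:C + (gap n (y' i))%:C * Z i.
  by rewrite /Z /chart mulrC mulfVK// addrC subrK.
have close i : N (Z i - Z 0%N) <= 1 -> N (w i - (y' i)%:C) <= r.
  move=> hZ; have := nc_dist (Z i) (Z 0%N) 0; rewrite !subr0 => hz.
  rewrite wE addrC addKr ncM nc_real gtr0_norm//.
  apply: le_trans taur; apply: ler_pM; [exact: ltW | exact: nc_ge0 | exact: hgap | lra].
have near_y i (x : R) : `|x - y' i| <= r -> N (x%:C - (y' i)%:C) <= r by rewrite nc_real_sub.
have Im_near i (v : C) : N (v - (y' i)%:C) <= r -> `|complex.Im v| < Delta.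
  move=> hv; apply: le_lt_trans rD; apply: le_trans hv; apply: le_trans (nc_Im _).
  by rewrite ImD ImN /= subr0.
(* the chart does not determine a cross-ratio at the point [Z 0 = 1], which is the real
   point [sh n 1 y] and is treated apart *)
suff main i : (i <= `|q n.+1|)%N -> Z 0%N != 1 ->
    [/\ Z i != 1, N (Z i - Z 0%N) <= eta / 2 &
     exists2 rho : C, N (rho - 1) <= expR (kap tau * S i) - 1 &
      (Z i - c i) * c 0%N * (Z 0%N - 1) = rho * c i * (Z 0%N - c 0%N) * (Z i - 1)].
  have [Z1|Z1] := eqVneq (Z 0%N) 1.
    have zE : z = (sh n 1 y)%:C.
      by have := wE 0%N; rewrite Z1 mulr1 -rmorphD /y' /w /gap /= addrC subrK.
    rewrite -/(Z 0%N) -/(w j) -/(y' j) Z1.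
    have wj : w j = (sh n 1 (y' j))%:C by rewrite /w zE iter_real sh_act.
    have -> : chart n (y' j) (w j) = 1.
      by rewrite wj chart_real -/(gap n (y' j)) divff ?rmorph1// gt_eqF.
    rewrite subrr nc0 ltW//; split=> //.
    by rewrite wj /= normr0.
  have [_ h1 _] := main j jq Z1.
  split; last by apply: le_trans h1 _; lra.
  by apply: (Im_near j); apply: close; apply: le_trans h1 _; lra.
elim: i => [|i IH] iq Z1.
  split => //; first by rewrite subrr nc0 divr_ge0// ltW.
  exists 1; first by rewrite subrr nc0 /S big_geq// mulr0 expR0 subrr.
  by ring.
have [Zi1 hi [rho hrho E]] := IH (ltnW iq) Z1.
have iq' := ltnW iq.
pose A : C := (y' i)%:C; pose B : C := (sh n 1 (y' i))%:C.
pose D : C := (sh n (-1) (y' i))%:C.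
have gtau : gap n (y' i) <= tau by exact: hgap.
have gtau' : gap n (sh n (-1) (y' i)) <= tau by exact: hgap.
have tr : tau <= r by nra.
have gD : gap n (sh n (-1) (y' i)) = y' i - sh n (-1) (y' i).
  by rewrite gap_sh// addNr sh0.
have gB : gap n (y' i) = sh n 1 (y' i) - y' i by [].
have hA : N (A - (y' i)%:C) <= r by rewrite subrr nc0 ltW.
have hB : N (B - (y' i)%:C) <= r.
  by apply: near_y; rewrite -gB gtr0_norm//; lra.
have hD : N (D - (y' i)%:C) <= r.
  by apply: near_y; rewrite distrC -gD gtr0_norm; [lra | exact: gap_gt0].
have hE : N (w i - (y' i)%:C) <= r by apply: close; lra.
have [_ HX] := H (y' i).
have HmL (a b : C) : N (a - (y' i)%:C) <= r -> N (b - (y' i)%:C) <= r ->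
    m * N (a - b) <= N (f a - f b).
  by move=> /Im_near ha /Im_near hb; exact: Hm.
have [rh hrh Est] := cross_ratio_distortion m0 K10 HX HmL hA hB hD hE.
have fA : f A = (y' i.+1)%:C by rewrite /A (ext_real f_ext).
have fB : f B = (sh n 1 (y' i.+1))%:C.
  rewrite /B (ext_real f_ext); congr (_%:C).
  by rewrite -(act1 g h) -sh_act.
have fD : f D = (sh n (-1) (y' i.+1))%:C.
  rewrite /D (ext_real f_ext); congr (_%:C).
  by rewrite -(act1 g h) -sh_act.
have fE : f (w i) = w i.+1 by [].
have AB : A - B = - (gap n (y' i))%:C by rewrite /A /B gB rmorphB opprB.
have AD k : (y' k)%:C - (sh n (-1) (y' k))%:C = - (c k * (gap n (y' k))%:C) :> C.
  have -> : c k * (gap n (y' k))%:C = - (gap n (sh n (-1) (y' k)))%:C.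
    by rewrite /c -rmorphM mulNr mulfVK ?gt_eqF// rmorphN.
  by rewrite opprK gap_sh// addNr sh0 rmorphB.
have EB k : w k - (sh n 1 (y' k))%:C = (gap n (y' k))%:C * (Z k - 1).
  rewrite wE mulrBr mulr1 /gap rmorphB /=; ring.
have ED k : w k - (sh n (-1) (y' k))%:C = (gap n (y' k))%:C * (Z k - c k).
  rewrite wE mulrBr [_ * c k]mulrC -[c k * _]opprK -AD; ring.
have AB' : f A - f B = - (gap n (y' i.+1))%:C.
  by rewrite fA fB /gap rmorphB opprB.
have step : (Z i.+1 - c i.+1) * c i * (Z i - 1) = rh * c i.+1 * (Z i - c i) * (Z i.+1 - 1).
  move: Est; rewrite AB' AB fE fD fB fA -/A -/D -/B !ED !EB !AD => Est.
  have gg : (gap n (y' i.+1))%:C ^+ 2 * (gap n (y' i))%:C ^+ 2 != 0 :> C.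
    by rewrite mulf_neq0// expf_neq0.
  apply: (mulfI gg).
  transitivity (- (gap n (y' i.+1))%:C * ((gap n (y' i.+1))%:C * (Z i.+1 - c i.+1)) *
    (- (c i * (gap n (y' i))%:C) * ((gap n (y' i))%:C * (Z i - 1)))); first by ring.
  by rewrite Est; ring.
have c_neq0 : c i != 0.
  rewrite /c Creal_eq0 oppr_eq0.
  by rewrite mulf_neq0 ?invr_eq0 ?gt_eqF//; exact: gap_gt0.
have E' : (Z i.+1 - c i.+1) * c 0%N * (Z 0%N - 1) =
    (rh * rho) * c i.+1 * (Z 0%N - c 0%N) * (Z i.+1 - 1).
  have cz : c i * (Z i - 1) != 0 by rewrite mulf_neq0// subr_eq0.
  apply: (mulfI cz).
  transitivity (((Z i.+1 - c i.+1) * c i * (Z i - 1)) * (c 0%N * (Z 0%N - 1))); first by ring.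
  rewrite step.
  transitivity (rh * c i.+1 * (Z i.+1 - 1) * ((Z i - c i) * c 0%N * (Z 0%N - 1))); first by ring.
  by rewrite E; ring.
have hrh' : N (rh - 1) <= kap tau * gap n (y' i).
  apply: le_trans hrh _; rewrite /kap.
  have h1 : N (B - D) <= 3 * tau.
    have -> : B - D = (gap n (y' i) + gap n (sh n (-1) (y' i)))%:C.
      by rewrite gB gD /B /D addrA subrK rmorphB.
    by rewrite nc_real ger0_norm; [lra | rewrite addr_ge0// ltW//; exact: gap_gt0].
  have h2 : N (w i - A) <= gap n (y' i) * (K + 1).
    rewrite wE addrC addKr ncM nc_real gtr0_norm// ler_pM2l//.
    have := nc_dist (Z i) (Z 0%N) 0; rewrite !subr0; lra.
  have h3 : N (B - D) * N (w i - A) <= 3 * tau * (gap n (y' i) * (K + 1)).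
    by apply: ler_pM; rewrite ?nc_ge0.
  have k0 : 0 <= K1 / m ^+ 2 by rewrite divr_ge0 ?exprn_ge0 ?ltW.
  apply: le_trans (ler_wpM2l k0 h3) _.
  by rewrite le_eqVlt; apply/orP; left; apply/eqP; ring.
have hrr : N (rh * rho - 1) <= expR (kap tau * S i.+1) - 1.
  have -> : rh * rho - 1 = (rh - 1) * rho + (rho - 1) by ring.
  apply: le_trans (ncD _ _) _; rewrite ncM.
  have -> : S i.+1 = S i + gap n (y' i) by rewrite /S big_nat_recr.
  rewrite mulrDr expRD.
  have h1 : N rho <= expR (kap tau * S i).
    by have := nc_dist rho 1 0; rewrite !subr0 nc1; lra.
  have h2 := expR_ge1Dx (kap tau * gap n (y' i)).
  have h3 : N (rh - 1) * N rho <= kap tau * gap n (y' i) * expR (kap tau * S i).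
    by apply: ler_pM; rewrite ?nc_ge0.
  have h4 := expR_gt0 (kap tau * S i).
  nra.
have Sle := S2 _ iq.
have hreps : N (rh * rho - 1) <= eps.
  apply: le_trans hrr _; rewrite lerBlDl; apply: le_trans kap2.
  by rewrite ler_expR; apply: ler_wpM2l.
split; last by exists (rh * rho).
- rewrite -subr_eq0 -nc_gt0.
  have := HmL (w i) B hE hB; rewrite fE fB !EB !ncM !nc_real !gtr0_norm// => hh.
  have z1 : 0 < N (Z i - 1) by rewrite nc_gt0 subr_eq0.
  have : 0 < gap n (y' i.+1) * N (Z i.+1 - 1).
    by apply: lt_le_trans hh; rewrite !mulr_gt0.
  by rewrite pmulr_rgt0.
rewrite -eps5; apply: (cross_ratio_stable K0 (ltW eps0) eps51 _ _ hreps Z0K E').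
  by apply: cE.
exact: cE.
Qed.

(** Both [y] and [sh n 1 y] are provided, because the return map is controlled from one
    of them to the other, in a direction that depends on the parity of [n]. *)
Lemma shadowing (K eta : R) : 0 <= K -> 0 < eta <= 1 ->
  exists n0, forall n, (n0 <= n)%N -> forall x, exists2 y, y <= x < sh n 1 y &
   [/\ shadows n K eta y, shadows n K eta (sh n 1 y),
       gap n (sh n 1 y) <= (1 + eta) * gap n y &
       gap n y <= (1 + eta) * gap n (sh n 1 y)].
Proof.
move=> K0 eta01; have /andP[e0 e1] := eta01.
have [eps [tau [eps0 tau0 Hsh]]] := shadows_of_even_grid K0 eta01.
have ee : 0 < Num.min eps eta <= 1.
  by rewrite lt_min eps0 e0 /= ge_min e1 orbT.
have [n1 H1] := even_grid g_incr g_per gK hK alphaE alpha_irr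
  g_lower g_upper g_cratio g_cratio_local ee.
have [n2 H2] := gap_small g_incr g_per gK hK alphaE alpha_irr g_lower g_upper g_cratio tau0.
exists (maxn n1 n2) => n; rewrite geq_max => /andP[nn1 nn2] x.
have [y hy grd] := H1 n nn1 x; exists y => //.
have leps : Num.min eps eta <= eps by rewrite ge_min lexx.
have leta : Num.min eps eta <= eta by rewrite ge_min lexx orbT.
have weak (u v s : R) : 0 < v -> Num.min eps eta <= s ->
    u <= (1 + Num.min eps eta) * v -> u <= (1 + s) * v.
  by move=> v0 ms h1; apply: le_trans h1 _; rewrite ler_pM2r// lerD2l.
have sh11 t : sh n (-1) (sh n 1 t) = t by rewrite -shD addNr sh0.
split.
- apply: Hsh => [t|j jq]; first exact: H2.
  have [|h1 h2] := grd (-1) j _ jq; first by [].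
  rewrite addNr sh0 in h1 h2.
  by split; apply: weak => //; exact: gap_gt0.
- apply: Hsh => [t|j jq]; first exact: H2.
  have [|h1 h2] := grd 0 j _ jq; first by [].
  rewrite add0r sh0 in h1 h2; rewrite -sh_act sh11.
  by split; apply: weak => //; exact: gap_gt0.
- have [|h1 h2] := grd 0 0%N _ (leq0n _); first by [].
  rewrite add0r sh0 in h1 h2; apply: weak h1 => //; exact: gap_gt0.
- have [|h1 h2] := grd 0 0%N _ (leq0n _); first by [].
  rewrite add0r sh0 in h1 h2; apply: weak h2 => //; exact: gap_gt0.
Qed.

End Shadowing.

(** * The graph of a multiple of the gap *)

Section CurveEstimates.
Variable R : realType.
Local Notation C := R[i].
Local Notation N := (@Normc.normc R).
Variables (Delta : R) (g h : R -> R) (V : set R[i]^o) (f : R[i]^o -> R[i]^o).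
Hypothesis Delta_gt0 : 0 < Delta.
Hypothesis f_ext : holo_diffeo_extension Delta g V f.
Hypothesis Re_Df : (0 < ereal_inf
       [set (complex.Re (derive1 f z))%:E | z in strip Delta])%E.
Hypothesis g_incr : {homo g : x y / x < y}.
Hypothesis g_per : forall x, g (x + 1) = g x + 1.
Hypothesis gK : cancel g h.
Hypothesis hK : cancel h g.
Variable alpha : R.
Hypothesis alphaE : alpha = rotation_number g.
Hypothesis alpha_irr : irrational alpha.

Local Notation act := (act g h).
Local Notation q := (cvg_den alpha).
Local Notation p := (cvg_num alpha).
Local Notation sh := (sh g h alpha).
Local Notation gap := (gap g h alpha).
Local Notation chart := (chart g h alpha).
Local Notation shadows := (shadows Delta g h f alpha).

Let shD := shD g_per gK hK alpha.
Let sh0 := sh0 g h alpha.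
Let sh_lt := sh_lt g_incr hK alpha.
Let sh_le := sh_le g_incr hK alpha.
Let sh_act := sh_act g_per gK hK alpha.
Let gap_gt0 := gap_gt0 g_incr g_per gK hK alphaE alpha_irr.
Let gap_addz := gap_addz g_per gK hK alpha.

Lemma cvg_den_le n : (`|q n| <= `|q n.+1|)%N.
Proof.
by rewrite -lez_nat !q_abs//; have /andP[] := cvg_den_mono alpha_irr n.
Qed.

(** The return map [g^(q_n) - p_n] is one step on the grid, in the direction [sgn_err]. *)
Lemma act_q n y : act `|q n|%N y = sh n (sgn_err alpha n) y + (p n)%:~R.
Proof.
have ss := sgn_err_sqr alpha n.
rewrite /sh !mulrA ss !mul1r q_abs// -addrA -rmorphD /= addNr.
by rewrite rmorph0 addr0.
Qed.

Lemma chart_addz n y z (k : int) :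
  chart n (y + k%:~R) (z + k%:~R) = chart n y z.
Proof.
rewrite /chart gap_addz; congr (_ / _).
have -> : ((y + k%:~R)%:C : C) = y%:C + k%:~R by rewrite rmorphD /= rmorph_int.
by ring.
Qed.

Lemma chart_real_addz n y x (k : int) :
  chart n (y + k%:~R) (x + k%:~R)%:C = chart n y x%:C.
Proof. by rewrite rmorphD /= rmorph_int chart_addz. Qed.

(** One step on the grid is a power of [g] of order at most [q_(n+1)], which the shadowing
    property controls; when it moves points to the left, it is seen from [sh n 1 y]. *)
Lemma return_chart n K eta y x : 3 <= K ->
  y <= x < sh n 1 y -> shadows n K eta y -> shadows n K eta (sh n 1 y) ->
  `|(sh n 1 x - sh n 1 y) / gap n (sh n 1 y) - (x - y) / gap n y| <= eta.
Proof.
move=> K3 /andP[yx xy] s0 s1.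
have gy := gap_gt0 n y; have gy1 := gap_gt0 n (sh n 1 y).
have [sg|sg] : sgn_err alpha n = 1 \/ sgn_err alpha n = -1 by rewrite /sgn_err; case: ifP; auto.
  have [|_] := s0 `|q n|%N x%:C (cvg_den_le n).
    rewrite chart_real nc_real normrM normfV [`|gap n y|]gtr0_norm// ler_pdivrMr//.
    rewrite ger0_norm ?subr_ge0//; have : sh n 1 y - y = gap n y by []; nra.
  rewrite (iter_real h f_ext) !act_q sg chart_real_addz !chart_real -rmorphB nc_real.
  by [].
have [|_] := s1 `|q n|%N (sh n 1 x)%:C (cvg_den_le n).
  rewrite chart_real nc_real normrM normfV [`|gap n _|]gtr0_norm// ler_pdivrMr//.
  rewrite ger0_norm ?subr_ge0 ?sh_le//.
  have : sh n 1 x < sh n 1 (sh n 1 y) by rewrite sh_lt.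
  have : sh n 1 (sh n 1 y) - sh n 1 y = gap n (sh n 1 y) by []; nra.
rewrite (iter_real h f_ext) !act_q sg chart_real_addz !chart_real -rmorphB nc_real.
by rewrite -!shD addNr !sh0 distrC.
Qed.

(** The gap at [x] compares the positions of [x] and [sh n 1 x] in neighbouring charts, and
    these agree by the previous lemma. *)
Lemma gap_base n K eta y x : 3 <= K -> 0 < eta <= 50^-1 ->
  y <= x < sh n 1 y -> shadows n K eta y -> shadows n K eta (sh n 1 y) ->
  gap n (sh n 1 y) <= (1 + eta) * gap n y ->
  gap n y <= (1 + eta) * gap n (sh n 1 y) ->
  `|gap n x - gap n y| <= 3 * eta * gap n y.
Proof.
move=> K3 /andP[e0 e1] xy s0 s1 h1 h2.
have := return_chart K3 xy s0 s1; move: xy => /andP[yx xy].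
have gy := gap_gt0 n y; have gy1 := gap_gt0 n (sh n 1 y).
set u' := (sh n 1 x - sh n 1 y) / _; set u := (x - y) / _ => hu.
have E : gap n x = gap n (sh n 1 y) * u' + gap n y - gap n y * u.
  rewrite /u' /u [gap n (sh n 1 y) * _]mulrC mulfVK ?gt_eqF//.
  by rewrite [gap n y * _]mulrC mulfVK ?gt_eqF// /gap; ring.
have u0 : 0 <= u by apply: divr_ge0; [rewrite subr_ge0 | exact: ltW].
have u1 : u <= 1 by rewrite ler_pdivrMr// mul1r; have : sh n 1 y - y = gap n y by []; lra.
move: hu; rewrite E !ler_norml => /andP[k1 k2].
set G := gap n y in gy h1 h2 *; set G1 := gap n (sh n 1 y) in gy1 h1 h2 *.
have a1 : G1 - G <= eta * G by lra.
have a2 : - (eta * G) <= G1 - G by nra.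
have E2 : G1 * u' + G - G * u - G = (G1 - G) * u + G1 * (u' - u) by ring.
rewrite E2.
have b1 : `|(G1 - G) * u| <= eta * G * 1.
  by rewrite normrM; apply: ler_pM => //; [rewrite ler_norml a1 a2 | rewrite ger0_norm].
have b2 : `|G1 * (u' - u)| <= ((1 + eta) * G) * eta.
  by rewrite normrM (gtr0_norm gy1); apply: ler_pM => //; [exact: ltW | rewrite ler_norml k1 k2].
have := ler_normD ((G1 - G) * u) (G1 * (u' - u)).
set T := (G1 - G) * u + _; move=> b3.
have b4 : `|T| <= 3 * eta * G by nra.
by move: b4; rewrite ler_norml.
Qed.

Lemma complex_mk (x y : R) : x +i* y = x%:C + 'i * y%:C.
Proof. by apply: complex_ext; rewrite ?ReD ?ImD ?ReM ?ImM /=; ring. Qed.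

Lemma chart_mk n b x y : chart n b (x +i* y) =
  chart n b x%:C + 'i * (y / gap n b)%:C.
Proof. by rewrite /chart complex_mk rmorphM fmorphV /=; ring. Qed.

(** The return map need not send [y] to a controlled point, as it shifts in the direction of
    [sgn_err]; it does so for the right one of [y] and [sh n 1 y]. *)
Lemma base_point n K eta y x : 3 <= K -> 0 < eta <= 50^-1 ->
  y <= x < sh n 1 y -> shadows n K eta y -> shadows n K eta (sh n 1 y) ->
  gap n (sh n 1 y) <= (1 + eta) * gap n y ->
  gap n y <= (1 + eta) * gap n (sh n 1 y) ->
  exists b b', [/\ shadows n K eta b,
    act `|q n|%N b = b' + (p n)%:~R,
    gap n b' <= (1 + eta) * gap n b /\ gap n b <= (1 + eta) * gap n b',
    `|gap n x - gap n b| <= 5 * eta * gap n b &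
    `|x - b| <= 2 * gap n b].
Proof.
move=> K3 e01 xy s0 s1 g1 g2.
have gx := gap_base K3 e01 xy s0 s1 g1 g2.
have /andP[yx xy'] := xy; have /andP[e0 e1] := e01.
have gy0 := gap_gt0 n y; have gy10 := gap_gt0 n (sh n 1 y).
have gyE : sh n 1 y - y = gap n y by [].
have [sg|sg] : sgn_err alpha n = 1 \/ sgn_err alpha n = -1 by rewrite /sgn_err; case: ifP; auto.
  exists y, (sh n 1 y); split => //; first by rewrite act_q sg.
    by apply: le_trans gx _; nra.
  by rewrite ger0_norm ?subr_ge0//; nra.
exists (sh n 1 y), y; split => //; first by rewrite act_q sg -shD addNr sh0.
  move: gx gy0 gy10 g1 g2; move: (gap n y) (gap n (sh n 1 y)) (gap n x) => u v w.
  rewrite !ler_norml => /andP[k1 k2] u0 v0 g1 g2.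
  have e2 : eta * u <= eta * ((1 + eta) * v) by apply: ler_wpM2l; [exact: ltW|].
  have e3 : 0 < eta * v by exact: mulr_gt0.
  have e4 : eta * eta * v <= 50^-1 * (eta * v).
    by rewrite -mulrA; apply: ler_wpM2r => //; exact: ltW.
  by apply/andP; split; nra.
have e5 : eta * gap n (sh n 1 y) <= gap n (sh n 1 y) by rewrite ler_piMl ?ltW//; lra.
by rewrite ler_norml; apply/andP; split; nra.
Qed.

Section Orbit.
Variables (n : nat) (K eta b x : R).
Hypothesis K1 : 1 <= K.
Hypothesis e0 : 0 < eta.
Hypothesis e1 : eta <= 50^-1.
Hypothesis sb : shadows n (4 * K + 4) eta b.
Hypothesis gxb : `|gap n x - gap n b| <= 5 * eta * gap n b.
Hypothesis xb : `|x - b| <= 2 * gap n b.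

Let K0 : 0 < K. Proof. exact: lt_le_trans K1. Qed.
Let gb0 := gap_gt0 n b.
Let H t := K * gap n t.

Lemma base_gap_ratio : `|gap n x / gap n b - 1| <= 5 * eta.
Proof.
have -> : gap n x / gap n b - 1 = (gap n x - gap n b) / gap n b.
  by field; rewrite gt_eqF.
by rewrite normrM normfV [`|gap n b|]gtr0_norm// ler_pdivrMr.
Qed.

Let ratio_le : gap n x / gap n b <= 11 / 10.
Proof.
have Kge1 := K1; have eta_le := e1.
move: base_gap_ratio; rewrite ler_norml => /andP[_ h1].
by lra.
Qed.

Lemma chart_base : N (chart n b x%:C) <= 2.
Proof.
by rewrite chart_real nc_real normrM normfV [`|gap n b|]gtr0_norm// ler_pdivrMr.
Qed.

Lemma chart_vertical t : `|t| <= 2 * H x -> N (chart n b (x +i* t)) <= 4 * K + 4.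
Proof.
have Kge1 := K1; have eta_le := e1.
move=> ht; rewrite chart_mk; apply: le_trans (ncD _ _) _.
rewrite [N ('i * _)]ncM nc_i mul1r [N (_ / _)%:C]nc_real.
rewrite normrM normfV [`|gap n b|]gtr0_norm//.
have h1 : `|t| / gap n b <= 2 * K * (11 / 10).
  apply: le_trans (_ : 2 * H x / gap n b <= _).
    by rewrite ler_pM2r// invr_gt0.
  rewrite /H mulrA -[_ / gap n b]mulrA; apply: ler_wpM2l => //.
  by apply: mulr_ge0 => //; exact: ltW.
have h2 := chart_base; lra.
Qed.

Let H_gt0 : 0 < H x. Proof. by apply: mulr_gt0 => //; exact: gap_gt0. Qed.

Lemma chart_end : N (chart n b (sh n 1 x)%:C) <= 4 * K + 4.
Proof.
have Kge1 := K1; have eta_le := e1.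
have -> : chart n b (sh n 1 x)%:C = chart n b x%:C + (gap n x / gap n b)%:C.
  rewrite !chart_real -rmorphD; congr (_%:C); rewrite -mulrDl; congr (_ / _).
  by rewrite /gap; ring.
apply: le_trans (ncD _ _) _; rewrite nc_real ger0_norm; last first.
  by apply: divr_ge0; exact: ltW (gap_gt0 n _).
have h2 := chart_base; have h3 := ratio_le; lra.
Qed.

(** Both end points of the gap of [x] keep their positions in the charts. *)
Lemma gap_ratio_stable j : (j <= `|q n|)%N ->
  `|gap n (act j x) / gap n (act j b) - gap n x / gap n b| <= 2 * eta.
Proof.
have Kge1 := K1; have eta_le := e1.
move=> hj; have {}hj : (j <= `|q n.+1|)%N by exact: leq_trans (cvg_den_le n).
have chx : N (chart n b x%:C) <= 4 * K + 4.
  by apply: le_trans chart_base _; lra.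
have [_ a1] := sb hj chx; have [_ a2] := sb hj chart_end.
move: a1 a2; rewrite !(iter_real h f_ext) !chart_real -!rmorphB !nc_real => a1 a2.
have -> : gap n (act j x) / gap n (act j b) - gap n x / gap n b =
  ((act j (sh n 1 x) - act j b) / gap n (act j b) - (sh n 1 x - b) / gap n b)
  - ((act j x - act j b) / gap n (act j b) - (x - b) / gap n b).
  by rewrite {1 3}/gap sh_act; ring.
by apply: le_trans (ler_normB _ _) _; lra.
Qed.

Lemma gap_ratio_near1 j : (j <= `|q n|)%N ->
  `|gap n (act j x) / gap n (act j b) - 1| <= 7 * eta.
Proof.
have Kge1 := K1; have eta_le := e1.
move=> hj; have := gap_ratio_stable hj; have := base_gap_ratio.
move: (gap n x / _) (gap n (act j x) / _) => u v; rewrite !ler_norml.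
by move=> /andP[h1 h2] /andP[h3 h4]; apply/andP; split; lra.
Qed.

(** In the charts, the point [x +i* H x] and its real part [x] keep their positions, and so
    does the gap, hence the height [H]. *)
Lemma iterate_near_curve j : (j <= `|q n|)%N ->
  N (iter j f (x +i* H x) - (act j x +i* H (act j x)))
    <= 2 * eta * (1 + K) * gap n (act j b).
Proof.
have Kge1 := K1; have eta_le := e1.
move=> hj; have hj' : (j <= `|q n.+1|)%N by exact: leq_trans (cvg_den_le n).
have G0 := gap_gt0 n (act j b).
have chx : N (chart n b x%:C) <= 4 * K + 4.
  by apply: le_trans chart_base _; lra.
have chz : N (chart n b (x +i* H x)) <= 4 * K + 4.
  by have hx := H_gt0; apply: chart_vertical; rewrite gtr0_norm//; lra.
have [_ a1] := sb hj' chz; have [_ a2] := sb hj' chx.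
have a3 := gap_ratio_stable hj; rewrite (iter_real h f_ext) in a2.
set G := gap n (act j b) in G0 a3 *.
have -> : iter j f (x +i* H x) - (act j x +i* H (act j x)) = G%:C *
   ((chart n (act j b) (iter j f (x +i* H x)) - chart n b (x +i* H x))
    - (chart n (act j b) (act j x)%:C - chart n b x%:C)
    - 'i * (K * (gap n (act j x) / G - gap n x / gap n b))%:C).
  have GC : G%:C != 0 :> C by rewrite Creal_eq0 gt_eqF.
  rewrite chart_mk; move: (iter j f _) => w; rewrite complex_mk /chart -/G /H.
  have -> : K * gap n x / gap n b = K * (gap n x / gap n b) by rewrite mulrA.
  have -> : K * gap n (act j x) = G * (K * (gap n (act j x) / G)).
    by rewrite [RHS]mulrCA [G * _]mulrC mulfVK ?gt_eqF.
  move: (gap n (act j x) / G) (gap n x / gap n b) => u1 u2.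
  move: (act j x) (act j b) ((x%:C - b%:C) / (gap n b)%:C) => u3 u4 u5.
  clearbody G; rewrite [(G * _)%:C]rmorphM [(K * (u1 - u2))%:C]rmorphM /=.
  rewrite [(u1 - u2)%:C]rmorphB ![(K * _)%:C]rmorphM /=.
  by field.
rewrite ncM nc_real gtr0_norm// mulrC ler_pM2r//.
move: a1 a2; set A1 := chart n (act j b) _ - chart n b _.
set A2 := chart n (act j b) (act j x)%:C - chart n b x%:C => a1 a2.
have c1 := ncB (A1 - A2) ('i * (K * (gap n (act j x) / G - gap n x / gap n b))%:C).
have c2 := ncB A1 A2.
rewrite [N ('i * _)]ncM nc_i mul1r nc_real normrM [`|K|]gtr0_norm// in c1.
have c3 : K * `|gap n (act j x) / G - gap n x / gap n b| <= K * (2 * eta).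
  by rewrite ler_pM2l.
by lra.
Qed.

(** The subtracted term bounds the error of the previous lemma; what remains is a lower bound
    for the height of the iterate. *)
Lemma curve_height j : (j <= `|q n|)%N ->
  K * gap n (act j b) / 2 <= H (act j x) - 4 * eta * (K * gap n (act j b)).
Proof.
have Kge1 := K1; have eta_le := e1.
move=> hj; have G0 := gap_gt0 n (act j b).
have HG : (1 - 7 * eta) * gap n (act j b) <= gap n (act j x).
  have := gap_ratio_near1 hj; rewrite ler_norml -ler_pdivlMr// => /andP[a4 _].
  by lra.
have HK : K * ((1 - 7 * eta) * gap n (act j b)) <= H (act j x) by rewrite ler_pM2l.
have KG : 0 < K * gap n (act j b) by exact: mulr_gt0.
have eK : eta * (K * gap n (act j b)) <= 50^-1 * (K * gap n (act j b)) by rewrite ler_pM2r.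
by move: (gap n (act j b)) HK KG eK => G HK KG eK; lra.
Qed.

Lemma iterate_near_curve_scaled j : (j <= `|q n|)%N -> exists2 s, 0 < s &
  [/\ s = K * gap n (act j b) / 2, s <= complex.Im (iter j f (x +i* H x)),
      s <= H (act j x) &
      N (iter j f (x +i* H x) - (act j x +i* H (act j x))) <= 8 * eta * s].
Proof.
have Kge1 := K1; have eta_le := e1.
move=> hj; have G0 := gap_gt0 n (act j b); have D := iterate_near_curve hj.
have HG := curve_height hj.
have KG : 0 < K * gap n (act j b) by exact: mulr_gt0.
have eKG : 0 < eta * (K * gap n (act j b)) by exact: mulr_gt0.
have D' : 2 * eta * (1 + K) * gap n (act j b) <= 4 * eta * (K * gap n (act j b)).
  have : eta * gap n (act j b) <= eta * (K * gap n (act j b)).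
    by rewrite ler_pM2l// ler_peMl// ltW.
  by move: (gap n (act j b)) => G hG; lra.
exists (K * gap n (act j b) / 2); first exact: divr_gt0.
have := nc_Im (iter j f (x +i* H x) - (act j x +i* H (act j x))).
rewrite ImD ImN /= ler_norml => /andP[c1 _].
split => //; first by lra.
  by lra.
by apply: le_trans D _; lra.
Qed.

Variable b' : R.
Hypothesis bE : act `|q n|%N b = b' + (p n)%:~R.
Hypothesis gb1 : gap n b' <= (1 + eta) * gap n b.
Hypothesis gb2 : gap n b <= (1 + eta) * gap n b'.

Let gb'0 := gap_gt0 n b'.
Let gapq : gap n (act `|q n|%N b) = gap n b'. Proof. by rewrite bE gap_addz. Qed.

Lemma return_gap : `|gap n (act `|q n|%N x) - gap n x| <= 15 * eta * gap n b.
Proof.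
have Kge1 := K1; have eta_le := e1.
have a4 := gap_ratio_near1 (leqnn _); rewrite gapq in a4.
have a5 : `|gap n (act `|q n|%N x) - gap n b'| <= 7 * eta * gap n b'.
  have -> : gap n (act `|q n|%N x) - gap n b' = (gap n (act `|q n|%N x) / gap n b' - 1) * gap n b'.
    by rewrite mulrBl mulfVK ?gt_eqF// mul1r.
  by rewrite normrM [`|gap n b'|]gtr0_norm// ler_pM2r.
move: a5 gxb gb1 gb2 gb0 gb'0.
move: (gap n (act _ x)) (gap n x) (gap n b) (gap n b') => w t u v.
rewrite !ler_norml => /andP[h1 h2] /andP[h3 h4] g1 g2 u0 v0.
have h5 : eta * v <= eta * ((1 + eta) * u) by rewrite ler_pM2l.
have h6 : 0 < eta * u by exact: mulr_gt0.
have h7 : eta * eta * u <= 50^-1 * (eta * u) by rewrite -mulrA ler_pM2r.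
by apply/andP; split; nra.
Qed.

(** The return map moves [x] by one gap: the one of [x], or the one of its image, when it goes
    to the left. *)
Lemma return_displacement : `|act `|q n|%N x - (p n)%:~R - x| <= 3 / 2 * gap n b.
Proof.
have Kge1 := K1; have eta_le := e1.
rewrite act_q addrK; have a6 := return_gap; have u0 := gb0.
have eb : eta * gap n b <= 50^-1 * gap n b by rewrite ler_pM2r.
have [sg|sg] : sgn_err alpha n = 1 \/ sgn_err alpha n = -1 by rewrite /sgn_err; case: ifP; auto.
  rewrite sg -/(gap n x) gtr0_norm; last exact: gap_gt0.
  by move: gxb; rewrite ler_norml => /andP[_ h1]; lra.
have gE : gap n (act `|q n|%N x) = x - sh n (-1) x.
  by rewrite act_q gap_addz sg gap_sh// addNr sh0.
rewrite sg distrC -gE gtr0_norm ?gap_gt0//.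
move: a6 gxb; rewrite !ler_norml => /andP[_ h1] /andP[_ h2].
by lra.
Qed.

(** Horizontally the point moves by about one gap, vertically by the variation of [H], and the
    iterate is close to the curve. The first displacement is small compared with the
    height because [K] is large. *)
Lemma return_estimate : exists2 s, 0 < s &
  [/\ s <= H x, s <= complex.Im (iter `|q n| f (x +i* H x)) &
      N (iter `|q n| f (x +i* H x) - (p n)%:~R - (x +i* H x))
        <= (8 / K + 80 * eta) * s].
Proof.
have Kge1 := K1; have eta_le := e1.
have g1 := gb1; have g2 := gb2; have u0 := gb0; have v0 := gb'0.
have Kgb : 0 < K * gap n b by exact: mulr_gt0.
have [_ _ [-> a1 _ _]] := iterate_near_curve_scaled (leqnn `|q n|).
have a3 := iterate_near_curve (leqnn `|q n|); rewrite gapq in a1 a3.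
have a6 := return_gap; have a7 := return_displacement.
exists (K * gap n b / 4); first exact: divr_gt0.
have eb : eta * gap n b <= 50^-1 * gap n b by rewrite ler_pM2r.
have eb' : eta * gap n b' <= 50^-1 * gap n b' by rewrite ler_pM2r.
have gb3 : gap n b <= 2 * gap n b' by lra.
have gb4 : gap n b / 4 <= gap n x.
  by move: gxb; rewrite ler_norml => /andP[h1 _]; lra.
split.
- by rewrite -mulrA /H ler_pM2l.
- by apply: le_trans a1; rewrite -!mulrA ler_pM2l//; lra.
have -> : iter `|q n| f (x +i* H x) - (p n)%:~R - (x +i* H x) =
   (iter `|q n| f (x +i* H x) - (act `|q n|%N x +i* H (act `|q n|%N x)))
   + ((act `|q n|%N x - (p n)%:~R - x)%:C + 'i * (K * (gap n (act `|q n|%N x) - gap n x))%:C).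
  rewrite (CintE _ (p n)).
  rewrite mulrBr -/(H x) -/(H (act _ x)).
  move: ((p n)%:~R : R) (act _ x) (H (act _ x)) (H x) (iter _ f _) => u1 u2 u3 u4 w.
  by apply: complex_ext; rewrite !(ReD, ReN, ImD, ImN, ReM, ImM) /=; ring.
apply: le_trans (ncD _ _) _.
have c1 := ncD ((act `|q n|%N x - (p n)%:~R - x)%:C)
  ('i * (K * (gap n (act `|q n|%N x) - gap n x))%:C).
rewrite [N ('i * _)]ncM nc_i mul1r !nc_real normrM [`|K|]gtr0_norm// in c1.
have c2 : K * `|gap n (act `|q n|%N x) - gap n x| <= K * (15 * eta * gap n b).
  by rewrite ler_pM2l.
have c3 : (1 + K) * gap n b' <= 5 / 2 * (K * gap n b).
  have h1 : (1 + K) * gap n b' <= (2 * K) * gap n b' by rewrite ler_pM2r//; lra.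
  have h2 : K * gap n b' <= K * (5 / 4 * gap n b).
    by rewrite ler_pM2l//; lra.
  by lra.
have c4 : eta * ((1 + K) * gap n b') <= eta * (5 / 2 * (K * gap n b)) by rewrite ler_pM2l.
have c5 : (8 / K + 80 * eta) * (K * gap n b / 4) = 2 * gap n b + 20 * K * (eta * gap n b).
  by move: (gap n b) => u; field; rewrite gt_eqF.
rewrite c5.
by lra.
Qed.

End Orbit.

(** The number [s] bounds from below the heights of the two points which are compared, so each
    quotient of a distance by [s] bounds a hyperbolic distance. The first statement
    holds on a neighbourhood of the region under the curve, of twice its height. *)
Lemma curve_estimates (K eta : R) : 1 <= K -> 0 < eta <= 50^-1 ->
  exists n0, forall n, (n0 <= n)%N -> forall x,
  let H t := K * gap n t in
  let z : C := x +i* H x in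
  [/\ forall y, `|y| <= 2 * H x -> forall j, (j <= `|q n|)%N ->
        `|complex.Im (iter j f (x +i* y))| < Delta,
      forall j, (j <= `|q n|)%N -> exists2 s, 0 < s &
        [/\ s <= complex.Im (iter j f z), s <= H (act j x) &
            N (iter j f z - (act j x +i* H (act j x))) <= 8 * eta * s] &
      exists2 s, 0 < s &
        [/\ s <= H x, s <= complex.Im (iter `|q n| f z) &
            N (iter `|q n| f z - (p n)%:~R - z) <= (8 / K + 80 * eta) * s]].
Proof.
move=> K1 e01; have /andP[e0 e1] := e01.
have K10 : 0 <= 4 * K + 4 by lra.
have K3 : 3 <= 4 * K + 4 by lra.
have e02 : 0 < eta <= 1 by rewrite e0 /=; lra.
(* in the charts, the region of height [2 * H] has size at most [4 * K + 4] *)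
have [n0 Hn0] := shadowing Delta_gt0 f_ext Re_Df g_incr g_per gK hK alphaE alpha_irr K10 e02.
exists n0 => n nn x H z; have [y xy [s0 s1 g1 g2]] := Hn0 n nn x.
have [b [b' [sb bE [gb1 gb2] gxb xb]]] := base_point K3 e01 xy s0 s1 g1 g2.
split.
- move=> t ht j hj.
  by have [] := sb j _ (leq_trans hj (cvg_den_le n)) (chart_vertical K1 e1 gxb xb ht).
- move=> j hj; have [s s_gt0 [_ a1 a2 a3]] := iterate_near_curve_scaled K1 e0 e1 sb gxb xb hj.
  by exists s.
exact: (return_estimate K1 e0 e1 sb gxb xb bE gb1 gb2).
Qed.

End CurveEstimates.

(** * The exterior of the disk and its covering *)

Section OuterCover.
Variable R : realType.
Local Notation C := R[i].
Local Notation N := (@Normc.normc R).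
Local Notation oc := (@outer_cover R).

Lemma nc_oc z : N (oc z) = expR (2 * pi * complex.Im z).
Proof.
rewrite /outer_cover /=; set e := expR _; set t := 2 * pi * _.
have -> : (e * cos t) ^+ 2 + (e * sin t) ^+ 2 = e ^+ 2 * (cos t ^+ 2 + sin t ^+ 2) by ring.
by rewrite cos2Dsin2 mulr1 sqrtr_sqr gtr0_norm// expR_gt0.
Qed.

Lemma cos_sin_int (t : R) (k : int) :
  cos (t + 2 * pi * k%:~R) = cos t /\ sin (t + 2 * pi * k%:~R) = sin t.
Proof.
have nat_case (s : R) (n : nat) :
    cos (s + 2 * pi * n%:R) = cos s /\ sin (s + 2 * pi * n%:R) = sin s.
  have -> : 2 * pi * n%:R = (pi *+ 2) *+ n :> R by rewrite -[RHS]mulr_natr -[pi *+ 2]mulr_natl.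
  by split; [exact: (periodicn (@cosD2pi R)) | exact: (periodicn (@sinD2pi R))].
case: k => n; first exact: nat_case.
have [h1 h2] := nat_case (t + 2 * pi * (Negz n)%:~R) n.+1.
have e : t + 2 * pi * (Negz n)%:~R + 2 * pi * n.+1%:R = t.
  by rewrite NegzE mulrNz mulrN subrK.
by rewrite -h1 -h2 e.
Qed.

Lemma oc_int z (k : int) : oc (z + k%:~R) = oc z.
Proof.
rewrite (CintE _ k).
rewrite /outer_cover ReD ImD /= addr0 [2 * pi * (_ + k%:~R)]mulrDr.
by have [-> ->] := cos_sin_int (2 * pi * complex.Re z) k.
Qed.

Lemma cos_eq1 (t : R) : cos t = 1 -> exists k : int, t = 2 * pi * k%:~R.
Proof.
move=> ct; have p0 : 0 < pi :> R by exact: pi_gt0.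
have pp : 0 < 2 * pi :> R by rewrite mulr_gt0.
pose k := Num.floor (t / (2 * pi)); exists k.
have := floor_itv (t / (2 * pi)); rewrite -/k rmorphD /= => /andP[h1 h2].
rewrite ler_pdivlMr// in h1; rewrite ltr_pdivrMr// in h2.
pose s := t - 2 * pi * k%:~R.
have cs : cos s = 1.
  by rewrite /s -mulrN -mulrNz; have [-> _] := cos_sin_int t (- k).
have s0 : 0 <= s by rewrite /s; lra.
have s2 : s < 2 * pi by rewrite /s; lra.
suff : s = 0 by rewrite /s; lra.
have z0 : (0 : R) \in `[0, pi] by rewrite in_itv/= lexx ltW.
have [sp|sp] := leP s pi.
  by apply: cos_inj => //; [rewrite in_itv/= s0 | rewrite cos0].
have : 2 * pi - s = 0.
  apply: cos_inj => //; first by rewrite in_itv/=; apply/andP; split; lra.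
  have [e _] := cos_sin_int (- s) 1; rewrite mulr1 in e.
  by rewrite addrC e cosN cs cos0.
lra.
Qed.

Lemma oc_inj z w : oc z = oc w -> exists k : int, z = w + k%:~R.
Proof.
move=> E.
have pp : 2 * pi != 0 :> R by rewrite mulf_neq0// gt_eqF// pi_gt0.
have eN : complex.Im z = complex.Im w.
  by have := congr1 N E; rewrite !nc_oc => /expR_inj; exact: mulfI.
have e0 : expR (2 * pi * complex.Im w) != 0 by rewrite gt_eqF// expR_gt0.
move: E; rewrite /outer_cover eN => -[/(mulfI e0) ec /(mulfI e0) es].
have [k hk] : exists k : int, 2 * pi * complex.Re z - 2 * pi * complex.Re w = 2 * pi * k%:~R.
  by apply: cos_eq1; rewrite cosB ec es -!expr2 cos2Dsin2.
exists k; rewrite (CintE _ k).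
apply: complex_ext; rewrite ?ReD ?ImD /= ?addr0//.
by apply: (mulfI pp); rewrite [RHS]mulrDr -hk; ring.
Qed.

Lemma oc_surj w : w != 0 -> exists z, [/\ oc z = w, 0 <= complex.Re z & complex.Re z <= 1].
Proof.
move=> w0; have Nw : 0 < N w by rewrite nc_gt0.
suff [z hz] : exists z, oc z = w.
  exists (z - (Num.floor (complex.Re z))%:~R).
  rewrite (CintE _ (Num.floor (complex.Re z))).
  have := floor_itv (complex.Re z); rewrite rmorphD /= => /andP[h1 h2].
  rewrite ReD ReN /=; split; [|lra..].
  rewrite -hz -[in RHS](oc_int _ (- Num.floor (complex.Re z))) mulrNz.
  by rewrite rmorph_int.
have pp : 2 * pi != 0 :> R by rewrite mulf_neq0// gt_eqF// pi_gt0.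
pose a := complex.Re w / N w; pose b := complex.Im w / N w.
have ab : a ^+ 2 + b ^+ 2 = 1.
  by rewrite /a /b !expr_div_n -mulrDl -nc_sq divff// expf_neq0// gt_eqF.
have a1 : -1 <= a <= 1.
  rewrite -ler_norml -(@ler_pXn2r _ 2) ?nnegrE// real_normK ?num_real// expr1n.
  by have := sqr_ge0 b; lra.
have [t ct st] : exists2 t, cos t = a & sin t = b.
  have ca : cos (acos a) = a by apply: acosK; rewrite in_itv.
  have sa : sin (acos a) = `|b|.
    rewrite sin_acos//; have -> : 1 - a ^+ 2 = b ^+ 2 by lra.
    by rewrite sqrtr_sqr.
  have [b0|b0] := leP 0 b.
    by exists (acos a) => //; rewrite sa ger0_norm.
  by exists (- acos a); rewrite ?cosN// sinN sa ltr0_norm// opprK.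
exists ((t / (2 * pi)) +i* (ln (N w) / (2 * pi))).
rewrite /outer_cover /= ![2 * pi * (_ / _)]mulrC !mulfVK// lnK ?posrE// ct st.
by apply: complex_ext => /=; rewrite mulrC mulfVK// gt_eqF.
Qed.

Lemma oc_continuous (T : topologicalType) (u v : T -> R) (t : T) :
  {for t, continuous u} -> {for t, continuous v} ->
  {for t, continuous (fun s => oc (u s +i* v s))}.
Proof.
move=> cu cv.
have c2 (k : T -> R) : {for t, continuous k} -> {for t, continuous (fun s => 2 * pi * k s)}.
  by move=> ck; apply: cvgM; [exact: cvg_cst | exact: ck].
have ce : {for t, continuous (fun s => expR (2 * pi * v s))}.
  by apply: continuous_comp; [exact: c2 | exact: continuous_expR].
apply: continuous_complex.
  apply: cvgM; first exact: ce.
  by apply: continuous_comp; [exact: c2 | exact: continuous_cos].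
apply: cvgM; first exact: ce.
by apply: continuous_comp; [exact: c2 | exact: continuous_sin].
Qed.

End OuterCover.

Section PoincareDistance.
Variable R : realType.
Local Notation C := R[i].
Local Notation N := (@Normc.normc R).
Local Notation oc := (@outer_cover R).

Definition affine (a b t : R) : R := a + t * (b - a).

Lemma affine_derive (a b t : R) : is_derive t 1 (affine a b) (b - a).
Proof.
apply: is_derive_eps => eps eps0; exists 1 => // s _.
have -> : affine a b s - affine a b t - (b - a) * (s - t) = 0 by rewrite /affine; ring.
by rewrite normr0 mulr_ge0// ltW.
Qed.

Lemma affine_derive1 (a b : R) : derive1 (affine a b) = fun=> b - a.
Proof.
apply/funext => t; rewrite derive1E; have H := affine_derive a b t.
exact: derive_val.
Qed.

Lemma affine_continuous (a b : R) : continuous (affine a b).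
Proof.
move=> t; apply: cvgD; first exact: cvg_cst.
by apply: cvgM; [exact: cvg_id | exact: cvg_cst].
Qed.

Lemma affine_C1 (a b : R) : C1 (affine a b).
Proof.
split; first by move=> t; have H := affine_derive a b t; exact: ex_derive.
by rewrite affine_derive1 => t; exact: cvg_cst.
Qed.

(** The distance is at most the length of the Euclidean segment, along which the height is at
    least [s]. *)
Lemma poincare_dist_le (z1 z2 : C) (s e : R) : 0 < s ->
  s <= complex.Im z1 -> s <= complex.Im z2 -> N (z1 - z2) <= e * s ->
  (poincare_dist (oc z1) (oc z2) <= e%:E)%E.
Proof.
move=> s0 h1 h2 he.
pose x := affine (complex.Re z1) (complex.Re z2).
pose y := affine (complex.Im z1) (complex.Im z2).
have ys t : 0 <= t <= 1 -> s <= y t.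
  by move=> /andP[t0 t1]; rewrite /y /affine; nra.
have len : (hyperbolic_length x y <= e%:E)%E.
  rewrite /hyperbolic_length /x /y !affine_derive1.
  set D := Num.sqrt _.
  have DE : D = N (z1 - z2).
    by rewrite ncC /D; case: (z1); case: (z2).
  have m1 : measurable_fun (`[0%R, 1%R]%classic : set (measurableTypeR R))
      (fun t : measurableTypeR R => D / affine (complex.Im z1) (complex.Im z2) t : measurableTypeR R).
    apply: measurable_realfun.subspace_continuous_measurable_fun.
      exact: measurable_itv.
    apply: continuous_in_subspaceT => t; rewrite inE /= in_itv /= => ht.
    apply: cvgM; first exact: cvg_cst.
    apply: cvgV; last exact: affine_continuous.
    by rewrite gt_eqF//; apply: lt_le_trans (ys t ht).
  apply: (@le_trans _ _ (\int[lebesgue_measure]_(t in `[0%R, 1%R]) e%:E)%E).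
    apply: ge0_le_integral => //=.
    - move=> t; rewrite in_itv/= => /ys yt; rewrite lee_fin divr_ge0 ?sqrtr_ge0//.
      by apply: le_trans yt; exact: ltW.
    - by apply/measurable_realfun.measurable_EFinP; exact: m1.
    move=> t; rewrite in_itv/= => /ys yt; rewrite lee_fin.
    have y0 : 0 < y t by apply: lt_le_trans yt.
    rewrite ler_pdivrMr//; have e0 : 0 <= e.
      by rewrite -(pmulr_lge0 _ s0); apply: le_trans he; exact: nc_ge0.
    rewrite DE; apply: le_trans he _; exact: ler_wpM2l.
  rewrite integral_cst /=; last exact: measurable_itv.
  by rewrite lebesgue_measure_itv /= lte_fin ltr01 sube0 mule1.
apply: le_trans len; apply: ereal_inf_lbound => /=.
exists x, y; split => //.
- by split; exact: affine_C1.
- by move=> t; rewrite in_itv/= => /ys; exact: lt_le_trans.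
- by congr oc; apply: complex_ext; rewrite /= /x /y /affine; ring.
- by congr oc; apply: complex_ext; rewrite /= /x /y /affine; ring.
Qed.

End PoincareDistance.

Section GraphNeighbourhood.
Variable R : realType.
Local Notation C := R[i].
Local Notation N := (@Normc.normc R).
Local Notation oc := (@outer_cover R).

Variable H : R -> R.
Hypothesis H_cont : continuous H.
Hypothesis H_gt0 : forall x, 0 < H x.
Hypothesis H_per : forall x (k : int), H (x + k%:~R) = H x.

(** A neighbourhood of the closed annulus on which all the iterates are controlled; its lift is
    symmetric about the real line, so that it is open at the points of the circle. *)
Definition graph_nbhs : set R[i]^o :=
  [set w | exists z : C, `|complex.Im z| < 2 * H (complex.Re z) /\ oc z = w].

Definition graph_curve (t : R) : R[i]^o := oc (t +i* H t).

Lemma H_bounded : exists2 M, 0 < M & forall x, H x <= M.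
Proof.
have [c _ hc] : exists2 c : R, c \in `[(0:R), 1] & forall t, t \in `[(0:R), 1] -> H t <= H c.
  apply: EVT_max; first exact: ler01.
  exact: continuous_subspaceT.
exists (H c) => // x.
rewrite -[x](subrK (Num.floor x)%:~R) H_per; apply: hc.
have := floor_itv x; rewrite rmorphD /= in_itv/= => /andP[? ?].
by apply/andP; split; lra.
Qed.

Lemma oc_eq_graph z w : oc z = oc w ->
  complex.Im z = complex.Im w /\ H (complex.Re z) = H (complex.Re w).
Proof.
move=> /oc_inj[k ->]; rewrite (CintE _ k).
by rewrite ImD ReD /= addr0 H_per.
Qed.

Lemma compact_oc_image (A : set (R * R)) (a b c d : R) :
  closed A -> A `<=` `[a, b] `*` `[c, d] ->
  closed ((fun p : R * R => oc (p.1 +i* p.2) : R[i]^o) @` A).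
Proof.
move=> cA sub; apply: compact_closed; first exact: norm_hausdorff.
apply: continuous_compact.
  apply: continuous_subspaceT => p.
  by apply: oc_continuous; [exact: cvg_fst | exact: cvg_snd].
by apply: (subclosed_compact cA (@compact_rect R a b c d) sub).
Qed.

Lemma closed_le2 (u v : R * R -> R) : continuous u -> continuous v ->
  closed [set p : R * R | u p <= v p].
Proof.
move=> cu cv.
have -> : [set p : R * R | u p <= v p] = (fun p => v p - u p) @^-1` [set x : R | 0 <= x].
  by apply/seteqP; split => p /=; rewrite subr_ge0.
apply: preimage_closed; last exact: closed_ge.
by move=> p _; apply: cvgB; [exact: cv | exact: cu].
Qed.

Lemma cfst : continuous (fun p : R * R => p.1). Proof. by move=> p; exact: cvg_fst. Qed.
Lemma csnd : continuous (fun p : R * R => p.2). Proof. by move=> p; exact: cvg_snd. Qed.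
Lemma cHfst : continuous (fun p : R * R => H p.1).
Proof. by move=> p; apply: continuous_comp; [exact: cfst | exact: H_cont]. Qed.
Lemma ccst (c : R) : continuous (fun _ : R * R => c).
Proof. by move=> p; exact: cvg_cst. Qed.

Lemma closed_strip01 (A : set (R * R)) : closed A ->
  closed (A `&` [set p | 0 <= p.1] `&` [set p | p.1 <= 1]).
Proof.
move=> cA; apply: closedI; first apply: closedI => //.
  apply: closed_le2; [exact: ccst | exact: cfst].
apply: closed_le2; [exact: cfst | exact: ccst].
Qed.

(** The complement is closed: it is the union of the points with too large or too small
    modulus and of the image of a compact set. Working with a compact set of lifts
    avoids the openness of the covering. *)
Lemma graph_nbhs_open : open graph_nbhs.
Proof.
have [M M0 HM] := H_bounded.
pose B := 2 * M + 1; have B0 : 0 < B by rewrite /B; lra.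
have pp : 0 < 2 * pi :> R by rewrite mulr_gt0// pi_gt0.
pose A : set (R * R) :=
  [set p | 2 * H p.1 <= `|p.2|] `&` [set p | - B <= p.2] `&` [set p | p.2 <= B].
have cA : closed A.
  apply: closedI; first apply: closedI.
  - apply: closed_le2.
      by move=> p; apply: cvgM; [exact: cvg_cst | exact: cHfst].
    by move=> p; apply: continuous_comp; [exact: csnd | exact: norm_continuous].
  - apply: closed_le2; [exact: ccst | exact: csnd].
  - apply: closed_le2; [exact: csnd | exact: ccst].
pose F1 : set R[i]^o := [set w | N w <= expR (- (2 * pi * B))].
pose F2 : set R[i]^o := [set w | expR (2 * pi * B) <= N w].
pose F3 : set R[i]^o :=
  (fun p : R * R => oc (p.1 +i* p.2) : R[i]^o) @` (A `&` [set p | 0 <= p.1] `&` [set p | p.1 <= 1]).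
rewrite -(setCK graph_nbhs); apply: closed_openC.
have -> : ~` graph_nbhs = F1 `|` F2 `|` F3.
  apply/seteqP; split => w.
    move=> nw; have [->|w0] := eqVneq w 0.
      by left; left; rewrite /F1; change (N 0 <= expR (- (2 * pi * B))); rewrite nc0 expR_ge0.
    have [z [zw z0 z1]] := oc_surj w0.
    have hz : 2 * H (complex.Re z) <= `|complex.Im z|.
      by rewrite leNgt; apply/negP => hz; apply: nw; exists z.
    have [zB|zB] := leP `|complex.Im z| B.
      right; exists (complex.Re z, complex.Im z); last by rewrite /= -zw; case: (z).
      by move: zB; rewrite ler_norml => /andP[? ?]; split => //; split => //; split => //; split.
    left; move: zB; rewrite ltr_normr => /orP[zB|zB]; [right|left].
      by rewrite /F2 /= -zw nc_oc ler_expR ler_pM2l// ltW.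
    by rewrite /F1 /= -zw nc_oc ler_expR -mulrN ler_pM2l// lerNr ltW.
  move=> hw [z [hz zw]].
  have zB : `|complex.Im z| < B.
    by apply: lt_trans hz _; have := HM (complex.Re z); rewrite /B; lra.
  move: zB; rewrite ltr_norml => /andP[zB1 zB2].
  case: hw => [[|]|[p [[[[Ap1 _] _] _] _] pw]].
  - by rewrite /F1 /= -zw nc_oc ler_expR -mulrN ler_pM2l// leNgt zB1.
  - by rewrite /F2 /= -zw nc_oc ler_expR ler_pM2l// leNgt zB2.
  have [e1 e2] := oc_eq_graph (etrans pw (esym zw)).
  by rewrite /= in e1 e2 Ap1; rewrite -e1 -e2 ltNge Ap1 in hz.
apply: closedU; first apply: closedU.
- apply: (@preimage_closed _ _ (N : R[i]^o -> R) [set x | x <= _]); last exact: closed_le.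
  by move=> w _; exact: continuous_normc.
- apply: (@preimage_closed _ _ (N : R[i]^o -> R) [set x | _ <= x]); last exact: closed_ge.
  by move=> w _; exact: continuous_normc.
apply: (@compact_oc_image _ 0 1 (- B) B); first exact: closed_strip01.
move=> p [[[[_ h1] h2] h3] h4]; split; rewrite /= in_itv/=; apply/andP; split => //.
Qed.

Lemma graph_curve_image x : curve_image graph_curve (graph_curve x).
Proof.
exists (x - (Num.floor x)%:~R) => /=.
  have := floor_itv x; rewrite rmorphD /= in_itv/= => /andP[? ?].
  by apply/andP; split; lra.
rewrite /graph_curve -mulrNz H_per.
have -> : ((x + (- Num.floor x)%:~R) +i* H x) = (x +i* H x) + (- Num.floor x)%:~R :> C.
  rewrite (CintE _ (- Num.floor x)).
  by apply: complex_ext; rewrite ?ReD ?ImD /= ?addr0.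
exact: oc_int.
Qed.

Lemma graph_curve_continuous : continuous graph_curve.
Proof. by move=> t; apply: oc_continuous; [exact: cvg_id | exact: H_cont]. Qed.

Lemma graph_curve_jordan : jordan_curve graph_curve.
Proof.
split.
- by apply: continuous_subspaceT; exact: graph_curve_continuous.
- rewrite /graph_curve; have := oc_int (0 +i* H 0) 1.
  have -> : (0 +i* H 0) + 1%:~R = 1 +i* H 1 :> C.
    have := H_per 0 1; rewrite add0r => ->.
    by apply: complex_ext => /=; rewrite ?ReD ?ImD /= ?addr0 ?add0r.
  by [].
move=> s t; rewrite !in_itv/= => /andP[s0 s1] /andP[t0 t1] /oc_inj[k].
rewrite (CintE _ k).
move=> /(congr1 (@complex.Re R)); rewrite ReD /= => e.
have k1 : (-1 < k)%R.
  by rewrite -(ltr_int R) [(-1)%:~R]mulrNz; lra.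
have k2 : (k < 1)%R by rewrite -(ltr_int R); lra.
have k0 : k = 0 by lia.
by rewrite e k0 addr0.
Qed.

Lemma graph_curve_homotopic : homotopic_to_circle graph_curve.
Proof.
exists (fun p : R * R => oc (p.2 +i* (p.1 * H p.2))); split.
  apply: continuous_subspaceT => p; apply: oc_continuous; first exact: csnd.
  apply: cvgM; first exact: cfst.
  by apply: continuous_comp; [exact: csnd | exact: H_cont].
move=> s t hs _; have /andP[s0 _] : 0 <= s <= 1 by move: hs; rewrite in_itv.
split.
- by rewrite /= mul0r.
- by rewrite /= mul1r.
- rewrite /=; have := oc_int (0 +i* (s * H 0)) 1.
  have -> : (0 +i* (s * H 0)) + 1%:~R = 1 +i* (s * H 1) :> C.
    have := H_per 0 1; rewrite add0r => ->.
    by apply: complex_ext => /=; rewrite ?ReD ?ImD /= ?addr0 ?add0r.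
  by move=> ->.
rewrite nc_oc -expR0 ler_expR /= mulr_ge0//; first by rewrite mulr_ge0// pi_ge0.
by apply: mulr_ge0 => //; exact: ltW.
Qed.

Lemma graph_curve_outside z : curve_image graph_curve z -> 1 < N z.
Proof.
move=> [t _ <-]; rewrite /graph_curve nc_oc expR_gt1 /=.
by rewrite !mulr_gt0// pi_gt0.
Qed.

(** A point above the graph is joined to infinity by a vertical half-line, whose image is
    connected, unbounded, and avoids the curve; so the annulus is in the image of
    the region under the graph, and this image is closed. *)
Lemma closure_annulus_below :
  closure (annulus_below (curve_image graph_curve)) `<=` graph_nbhs.
Proof.
have [M M0 HM] := H_bounded.
have pp : 0 < 2 * pi :> R by rewrite mulr_gt0// pi_gt0.
pose A : set (R * R) := [set p | 0 <= p.2] `&` [set p | p.2 <= H p.1].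
have cA : closed A.
  apply: closedI; first by apply: closed_le2; [exact: ccst | exact: csnd].
  apply: closed_le2; [exact: csnd | exact: cHfst].
pose F : set R[i]^o :=
  (fun p : R * R => oc (p.1 +i* p.2) : R[i]^o) @` (A `&` [set p | 0 <= p.1] `&` [set p | p.1 <= 1]).
have cF : closed F.
  apply: (@compact_oc_image _ 0 1 0 M); first exact: closed_strip01.
  move=> p [[[h1 h2] h3] h4]; split; rewrite /= in_itv/=; apply/andP; split => //.
  by apply: le_trans h2 _; exact: HM.
have sub : annulus_below (curve_image graph_curve) `<=` F.
  move=> w [w1 nw bw].
  have w0 : w != 0 by rewrite -nc_gt0; apply: lt_trans w1.
  have [z [zw z0 z1]] := oc_surj w0.
  have Imz : 0 < complex.Im z.
    by move: w1; rewrite -zw nc_oc expR_gt1 pmulr_rgt0.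
  have [zH|zH] := leP (complex.Im z) (H (complex.Re z)).
    exists (complex.Re z, complex.Im z); last by rewrite /= -zw; case: (z).
    by split => //; split => //; split => //=; exact: ltW.
  exfalso.
  pose ray := (fun s => oc (complex.Re z +i* s) : R[i]^o) @` [set` `[complex.Im z, +oo[].
  have ray_conn : connected ray.
    apply: connected_continuous_connected; first exact/connected_intervalP/interval_is_interval.
    apply: continuous_subspaceT => s.
    by apply: (@oc_continuous R R (fun=> complex.Re z) id); [exact: cvg_cst | exact: cvg_id].
  have ray_w : ray w.
    exists (complex.Im z); first by rewrite /= in_itv/= lexx.
    by rewrite -zw; case: (z).
  have ray_sub : ray `<=` ~` curve_image graph_curve.
    move=> v [s hs <-] [t _ /oc_eq_graph[/= e1 e2]].
    by move: hs; rewrite /= in_itv/= andbT; rewrite -e1 e2; lra.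
  have := connected_component_max ray_w ray_sub ray_conn => ray_comp.
  move: bw => [m [mr hm]].
  have mE : m = (complex.Re m)%:C by rewrite RRe_real.
  pose s := Num.max (complex.Im z) ((complex.Re m + 1) / (2 * pi)).
  have hs : ray (oc (complex.Re z +i* s)).
    by exists s => //=; rewrite in_itv/= andbT le_max lexx.
  have := hm (m + 1) _ _ (ray_comp _ hs).
  rewrite ltrDl => /(_ ltr01).
  move=> hle0; have : (N (oc (complex.Re z +i* s)))%:C <= m + 1 by exact: hle0.
  rewrite mE -(rmorph1 (real_complex R)) -rmorphD lecR nc_oc /= => hle.
  have h1 : (complex.Re m + 1) <= 2 * pi * s.
    by rewrite -ler_pdivrMl// mulrC le_max lexx orbT.
  have := expR_ge1Dx (2 * pi * s); lra.
move=> w hw; have : closure F w by apply: closureS hw.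
rewrite -(closure_id F).1// => -[p [[[h1 h2] _] _] <-].
exists (p.1 +i* p.2); split => //=.
rewrite /= in h1 h2; rewrite ger0_norm//; have := H_gt0 p.1; lra.
Qed.

End GraphNeighbourhood.

Section InducedMap.
Variable R : realType.
Local Notation C := R[i].
Local Notation N := (@Normc.normc R).
Local Notation oc := (@outer_cover R).
Variables (Delta : R) (g : R -> R) (V : set R[i]^o) (f : R[i]^o -> R[i]^o).
Hypothesis f_ext : holo_diffeo_extension Delta g V f.

(** The two lifts of a point differ by an integer, with which [f] commutes. *)
Lemma annulus_map_oc z : V z -> annulus_map f (oc z) = oc (f z).
Proof.
move=> Vz; rewrite /annulus_map; case: xgetP => [w _ /oc_inj[k wE]|].
  by rewrite wE (ext_int f_ext k Vz) oc_int.
by move=> /(_ z); case.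
Qed.

Lemma iter_annulus_map_oc j z :
  (forall i, (i < j)%N -> V (iter i f z)) ->
  iter j (annulus_map f) (oc z) = oc (iter j f z).
Proof.
elim: j => // j IH h; rewrite !iterS IH; last by move=> i ij; apply: h; exact: ltnW.
by apply: annulus_map_oc; exact: h.
Qed.

Lemma iter_defined_oc j z :
  (forall i, (i < j)%N -> V (iter i f z)) -> iter_defined V f j (oc z).
Proof.
move=> h i ij; rewrite iter_annulus_map_oc; last by move=> k ki; apply: h; exact: ltn_trans ij.
by exists (iter i f z) => //; exact: h.
Qed.

End InducedMap.

(** * The almost invariant curves *)

Lemma hausdorff_dist_le (R : realType) (T : Type) (d : T -> T -> \bar R)
    (A B : set T) (e : \bar R) :
  (forall a, A a -> exists2 b, B b & (d a b <= e)%E) ->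
  (forall b, B b -> exists2 a, A a & (d a b <= e)%E) ->
  (hausdorff_dist d A B <= e)%E.
Proof.
move=> hA hB; rewrite /hausdorff_dist ge_max; apply/andP; split.
  apply: ge_ereal_sup => _ [a /hA[b Bb le_e] <-].
  by apply: ge_ereal_inf; exists (d a b) => //; exists b.
apply: ge_ereal_sup => _ [b /hB[a Aa le_e] <-].
by apply: ge_ereal_inf; exists (d a b) => //; exists a.
Qed.

Theorem theorem16 (R : realType) (Delta : R) (g : R -> R)
    (V : set R[i]^o) (gc : R[i]^o -> R[i]^o) (alpha : R)
    (Delta_gt0 : 0 < Delta)
    (g_diffeo : circle_analytic_diffeo g)
    (gc_ext : holo_diffeo_extension Delta g V gc)
    (alphaE : alpha = rotation_number g)
    (alpha_irr : irrational alpha)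
    (Re_Dg : (0 < ereal_inf
       [set (complex.Re (derive1 gc z))%:E | z in strip Delta])%E)
    (DlogDg : (ereal_sup
       [set (Normc.normc (derive1 (fun u : R[i]^o => clog (derive1 gc u)) z))%:E
         | z in strip Delta] < (9^-1)%:E)%E)
    (C0 : R) (C0_gt0 : 0 < C0) :
  let q := convergent_den alpha in
  let G := annulus_map gc in
  exists (n0 : nat) (c : nat -> R -> R[i]^o), forall n, (n0 <= n)%N ->
    let gamma := curve_image (c n) in
    [/\ jordan_curve (c n) /\ homotopic_to_circle (c n),
        forall z, gamma z -> 1 < Normc.normc z,
        exists N : set R[i]^o,
          [/\ open N, closure (annulus_below gamma) `<=` N &
              forall j, (j <= q n)%N -> forall w, N w -> iter_defined V gc j w],
        forall j, (j <= q n)%N ->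
          (hausdorff_dist (@poincare_dist R) (iter j G @` gamma) gamma
             <= C0%:E)%E &
        (forall z, gamma z -> (poincare_dist (iter (q n) G z) z <= C0%:E)%E) /\
        (ereal_sup [set poincare_dist (iter (q n) G z) z | z in gamma]
             <= C0%:E)%E].
Proof.
move=> q G; have [g_incr g_per _ [h [gK hK _]]] := g_diffeo.
(* the two errors of the return map, [8 / K] and [80 * eta], get half of [C0] each *)
pose K := 16 / C0 + 1; pose eta := Num.min (50^-1) (C0 / 160).
have i0 : 0 < 16 / C0 by rewrite divr_gt0.
have K1 : 1 <= K by rewrite /K lerDr ltW.
have e01 : 0 < eta <= 50^-1.
  by rewrite /eta ge_min lexx andbT lt_min invr_gt0 ltr0n /=; apply: divr_gt0.
have etaC : 160 * eta <= C0.
  have : eta <= C0 / 160 by rewrite /eta ge_min lexx orbT.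
  lra.
have KC : 8 / K + 80 * eta <= C0.
  suff : 8 / K <= C0 / 2 by lra.
  have K0 : 0 < K by apply: lt_le_trans K1.
  rewrite ler_pdivrMr// /K mulrDr mulr1.
  have -> : C0 / 2 * (16 / C0) = 8 by field; rewrite gt_eqF.
  by rewrite lerDl divr_ge0// ltW.
have [n0 Hn0] := curve_estimates Delta_gt0 gc_ext Re_Dg g_incr g_per gK hK alphaE alpha_irr K1 e01.
pose H n t := K * gap g h alpha n t.
have lo := real_lower Delta_gt0 gc_ext Re_Dg g_incr.
have up := real_upper Delta_gt0 gc_ext g_incr g_per.
have H_cont n : continuous (H n).
  move=> t; apply: cvgM; first exact: cvg_cst.
  exact: (gap_continuous g_incr hK lo up).
have H_gt0 n t : 0 < H n t.
  apply: mulr_gt0; first by apply: lt_le_trans K1.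
  exact: (gap_gt0 g_incr g_per gK hK alphaE alpha_irr).
have H_per n t (k : int) : H n (t + k%:~R) = H n t.
  by rewrite /H (gap_addz g_per gK hK).
exists n0, (fun n => graph_curve (H n)) => n nn gamma.
have defd x y : `|y| <= 2 * H n x -> forall j, (j <= q n)%N -> V (iter j gc (x +i* y)).
  move=> hy j jq; have [h1 _ _] := Hn0 n nn x.
  by apply: (strip_sub gc_ext); exact: h1.
have iterE x j : (j <= q n)%N ->
    iter j G (graph_curve (H n) x) = outer_cover (iter j gc (x +i* H n x)).
  move=> jq; rewrite /graph_curve (iter_annulus_map_oc gc_ext)// => i ij.
  apply: defd; last by apply: leq_trans jq; exact: ltnW.
  by have := H_gt0 n x; rewrite ger0_norm; [lra | exact: ltW].
have near x j : (j <= q n)%N ->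
    (poincare_dist (iter j G (graph_curve (H n) x)) (graph_curve (H n) (act g h j x)) <= C0%:E)%E.
  move=> jq; rewrite iterE// /graph_curve; have [_ h2 _] := Hn0 n nn x.
  have [s s0 [s1 s2 s3]] := h2 j jq.
  apply: (@poincare_dist_le _ _ (act g h j x +i* H n (act g h j x)) s C0 s0 s1 s2).
  apply: le_trans s3 _.
  by apply: ler_wpM2r; [exact: ltW | lra].
have ret z : gamma z -> (poincare_dist (iter (q n) G z) z <= C0%:E)%E.
  move=> [x _ <-]; rewrite iterE// /graph_curve; have [_ _ h3] := Hn0 n nn x.
  have [s s0 [s1 s2 s3]] := h3.
  rewrite -(oc_int _ (- cvg_num alpha n)).
  apply: (@poincare_dist_le _ _ (x +i* H n x) s C0 s0 _ s1).
    rewrite (CintE _ (- cvg_num alpha n)).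
    by rewrite ImD /= addr0.
  rewrite rmorphN; apply: le_trans s3 _.
  by apply: ler_wpM2r; [exact: ltW | exact: KC].
split.
- by split; [exact: graph_curve_jordan | exact: graph_curve_homotopic].
- by move=> z; exact: graph_curve_outside.
- exists (graph_nbhs (H n)); split.
  + exact: graph_nbhs_open.
  + exact: closure_annulus_below.
  move=> j jq _ [z [hz <-]]; apply: (iter_defined_oc gc_ext) => i ij.
  have -> : z = complex.Re z +i* complex.Im z by case: (z).
  apply: defd; first exact: ltW.
  by apply: leq_trans jq; exact: ltnW.
- move=> j jq; apply: hausdorff_dist_le.
    move=> _ [_ [x _ <-] <-]; exists (graph_curve (H n) (act g h j x)) => //.
      exact: graph_curve_image.
    exact: near.
  move=> _ [t _ <-]; exists (iter j G (graph_curve (H n) (act g h (- j%:Z) t))).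
    by exists (graph_curve (H n) (act g h (- j%:Z) t)) => //; exact: graph_curve_image.
  have {2}-> : t = act g h j (act g h (- j%:Z) t) by rewrite -(actD gK hK) subrr.
  exact: near.
split=> //; apply: ge_ereal_sup => _ [z gz <-]; exact: ret.
Qed.
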